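(* There exists a unique function $$\langle\langle\ \cdot\ \rangle\rangle:\{\text{unoriented tied link diagrams}\}\to\mathbb{Z}[A^{\pm1},c]$$ defined by the following rules: (i) $\langle\langle O\rangle\rangle=1$; (ii) $\langle\langle O\sqcup D\rangle\rangle=c\,\langle\langle D\rangle\rangle$; (iii) $\langle\langle O\,\widetilde{\sqcup}\,D\rangle\rangle=-(A^2+A^{-2})\,\langle\langle D\rangle\rangle$; (iv) $\langle\langle\ \cdot\ \rangle\rangle$ is invariant under Reidemeister moves II and III; (v) $\langle\langle D\rangle\rangle=A\,\langle\langle D_A\rangle\rangle+A^{-1}\langle\langle D_B\rangle\rangle$ whenever $D$ has a crossing whose two strands belong to the same component or to components tied together, and $D_A,D_B$ are obtained from $D$ by replacing this crossing by its $A$-smoothing, respectively $B$-smoothing, with a tie joining the two arcs; (vi) $\langle\langle D_+\rangle\rangle+\langle\langle D_-\rangle\rangle=(A+A^{-1})\big(\langle\langle D_e\rangle\rangle+\langle\langle D_f\rangle\rangle\big)$ for all unoriented tied link diagrams $D_+,D_-,D_e,D_f$ identical outside a disc and inside this disc equal, respectively, to a crossing, the opposite crossing, and the two smoothings of the crossing, each with a tie joining its two arcs.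
   Context: $A,c$ are commuting independent variables. A tied link is a link together with a partition of the set of its components; the partition is depicted by ties: two components connected by one or more ties belong to the same subset of the partition (''tied together''). Only the partition matters. An unoriented tied link diagram is a (nonempty) unoriented link diagram in $S^2$ (up to isotopy of $S^2$) together with a partition of the set of components; Reidemeister moves keep the partition. $O$ is the crossingless diagram of one circle; $O\sqcup D$ is the disjoint union of $D$ with a crossingless circle not tied to $D$; $O\,\widetilde{\sqcup}\,D$ is the disjoint union with a crossingless circle tied to a component of $D$. Adding a tie between the two arcs of a smoothing puts all components passing through the disc into one class, which also contains all the other components that, before smoothing, belonged to the classes of the strands at the crossing; other classes are unchanged. The $A$-smoothing of a crossing is the one joining the two regions swept out when the overcrossing strand is rotated counterclockwise onto the undercrossing strand; the $B$-smoothing is the other one. *)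

(* Defs.v *)
From Stdlib Require Import Relations.
From mathcomp Require Import all_boot all_order all_algebra.

Set Implicit Arguments.
Unset Strict Implicit.
Unset Printing Implicit Defensive.

Import GRing.Theory.
Local Open Scope ring_scope.

(* Z[A^{+-1}, c], as a subring of its field of fractions Q(A, c); in
   {poly {poly int}} the outer variable is A and the inner one is c. *)
Definition Kfrac := {fraction {poly {poly int}}}.
Definition varA : Kfrac := FracField.tofrac 'X.
Definition varc : Kfrac := FracField.tofrac ('X%:P).
Definition is_laurent (x : Kfrac) : Prop :=
  exists (p : {poly {poly int}}) (n : nat), x = FracField.tofrac p / varA ^+ n.

(* A link diagram in the oriented sphere is recorded as a plane graph whose
   vertices are the crossings (degree 4) together with finitely many marked
   points (degree 2) on the arcs, at least one on each circle without crossings.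
   Darts are half-edges, each pointing away from the vertex it is attached to:
   - [edge x] is the other half of the edge of x;
   - [node x] is the next dart, counterclockwise, around the vertex of x;
   - [over x] says that x lies on the overcrossing strand; it is meaningful
     only when x is attached to a crossing;
   - [region x y] says that the region of the complement of the diagram lying
     immediately to the left of x (i.e. at the corner between x and [node x])
     is the same as the one for y. This is data: when the diagram is
     disconnected, one region may have several boundary circuits;
   - [tie x y] says that the components through x and y are in the same class
     of the partition of the set of components. *)
Record tgraph := TGraph {
  dart : finType;
  edge : dart -> dart;
  node : dart -> dart;
  over : pred dart;
  region : rel dart;
  tie : rel dart }.

Arguments edge {t} _.
Arguments node {t} _.
Arguments over {t} _.
Arguments region {t} _ _.
Arguments tie {t} _ _.

Definition equivalence (T : Type) (r : rel T) : Prop :=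
  [/\ reflexive r, symmetric r & transitive r].

Section TGraph.
Variable D : tgraph.
Implicit Types x y : dart D.

Definition crossing x : bool := node (node x) != x.

(* The dart by which a strand arriving at the vertex along x leaves it. *)
Definition opp x : dart D := node (node x).
Definition across x : dart D := if crossing x then opp x else node x.

Definition same_vertex x y : bool := fconnect node x y.

(* Adjacency for the connected components of the underlying graph... *)
Definition glink x y : bool := (edge x == y) || (node x == y).
(* ... and for the incidence structure between these and the regions. *)
Definition slink x y : bool := glink x y || region x y.

(* [td_euler] is Euler's formula V + R = E + 1 + K for a graph with K connected
   components in the sphere. Together with [td_conn] it forces every connected
   component to have genus 0 and the incidence graph between connected
   components and regions to be a tree, so that such data are exactly those
   coming from diagrams in the sphere. *)
Record is_diagram : Prop := IsDiagram {
  td_nonempty : (0 < #|dart D|)%N;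
  td_edgeK : involutive (@edge D);
  td_edge_neq : forall x, edge x != x;
  td_node4 : forall x, iter 4 node x = x;
  td_node_neq : forall x, node x != x;
  td_over : forall x, crossing x -> over (node x) = ~~ over x;
  td_region : equivalence (@region D);
  td_region_edge : forall x, region x (edge (node x));
  td_tie : equivalence (@tie D);
  td_tie_edge : forall x, tie x (edge x);
  td_tie_across : forall x, tie x (across x);
  td_conn : forall x y, connect slink x y;
  td_euler : (fcard (@node D) predT + n_comp (@region D) predT =
              fcard (@edge D) predT + (n_comp glink predT).+1)%N }.

End TGraph.

Record diagram := Diagram { dgm :> tgraph; dgmP : is_diagram dgm }.

(* For r an equivalence relation: the classes of a and b are merged. *)
Definition merge (T : Type) (r : rel T) (a b : T) : rel T :=
  fun x y => [|| r x y, r x a && r y b | r x b && r y a].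

Definition isom (D E : tgraph) : Prop :=
  exists h : dart D -> dart E,
    bijective h /\
    [/\ forall x, h (edge x) = edge (h x),
        forall x, h (node x) = node (h x),
        forall x, crossing x -> over (h x) = over x,
        forall x y, region (h x) (h y) = region x y &
        forall x y, tie (h x) (h y) = tie x y].

(* Insertion of a marked point in the edge of d: [inr false] is the new dart
   facing d, and [inr true] the one facing the former [edge d]. *)
Definition subdivide (D : tgraph) (d : dart D) : tgraph :=
  let parallel (u : (dart D + bool)%type) : dart D :=
    match u with inl x => x | inr false => edge d | inr true => d end in
  {| dart := (dart D + bool)%type;
     edge := fun u => match u with
       | inl x => if x == d then inr false
                  else if x == edge d then inr true else inl (edge x)
       | inr false => inl d
       | inr true => inl (edge d) end;
     node := fun u => match u with inl x => inl (node x) | inr i => inr (~~ i) end;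
     over := fun u => if u is inl x then over x else false;
     region := fun u v => region (parallel u) (parallel v);
     tie := fun u v => tie (parallel u) (parallel v) |}.

(* Isotopy in the sphere: diagrams are recorded up to (orientation-preserving)
   isomorphism and up to the choice of the marked points. *)
Definition isotopic : relation diagram :=
  clos_refl_sym_trans diagram
    (fun D E => isom D E \/ exists d : dart D, isom E (subdivide d)).

Definition circle : tgraph :=
  {| dart := bool : finType; edge := negb; node := negb; over := xpred0;
     region := fun i j => i == j; tie := fun _ _ => true |}.

Definition orel (T : Type) (r : rel T) : rel (option T) := fun u v =>
  match u, v with
  | Some x, Some y => r x y
  | None, None => true
  | _, _ => false
  end.

(* A crossingless circle bounding an empty disc is added inside the region to
   the left of d; it is tied to the component through e if t = Some e, and to
   nothing if t = None. *)
Definition add_circle (D : tgraph) (d : dart D) (t : option (dart D)) : tgraph :=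
  let left_of (u : (dart D + bool)%type) :=
    match u with inl x => Some x | inr false => Some d | inr true => None end in
  let tie_of (u : (dart D + bool)%type) := if u is inl x then Some x else t in
  let flip (u : (dart D + bool)%type) (x' : dart D -> dart D) :=
    match u with inl x => inl (x' x) | inr i => inr (~~ i) end in
  {| dart := (dart D + bool)%type;
     edge := fun u => flip u edge;
     node := fun u => flip u node;
     over := fun u => if u is inl x then over x else false;
     region := fun u v => orel region (left_of u) (left_of v);
     tie := fun u v => orel tie (tie_of u) (tie_of v) |}.

(* The crossing at d is replaced by two marked points, one joining d to
   [node d], the other one joining the two remaining darts, with a tie between
   the two new arcs. These arcs cut off the corners to the left of d and of
   [iter 2 node d]; the regions at the two other corners are merged. *)
Definition smooth (D : tgraph) (d : dart D) : tgraph :=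
  {| dart := dart D;
     edge := edge;
     node := [eta node with d |-> node d, node d |-> d,
               iter 2 node d |-> iter 3 node d, iter 3 node d |-> iter 2 node d];
     over := over;
     region := merge region (node d) (iter 3 node d);
     tie := merge tie d (node d) |}.

(* Rotating the overcrossing strand through d counterclockwise sweeps out the
   corner between d and [node d] and the opposite one; joining them connects
   [node d] to [iter 2 node d]. *)
Definition A_smoothing (D : tgraph) (d : dart D) : tgraph := smooth (node d).
Definition B_smoothing (D : tgraph) (d : dart D) : tgraph := smooth d.

Definition switch (D : tgraph) (d : dart D) : tgraph :=
  {| dart := dart D; edge := edge; node := node;
     over := fun x => over x (+) same_vertex d x;
     region := region; tie := tie |}.

(* a and b are the two sides of a bigonal region, which lies to their left; the
   side a goes over at both ends. *)
Definition bigon (D : tgraph) (a b : dart D) : Prop :=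
  [/\ crossing a && crossing b, ~~ same_vertex a b,
      edge a = node b /\ edge b = node a,
      forall x, region a x = (x \in [:: a; b]) &
      over a && over (edge a)].

(* The second Reidemeister move removing a bigon: the two strands pass through
   the two vertices of the bigon without meeting. [left_of x] is a dart whose
   former left region is the new left region of x; the regions at the two tips
   of the bigon are merged. *)
Definition remove_bigon (D : tgraph) (a b : dart D) : tgraph :=
  let left_of := [eta id with a |-> node a, edge a |-> opp a,
                              b |-> node b, edge b |-> opp a] in
  {| dart := dart D;
     edge := edge;
     node := fun x =>
       if same_vertex a x || same_vertex b x then opp x else node x;
     over := over;
     region := fun x y =>
       merge region (opp a) (opp b) (left_of x) (left_of y);
     tie := tie |}.

(* a, b, c are the successive sides of a triangular region, which lies to their
   left; the side a goes over at both ends. *)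
Definition triangle (D : tgraph) (a b c : dart D) : Prop :=
  [/\ [&& crossing a, crossing b & crossing c],
      [&& ~~ same_vertex a b, ~~ same_vertex b c & ~~ same_vertex c a],
      [/\ edge a = node b, edge b = node c & edge c = node a],
      forall x, region a x = (x \in [:: a; b; c]) &
      over a && over (edge a)].

(* The third Reidemeister move: the crossings are kept, and each of the three
   strands meets its two crossings in the reverse order. So if the strand
   containing the side {p, q} was  s - [opp p, p] - [q, opp q] - t, then it
   becomes  s - [q, opp q] - [opp p, p] - t. [outward] is the permutation
   p -> opp p -> q -> opp q -> p, and [inward] is its inverse. The region of the
   triangle moves to the opposite corner of each of its vertices, and [left_of]
   is as in [remove_bigon]. *)
Definition flip_triangle (D : tgraph) (a b c : dart D) : tgraph :=
  let side (x : dart D) := x \in [:: a; edge a; b; edge b; c; edge c] in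
  let outward (x : dart D) := if side x then opp x
    else if side (opp x) then edge (opp x) else x in
  let inward (x : dart D) := if side x then opp (edge x)
    else if side (opp x) then opp x else x in
  let left_of := [eta id with
    a |-> edge b, node a |-> opp c, opp a |-> a, node (opp a) |-> opp b,
    b |-> edge c, node b |-> opp a, opp b |-> a, node (opp b) |-> opp c,
    c |-> edge a, node c |-> opp b, opp c |-> a, node (opp c) |-> opp a] in
  {| dart := dart D;
     edge := fun x => outward (edge (inward x));
     node := node;
     over := over;
     region := fun x y => region (left_of x) (left_of y);
     tie := tie |}.

Record is_tied_bracket (f : diagram -> Kfrac) : Prop := IsTiedBracket {
  tb_laurent : forall D, is_laurent (f D);
  tb_isotopy : forall D E, isotopic D E -> f D = f E;
  tb_circle : forall D : diagram, isom D circle -> f D = 1;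
  tb_union : forall (D E : diagram) (d : dart D),
    isom E (add_circle d None) -> f E = varc * f D;
  tb_tied_union : forall (D E : diagram) (d e : dart D),
    isom E (add_circle d (Some e)) -> f E = - (varA ^+ 2 + varA ^- 2) * f D;
  tb_R2 : forall (D E : diagram) (a b : dart D),
    bigon a b -> isom E (remove_bigon a b) -> f D = f E;
  tb_R3 : forall (D E : diagram) (a b c : dart D),
    triangle a b c -> isom E (flip_triangle a b c) -> f D = f E;
  tb_skein : forall (D DA DB : diagram) (d : dart D),
    crossing d -> over d -> tie d (node d) ->
    isom DA (A_smoothing d) -> isom DB (B_smoothing d) ->
    f D = varA * f DA + varA^-1 * f DB;
  tb_switch : forall (D D' De Df : diagram) (d : dart D),
    crossing d -> isom D' (switch d) ->
    isom De (smooth d) -> isom Df (smooth (node d)) ->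
    f D + f D' = (varA + varA^-1) * (f De + f Df) }.

(* Main.v *)
From Stdlib Require Import Relations Classical IndefiniteDescription FunctionalExtensionality.
From mathcomp Require Import all_boot all_order all_algebra all_field.
From mathcomp Require Import ring.
Require Import Defs.

(* Uniqueness. Every diagram is reduced to circles by the moves appearing in the
   rules. If a crossing joins strands that are tied, smooth it. Otherwise
   crossings may be switched at the cost of diagrams with fewer crossings, so
   that only the underlying plane graph matters, and components do not cross
   themselves. Each component bounds a disc; take a disc of minimal area whose
   boundary is one closed strand or consists of two arcs of strands. It is a
   crossingless circle bounding an empty disc, or an empty bigon, to be removed
   by a move II, or it contains a triangular face resting on one of the two
   arcs; a move III across this triangle makes the disc smaller.

   Existence. Give each class of tied components one of N colours, and let the
   crossings between equally coloured strands be evaluated by Kauffman's state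
   model, with loop value M = -(a^2 + a^-2), while a crossing between strands of
   different colours is left as it is, with a sign that changes with the
   crossing. Write loops of value M as sums over M labels. The resulting state
   sum is N M times the value at A = a, c = N M of the bracket, and these values
   for all positive N, M determine an element of Z[A^{+-1}, c]. That they come
   from such an element follows from the same induction as uniqueness. *)

(** Diagrams are finite combinatorial data, so the topology of the sphere has to be recovered from
    Euler's formula. Over F_2 this formula is equivalent to the statement that every mod 2 cycle
    separates two colours of regions; the statement serves both as the Jordan curve theorem and as
    the invariant to be checked after a move. Labels turn the number of loops, a global quantity,
    into a sum of products of vertex weights. Every rule then becomes an identity between tensors at
    one, two or three vertices. The price is that the loop value must be a positive integer, which
    is why A runs through complex roots of A^2 + A^-2 = -M and Laurent polynomials are compared
    through their values. The sign at crossings of unequal colours answers rule (vi): the tied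
    smoothings admit no such colouring, so there the two crossings must cancel. Existence needs no
    confluence argument: the induction only shows that some Laurent polynomial has the prescribed
    values, and these values determine it. *)

Set Implicit Arguments.
Unset Strict Implicit.
Unset Printing Implicit Defensive.

Import GRing.Theory.
Local Open Scope ring_scope.

(** * Euler's formula and the Jordan property *)

Section ConnectMatrix.
Variables (T : finType) (e : rel T).
Hypothesis sym_e : connect_sym e.
Let n := #|T|.

(** [bool] is the field F_2, with xor as addition. The row space consists of the functions constant
    on components, so that numbers of components become ranks. *)
Definition connect_mx : 'M[bool]_n :=
  \matrix_(i, j) connect e (enum_val i) (enum_val j).

Definition row_of (f : T -> bool) : 'rV[bool]_n := \row_j f (enum_val j).

Lemma connect_mxP (v : 'rV_n) :
  reflect (forall x y, connect e x y -> v 0 (enum_rank x) = v 0 (enum_rank y))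
          (v <= connect_mx)%MS.
Proof.
apply: (iffP idP) => [/submxP[w ->] x y xy|inv_v].
  rewrite !mxE; apply: eq_bigr => k _; rewrite !mxE !enum_rankK.
  by rewrite ![connect e (enum_val k) _]sym_e (same_connect sym_e xy).
(* An invariant function is a combination of the indicators of components, one for each root. *)
have -> : v = \sum_(x | roots e x) v 0 (enum_rank x) *: row (enum_rank x) connect_mx.
  apply/rowP=> j; rewrite summxE; set y := enum_val j.
  rewrite (bigD1 (fingraph.root e y)) /=; last exact: roots_root.
  rewrite big1 ?addr0 => [|x /andP[rx xy]].
    rewrite !mxE enum_rankK -/y sym_e connect_root mulr1.
    by rewrite -(inv_v y) ?connect_root // enum_valK.
  rewrite !mxE enum_rankK -/y; case: (boolP (connect e x y)) => [exy|]; last by rewrite mulr0.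
  by case/eqP: xy; rewrite -(eqP rx); apply/(fingraph.rootP sym_e).
by apply: summx_sub => x _; apply: scalemx_sub; apply: row_sub.
Qed.

Lemma rank_connect_mx : \rank connect_mx = n_comp e predT.
Proof.
pose R : {set T} := [set x | roots e x].
have -> : n_comp e predT = #|R|.
  by apply: eq_card => x; rewrite !inE andbT.
pose B : 'M[bool]_(#|R|, n) := \matrix_(i, j) connect e (enum_val i) (enum_val j).
have BC : (B <= connect_mx)%MS.
  apply/row_subP=> i; apply/connect_mxP=> x y xy; rewrite !mxE !enum_rankK.
  by rewrite ![connect e (enum_val i) _]sym_e (same_connect sym_e xy).
have CB : (connect_mx <= B)%MS.
  apply/row_subP=> i; pose r := fingraph.root e (enum_val i).
  have rR : r \in R by rewrite inE roots_root.
  have -> : row i connect_mx = row (enum_rank_in rR r) B.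
    apply/rowP=> j; rewrite !mxE enum_rankK_in //.
    by rewrite (same_connect sym_e (connect_root e (enum_val i))).
  exact: row_sub.
have -> : \rank connect_mx = \rank B by apply/eqP; rewrite eqn_leq !mxrankS.
apply/eqP; rewrite -/(row_free B); apply/row_freeP.
pose S : 'M[bool]_(n, #|R|) := \matrix_(i, j) (enum_val i == enum_val j).
exists S; apply/matrixP=> i j; rewrite !mxE.
rewrite (bigD1 (enum_rank (enum_val j))) //= big1 ?addr0 => [|k kj].
  rewrite !mxE enum_rankK eqxx mulr1.
  have := enum_valP i; have := enum_valP j; rewrite !inE => /eqP rj /eqP ri.
  rewrite -(root_connect sym_e) ri rj; rewrite (inj_eq enum_val_inj).
  by case: (i == j).
rewrite !mxE; case: eqP => [kj'|]; last by rewrite mulr0.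
by rewrite -kj' enum_valK eqxx in kj.
Qed.

Lemma mul_connect_mx (v : 'rV_n) x :
  (v *m connect_mx) 0 (enum_rank x) = \sum_(y | connect e x y) v 0 (enum_rank y).
Proof.
rewrite mxE (reindex enum_rank) /=; last by apply/onW_bij/enum_rank_bij.
rewrite [RHS]big_mkcond /=; apply: eq_bigr => y _; rewrite !mxE !enum_rankK sym_e.
by case: connect; rewrite ?mulr1 ?mulr0.
Qed.

Lemma connect_mx_sym : connect_mx^T = connect_mx.
Proof. by apply/matrixP=> i j; rewrite !mxE sym_e. Qed.

Lemma row_ofE f x : row_of f 0 (enum_rank x) = f x.
Proof. by rewrite mxE enum_rankK. Qed.

Lemma row_of_eq (u v : 'rV[bool]_n) :
  (forall x, u 0 (enum_rank x) = v 0 (enum_rank x)) -> u = v.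
Proof. by move=> uv; apply/rowP=> j; rewrite -(enum_valK j). Qed.

End ConnectMatrix.

Lemma connect_equivalence (T : finType) (r : rel T) :
  equivalence r -> connect r =2 r.
Proof.
move=> [rr rs rt] x y; apply/idP/idP; last exact: connect1.
by case/connectP=> p rp ->{y}; elim: p x rp => //= z p IH x /andP[xz /IH]; apply: rt.
Qed.

Lemma connect_sym_equivalence (T : finType) (r : rel T) :
  equivalence r -> connect_sym r.
Proof.
by move=> er x y; rewrite !connect_equivalence //; case: er => _ ->.
Qed.

Lemma fconnect_involutive (T : finType) (f : T -> T) x y :
  involutive f -> fconnect f x y = (y == x) || (y == f x).
Proof.
move=> fK; apply/idP/idP => [/connectP[p fp ->{y}]|/orP[]/eqP->].
- elim: p x fp => [x|z p IH x] /=; first by rewrite eqxx.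
  by case/andP=> /eqP<- /IH; rewrite fK orbC.
- exact: connect0.
- exact: fconnect1.
Qed.

Lemma sum_fconnect4 (T : finType) (f : T -> T) (z : T -> bool) x :
    (forall x, iter 4 f x = x) -> f x != x -> (f (f x) != x) ->
  (\sum_(y | fconnect f x y) z y)%R = (z x (+) z (f x) (+) z (f (f x)) (+) z (f (f (f x)))).
Proof.
move=> f4 fx ffx.
have finj : injective f by move=> a b ab; rewrite -(f4 a) -(f4 b) /= ab.
have fI a b : (f a == f b) = (a == b) by apply: inj_eq.
have c4 : fcycle f [:: x; f x; f (f x); f (f (f x))].
  by rewrite /= !eqxx andbT; apply/eqP/f4.
rewrite (eq_bigl (mem [:: x; f x; f (f x); f (f (f x))])) => [|y].
  rewrite -big_uniq /=; first by rewrite !big_cons big_nil; do 4!case: (z _).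
  have f3 : x != f (f (f x)) by apply: contra fx => /eqP xE; rewrite {1}xE; apply/eqP/f4.
  by rewrite /= !inE !fI ![x == _]eq_sym (negPf fx) (negPf ffx) [_ == x]eq_sym (negPf f3).
by rewrite (fconnect_cycle c4) // inE eqxx.
Qed.

Lemma sum_fconnect2 (T : finType) (f : T -> T) (z : T -> bool) x :
    f x != x -> (f (f x) == x) ->
  (\sum_(y | fconnect f x y) z y)%R = (z x (+) z (f x)).
Proof.
move=> fx ffx.
have c2 : fcycle f [:: x; f x] by rewrite /= eqxx ffx.
rewrite (eq_bigl (mem [:: x; f x])) => [|y].
  rewrite -big_uniq /=; first by rewrite !big_cons big_nil; do 2!case: (z _).
  by rewrite /= !inE eq_sym fx.
by rewrite (fconnect_cycle c2) // inE eqxx.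
Qed.

Section Planar.
Variable D : tgraph.
Implicit Types x y : dart D.

(* For a set z of edges, the number of edges of z at the vertex of x is even
   (a mod 2 cycle); chi colours the regions, and the cutset of chi is the
   set of edges separating regions of different colours. *)
Definition even_at (z : dart D -> bool) x : bool :=
  if crossing x
  then ~~ (z x (+) z (node x) (+) z (node (node x)) (+) z (node (node (node x))))
  else z x == z (node x).

Definition cutset (chi : dart D -> bool) x := chi x (+) chi (edge x).

Definition region_colouring (chi : dart D -> bool) :=
  forall x y, region x y -> chi x = chi y.

(* The Jordan curve theorem in homological form. Counting dimensions over F_2,
   it is equivalent to Euler's formula. *)
Definition planar :=
  forall z, (forall x, z (edge x) = z x) -> (forall x, even_at z x) ->
  exists2 chi, region_colouring chi & z =1 cutset chi.

Hypotheses (edgeK : involutive (@edge D)) (edge_neq : forall x, edge x != x)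
  (node4 : forall x, iter 4 node x = x) (node_neq : forall x, node x != x)
  (regionE : equivalence (@region D)) (region_edge : forall x, region x (edge (node x)))
  (conn : forall x y, connect (@slink D) x y) (x0 : dart D).

(** Written as a sum over an orbit, evenness at crossings and at marked points alike says that z
    lies in the kernel of the component matrix of [node]. *)
Lemma even_atP z x : even_at z x = ~~ (\sum_(y | fconnect node x y) z y)%R.
Proof.
rewrite /even_at; case: ifP => cx; first by rewrite sum_fconnect4.
rewrite sum_fconnect2 //; last exact: negbFE cx.
by case: (z x); case: (z _).
Qed.

Let edge_inj : injective (@edge D) := inv_inj edgeK.
Let node_inj : injective (@node D).
Proof. by move=> a b ab; rewrite -(node4 a) -(node4 b) /= ab. Qed.

Let Pe := connect_mx (frel (@edge D)).
Let Pn := connect_mx (frel (@node D)).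
Let Pg := connect_mx (@glink D).
Let Pr := connect_mx (@region D).
Let Ps := connect_mx (@slink D).

Let edge_sym : connect_sym (frel (@edge D)). Proof. exact: fconnect_sym. Qed.
Let node_sym : connect_sym (frel (@node D)). Proof. exact: fconnect_sym. Qed.
Let region_sym : connect_sym (@region D). Proof. exact: connect_sym_equivalence. Qed.

Let glinkE : @glink D =2 relU (frel edge) (frel node). Proof. by []. Qed.

Let glink_sym : connect_sym (@glink D).
Proof.
exact: (relU_sym edge_sym node_sym).
Qed.

Lemma slink_sym : connect_sym (@slink D).
Proof. exact: (relU_sym glink_sym region_sym). Qed.

Let invariant_connect (e : rel (dart D)) (f : dart D -> bool) :
  (forall x y, e x y -> f x = f y) -> forall x y, connect e x y -> f x = f y.
Proof.
move=> fe x y /connectP[p ep ->{y}]; elim: p x ep => //= y p IH x /andP[/fe-> /IH].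
by [].
Qed.

Lemma mul_edge_mx (v : 'rV_#|dart D|) x :
  (v *m Pe) 0 (enum_rank x) = v 0 (enum_rank x) (+) v 0 (enum_rank (edge x)).
Proof.
rewrite mul_connect_mx //.
rewrite (eq_bigl (mem [:: x; edge x])) => [|y]; last first.
  by rewrite fconnect_involutive // !inE.
rewrite -big_uniq /=; first by rewrite !big_cons big_nil; do 2!case: (v _ _).
by rewrite /= !inE eq_sym edge_neq.
Qed.

(** Let V, E, K, R count vertices, edges, graph components and regions. The cycles form a space of
    dimension E + K - V, the cutsets a subspace of dimension R - 1. All cycles are cutsets exactly
    when these dimensions agree, which is Euler's formula. *)
Lemma euler_planar :
  (fcard (@node D) predT + n_comp (@region D) predT =
   fcard (@edge D) predT + (n_comp (@glink D) predT).+1)%N <-> planar.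
Proof.
have rE : \rank Pe = fcard (@edge D) predT by apply: rank_connect_mx.
have rV : \rank Pn = fcard (@node D) predT by apply: rank_connect_mx.
have rR : \rank Pr = n_comp (@region D) predT by apply: rank_connect_mx.
have rK : \rank Pg = n_comp (@glink D) predT by apply: rank_connect_mx.
have rS : \rank Ps = 1%N.
  rewrite rank_connect_mx; last exact: slink_sym.
  rewrite -(n_comp_connect slink_sym x0); apply: eq_n_comp_r => y.
  by rewrite !inE conn.
have kerE (v : 'rV_#|dart D|) : (v <= kermx Pe)%MS =
    [forall x, v 0 (enum_rank x) == v 0 (enum_rank (edge x))].
  apply/idP/forallP => [/sub_kermxP v0 x|vE].
    have := mul_edge_mx v x; rewrite v0 mxE.
    by case: (v _ _); case: (v _ _).
  apply/sub_kermxP/row_of_eq => x; rewrite mul_edge_mx mxE.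
  by rewrite (eqP (vE x)); case: (v _ _).
(* Multiplication by [Pe] is the coboundary. Its kernel on functions of the vertices consists of the
   functions constant on graph components; on functions of the regions ([sE] below), of the
   constants only, by connectedness. *)
have gE : (Pn :&: kermx Pe :=: Pg)%MS.
  apply/eqmxP/andP; split; apply/rV_subP=> v; rewrite sub_capmx.
    case/andP=> /(connect_mxP node_sym) vn; rewrite kerE => /forallP ve.
    apply/(connect_mxP glink_sym)=> x y xy.
    apply: (invariant_connect (f := fun x => v 0 (enum_rank x))) xy => {}x {}y.
    case/orP=> /eqP<-; [exact/eqP/ve | exact/vn/fconnect1].
  move/(connect_mxP glink_sym)=> vg; apply/andP; split.
    apply/(connect_mxP node_sym)=> x y xy; apply: vg; apply: connect_sub xy => {}x {}y xy.
    by apply: connect1; apply/orP; right.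
  by rewrite kerE; apply/forallP=> x; rewrite (vg x (edge x)) // connect1 /glink ?eqxx.
have sE : (Pr :&: kermx Pe :=: Ps)%MS.
  apply/eqmxP/andP; split; apply/rV_subP=> v; rewrite sub_capmx.
    case/andP=> /(connect_mxP region_sym) vr; rewrite kerE => /forallP ve.
    apply/(connect_mxP slink_sym)=> x y xy.
    apply: (invariant_connect (f := fun x => v 0 (enum_rank x))) xy => {}x {}y.
    case/orP=> [/orP[]/eqP<-|/connect1/vr //]; first exact/eqP/ve.
    rewrite (vr x (edge (node x))); last exact/connect1/region_edge.
    by rewrite -(eqP (ve _)).
  move/(connect_mxP slink_sym)=> vg; apply/andP; split.
    apply/(connect_mxP region_sym)=> x y xy; apply: vg; apply: connect_sub xy => {}x {}y xy.
    by apply: connect1; apply/orP; right.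
  by rewrite kerE; apply/forallP=> x; rewrite (vg x (edge x)) // connect1 /slink /glink ?eqxx.
pose Z := (Pe :&: kermx Pn)%MS; pose B := Pr *m Pe.
(* The products of [Pe] and [Pn] in the two orders are transposes of each other, hence have equal
   rank. *)
have dimZ : (\rank Z + \rank Pn = \rank Pe + \rank Pg)%N.
  rewrite -(mxrank_mul_ker Pe Pn) -(mxrank_mul_ker Pn Pe) gE.
  rewrite -[\rank (Pe *m Pn)]mxrank_tr trmx_mul !connect_mx_sym // -/Z.
  by rewrite addnCA addnA.
have dimB : (\rank B + 1 = \rank Pr)%N.
  by rewrite -(mxrank_mul_ker Pr Pe) sE rS.
have BZ : (B <= Z)%MS.
  apply/rV_subP=> v /submxP[w ->]; rewrite mulmxA.
  have: (w *m Pr <= Pr)%MS by apply: submxMl.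
  move: (w *m Pr) => {w v} v /(connect_mxP region_sym) vr.
  rewrite sub_capmx submxMl; apply/sub_kermxP/row_of_eq=> x; rewrite mul_connect_mx // mxE.
  (* Around a vertex each corner is counted twice, from [y] and from [edge (node y)], so the cutset
     is even there. *)
  transitivity (\sum_(y | fconnect node x y) v 0 (enum_rank y) +
                \sum_(y | fconnect node x y) v 0 (enum_rank (edge y))).
    by rewrite -big_split; apply: eq_bigr => y _; apply: mul_edge_mx.
  rewrite [X in _ + X](reindex_inj node_inj) /=.
  rewrite [X in _ + X](eq_bigl (fconnect node x)) => [|y]; last first.
    by rewrite -same_fconnect1_r.
  rewrite -big_split big1 // => y _.
  rewrite -(vr y (edge (node y))) ?connect1 //; first by case: (v _ _).
have ZB : (Z <= B)%MS <-> planar.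
  split=> [/rV_subP zb z ze zn|pl].
    have /zb/submxP[w] : (row_of z <= Z)%MS.
      rewrite sub_capmx; apply/andP; split.
        apply/(connect_mxP edge_sym)=> x y; rewrite fconnect_involutive // !row_ofE.
        by case/orP=> /eqP->.
      apply/sub_kermxP/row_of_eq=> x; rewrite mul_connect_mx // mxE.
      have := zn x; rewrite even_atP => /negbTE sz.
      by rewrite (eq_bigr z) // => y _; apply: row_ofE.
    rewrite mulmxA; have: (w *m Pr <= Pr)%MS by apply: submxMl.
    move: (w *m Pr) => {w} v /(connect_mxP region_sym) vr zE.
    exists (fun x => v 0 (enum_rank x)) => [x y /connect1/vr //|x].
    by rewrite -(row_ofE z) zE mul_edge_mx.
  apply/rV_subP=> v; rewrite sub_capmx => /andP[/(connect_mxP edge_sym) ve /sub_kermxP vn].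
  case: (pl (fun x => v 0 (enum_rank x))) => [x|x|chi chir vE].
  - by rewrite -(ve x) // fconnect1.
  - by rewrite even_atP -mul_connect_mx // vn mxE.
  have cP : (row_of chi <= Pr)%MS.
    apply/(connect_mxP region_sym)=> x y; rewrite !row_ofE connect_equivalence //.
    exact: chir.
  have -> : v = row_of chi *m Pe.
    by apply/row_of_eq=> x; rewrite mul_edge_mx !row_ofE vE.
  exact: submxMr.
have rBZ : (\rank B == \rank Z) <-> planar by have [_ ->] := mxrank_leqif_sup BZ.
rewrite -rE -rV -rR -rK -dimB addn1 !addnS.
split=> [[e]|/rBZ/eqP e]; last by rewrite e addnC dimZ.
by apply/rBZ/eqP/(@addnI (\rank Pn)); rewrite e -dimZ addnC.
Qed.

End Planar.

Local Close Scope ring_scope.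

(** * Moves preserve diagrams *)

Lemma merge_equivalence (T : Type) (r : rel T) a b :
  equivalence r -> equivalence (merge r a b).
Proof.
move=> [rr rs rt]; split=> [x|x y|y x z]; rewrite /merge.
- by rewrite rr.
- by rewrite (rs x y); congr orb; rewrite [RHS]orbC [r y a && _]andbC [r y b && _]andbC.
have tr u v w : r u v -> r u w = r v w.
  by move=> uv; apply/idP/idP; apply: rt => //; rewrite rs.
case/or3P=> [xy|/andP[xa yb]|/andP[xb ya]].
- by rewrite !(tr _ _ _ xy).
- rewrite !(tr _ _ _ yb) xa [r b z]rs; case/or3P=> [->|/andP[ba zb]|/andP[_ za]].
  + by rewrite orbT.
  + by rewrite zb orbT.
  + by rewrite (rt a) // rs.
- rewrite !(tr _ _ _ ya) xb [r a z]rs; case/or3P=> [->|/andP[_ zb]|/andP[ab za]].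
  + by rewrite !orbT.
  + by rewrite (rt b) // rs.
  + by rewrite za !orbT.
Qed.

Section Diagram.
Variable D : tgraph.
Hypothesis DP : is_diagram D.
Implicit Types x y d : dart D.

Lemma nodeK4 x : node (node (node (node x))) = x.
Proof. exact: td_node4. Qed.

Lemma edgeK : involutive (@edge D). Proof. exact: td_edgeK. Qed.

Lemma node_inj : injective (@node D).
Proof. by move=> x y xy; rewrite -(nodeK4 x) xy nodeK4. Qed.

Lemma edge_inj : injective (@edge D).
Proof. exact/inv_inj/edgeK. Qed.

Lemma crossing_node x : crossing (node x) = crossing x.
Proof. by rewrite /crossing (inj_eq node_inj). Qed.

Lemma node2_noncrossing x : ~~ crossing x -> node (node x) = x.
Proof. by move/negbNE/eqP. Qed.

Lemma region_refl x : region x x. Proof. by case: (td_region DP). Qed.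
Lemma region_sym x y : region x y = region y x. Proof. by case: (td_region DP). Qed.
Lemma region_trans x y z : region x y -> region y z -> region x z.
Proof. by case: (td_region DP) => _ _ rt; apply: rt. Qed.
Lemma tie_refl x : tie x x. Proof. by case: (td_tie DP). Qed.
Lemma tie_sym x y : tie x y = tie y x. Proof. by case: (td_tie DP). Qed.
Lemma tie_trans x y z : tie x y -> tie y z -> tie x z.
Proof. by case: (td_tie DP) => _ _ rt; apply: rt. Qed.

Lemma tie_opp x : crossing x -> tie x (node (node x)).
Proof. by move=> cx; have := td_tie_across DP x; rewrite /across cx. Qed.

Lemma diagram_planar : planar D.
Proof.
have /card_gt0P[x0 _] := td_nonempty DP.
apply/(euler_planar (td_edgeK DP) (td_edge_neq DP) (td_node4 DP) (td_node_neq DP)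
  (td_region DP) (td_region_edge DP) (td_conn DP) x0).
exact: td_euler.
Qed.

Lemma node_eq x : (node x == x) = false.
Proof. exact/negbTE/td_node_neq. Qed.

Lemma eq_node x : (x == node x) = false.
Proof. by rewrite eq_sym node_eq. Qed.

Lemma node3_eq x : (node (node (node x)) == x) = false.
Proof.
apply: contraFF (node_eq x) => /eqP xE.
by rewrite -[X in X == _]/(node x) -{2}(nodeK4 x) xE.
Qed.

Lemma eq_node3 x : (x == node (node (node x))) = false.
Proof. by rewrite eq_sym node3_eq. Qed.

Lemma node2_eq x : crossing x -> (node (node x) == x) = false.
Proof. exact: negbTE. Qed.

Lemma eq_node2 x : crossing x -> (x == node (node x)) = false.
Proof. by rewrite eq_sym; apply: negbTE. Qed.

Lemma node_injE x y : (node x == node y) = (x == y).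
Proof. exact: inj_eq node_inj _ _. Qed.

Lemma edge_injE x y : (edge x == edge y) = (x == y).
Proof. exact: inj_eq edge_inj _ _. Qed.

Definition nodeE := (node_eq, eq_node, node3_eq, eq_node3, node_injE, nodeK4).

Definition vertex d : seq (dart D) := [:: d; node d; node (node d); node (node (node d))].

Lemma same_vertexE x y : same_vertex x y = (y \in vertex x).
Proof.
rewrite /same_vertex; apply/idP/idP => [/connectP[p np ->{y}]|].
  suff: forall z, z \in vertex x -> fpath node z p -> last z p \in vertex x.
    by apply; rewrite // inE eqxx.
  elim: p {np} => //= y p IH z zv /andP[/eqP<-]; apply: IH.
  by move: zv; rewrite !inE => /or4P[]/eqP->; rewrite ?nodeK4 ?eqxx ?orbT.
by rewrite !inE => /or4P[]/eqP->; rewrite -?same_fconnect1_r ?connect0 //; exact: node_inj.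
Qed.

Lemma vertex_node x d : (node x \in vertex d) = (x \in vertex d).
Proof.
by rewrite -!same_vertexE /same_vertex -same_fconnect1_r //; exact: node_inj.
Qed.

Lemma crossing_vertex x d : x \in vertex d -> crossing x = crossing d.
Proof. by rewrite !inE => /or4P[]/eqP->; rewrite ?crossing_node. Qed.

Lemma vertex_refl d : d \in vertex d. Proof. by rewrite inE eqxx. Qed.

Lemma vertex_sym x d : (x \in vertex d) = (d \in vertex x).
Proof. by rewrite -!same_vertexE /same_vertex fconnect_sym //; exact: node_inj. Qed.

Lemma vertex_trans y x z : x \in vertex y -> y \in vertex z -> x \in vertex z.
Proof.
by rewrite -!same_vertexE /same_vertex => xy yz; apply: connect_trans yz xy.
Qed.

Lemma region_node x : region x (edge (node x)). Proof. exact: td_region_edge. Qed.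

Lemma colour_node chi x : region_colouring chi -> chi (edge (node x)) = chi x.
Proof. by move=> cc; symmetry; apply/cc/region_node. Qed.

Lemma colour_edge chi x : region_colouring chi ->
  chi (edge x) = chi (node (node (node x))).
Proof. by move=> cc; rewrite -[in LHS](nodeK4 x) colour_node. Qed.

End Diagram.

(** With this criterion a move is treated by transporting cycles and colourings, without recounting
    vertices, edges, regions and components. *)
Lemma is_diagram_planar (D : tgraph) : (0 < #|dart D|)%N ->
  involutive (@edge D) -> (forall x : dart D, edge x != x) ->
  (forall x : dart D, iter 4 node x = x) -> (forall x : dart D, node x != x) ->
  (forall x : dart D, crossing x -> over (node x) = ~~ over x) ->
  equivalence (@region D) -> (forall x : dart D, region x (edge (node x))) ->
  equivalence (@tie D) -> (forall x : dart D, tie x (edge x)) ->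
  (forall x : dart D, tie x (across x)) ->
  (forall x y : dart D, connect (@slink D) x y) -> planar D -> is_diagram D.
Proof.
move=> ne eK en n4 nn ov rg re ti te ta cn pl; split=> //.
have /card_gt0P[x0 _] := ne.
exact/(euler_planar eK en n4 nn rg re cn x0).
Qed.

(** * Smoothing a crossing *)

Section Smooth.
Variable D : tgraph.
Hypothesis DP : is_diagram D.
Variable d : dart D.
Hypothesis cd : crossing d.
Implicit Types x y : dart D.
Local Notation "x =v" := (x \in vertex d) (at level 70).

Let E := smooth d.
Let nd : dart D -> dart D := @node E.

Lemma smooth_node_out x : x \notin vertex d -> nd x = node x.
Proof. by rewrite /nd /= !inE !negb_or => /and4P[/negPf-> /negPf-> /negPf-> /negPf->]. Qed.

Lemma smooth_node0 : nd d = node d. Proof. by rewrite /nd /= eqxx. Qed.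
Lemma smooth_node1 : nd (node d) = d.
Proof. by rewrite /nd /= !(nodeE DP) eqxx. Qed.
Lemma smooth_node2 : nd (node (node d)) = node (node (node d)).
Proof. by rewrite /nd /= !(nodeE DP) node2_eq // eqxx. Qed.
Lemma smooth_node3 : nd (node (node (node d))) = node (node d).
Proof. by rewrite /nd /= !(nodeE DP) node2_eq // eqxx. Qed.

Definition smooth_nodeE := (smooth_node0, smooth_node1, smooth_node2, smooth_node3).

Lemma smooth_nodeK x : x \in vertex d -> nd (nd x) = x.
Proof. by rewrite !inE => /or4P[]/eqP->; rewrite !smooth_nodeE. Qed.

Lemma smooth_crossing x : @crossing E x = crossing x && (x \notin vertex d).
Proof.
rewrite {1}/crossing -/nd; case: (boolP (x \in vertex d)) => xd.
  by rewrite smooth_nodeK // eqxx andbF.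
by rewrite !smooth_node_out ?vertex_node // andbT.
Qed.

(** The vertex falls apart into two, but the merged region keeps the incidence structure connected.
    A cycle of the result takes equal values at the two ends of each new arc, so it is a cycle of D;
    the same equalities give the two merged corners one colour, so that the colouring found for D
    respects the new regions. *)
Lemma smooth_diagram : is_diagram E.
Proof.
have nK x : x \notin vertex d -> nd (nd (nd (nd x))) = x.
  by move=> xd; rewrite !smooth_node_out ?vertex_node // nodeK4.
have rE : equivalence (@region E) by apply/merge_equivalence/(td_region DP).
have tE : equivalence (@tie E) by apply/merge_equivalence/(td_tie DP).
have n4 (x : dart E) : iter 4 node x = x.
  change (nd (nd (nd (nd x))) = x).
  by case: (boolP (x \in vertex d)) => [xd|/nK //]; rewrite !smooth_nodeK.
have nn (x : dart E) : node x != x.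
  change (nd x != x); case: (boolP (x \in vertex d)) => [|xd].
    by rewrite !inE => /or4P[]/eqP->; rewrite !smooth_nodeE !(nodeE DP).
  by rewrite smooth_node_out // td_node_neq.
have r13 : @region E (node d) (node (node (node d))).
  by rewrite /= /merge !region_refl // !orbT.
apply: is_diagram_planar => //; try exact: (td_nonempty DP).
- exact: (td_edgeK DP).
- exact: (td_edge_neq DP).
- move=> x; rewrite smooth_crossing => /andP[cx xd].
  change (over (nd x) = ~~ over x); rewrite smooth_node_out //; exact: td_over.
- move=> x; change (@region E x (edge (nd x))).
  case: (boolP (x \in vertex d)) => [|xd].
    case: rE => rr rs rt.
    have re y : @region E y (edge (node y)) by rewrite /= /merge region_node.
    rewrite !inE => /or4P[]/eqP->; rewrite !smooth_nodeE //.
    + by apply: rt r13 _; have := re (node (node (node d))); rewrite nodeK4.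
    + by rewrite rs in r13; apply: rt r13 _; apply: re.
  by rewrite smooth_node_out //= /merge region_node.
- by move=> x; rewrite /= /merge td_tie_edge.
- move=> x; rewrite /across smooth_crossing.
  case: (boolP (x \in vertex d)) => xd.
    have t1 : tie (node (node d)) d by rewrite tie_sym // tie_opp.
    have t2 : tie (node (node (node d))) (node d) by rewrite tie_sym // tie_opp ?crossing_node.
    rewrite andbF -/nd /=; move: xd; rewrite !inE => /or4P[]/eqP->;
      by rewrite !smooth_nodeE /merge ?tie_refl // ?t1 ?t2 !orbT.
  rewrite andbT; have := td_tie_across DP x; rewrite /across /opp -/nd.
  by rewrite !smooth_node_out ?vertex_node //; case: ifP => _ tx; rewrite /= /merge tx.
- move=> x y; have sE : connect_sym (@slink E) by apply: slink_sym => //; exact: (td_edgeK DP).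
  apply: connect_sub (td_conn DP x y) => {}x {}y /orP[/orP[]|xy].
  + by move=> xy; apply: connect1; rewrite /slink /glink /= xy.
  + move/eqP<-; have [xd|xd] := boolP (x \in vertex d); last first.
      by apply: connect1; rewrite /slink /glink -/nd smooth_node_out // eqxx orbT.
    have c01 : connect (@slink E) d (node d).
      by apply: connect1; rewrite /slink /glink -/nd smooth_nodeE eqxx orbT.
    have c23 : connect (@slink E) (node (node d)) (node (node (node d))).
      by apply: connect1; rewrite /slink /glink -/nd smooth_nodeE eqxx orbT.
    have c13 : connect (@slink E) (node d) (node (node (node d))).
      by apply: connect1; rewrite /slink r13 orbT.
    move: xd; rewrite !inE => /or4P[]/eqP-> //.
      by rewrite sE; apply: connect_trans c23 _; rewrite sE.
    by rewrite nodeK4 // sE; apply: connect_trans c01 c13.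
  + by apply: connect1; rewrite /slink /= /merge xy orbT.
move=> z ze zn.
have zd0 : z (node d) = z d.
  by have := zn d; rewrite /even_at smooth_crossing vertex_refl andbF -/nd smooth_nodeE => /eqP->.
have zd2 : z (node (node (node d))) = z (node (node d)).
  have := zn (node (node d)); rewrite /even_at smooth_crossing !vertex_node // vertex_refl andbF.
  by rewrite -/nd smooth_nodeE => /eqP->.
have [|x|chi cc zE] := diagram_planar DP (z := z) ; first exact: ze.
  have := zn x; rewrite /even_at smooth_crossing -/nd.
  case: (boolP (x \in vertex d)) => xd; last first.
    by rewrite !smooth_node_out ?vertex_node // andbT.
  rewrite (crossing_vertex DP xd) cd.
  move: xd; rewrite !inE => /or4P[]/eqP-> _; rewrite ?nodeK4 // zd0 zd2;
   by case: (z _); case: (z _).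
exists chi; last exact: zE.
have c13 : chi (node d) = chi (node (node (node d))).
  move: (zE (node d)) (zE d); rewrite zd0 /cutset colour_node // colour_edge //.
  by move=> ->; case: (chi _); case: (chi _); case: (chi _).
move=> x y /or3P[/cc //|/andP[/cc-> /cc->]|/andP[/cc-> /cc->]] //.
Qed.

End Smooth.

Lemma switch_diagram (D : tgraph) (d : dart D) : is_diagram D -> is_diagram (switch d).
Proof.
move=> DP; case: (DP) => ne eK en n4 nn ov rg re ti te ta cn eu.
split=> //= x cx; rewrite ov // -addNb; congr addb.
by rewrite !same_vertexE // vertex_node.
Qed.

Lemma pullback_equivalence (S T : Type) (f : S -> T) (r : rel T) :
  equivalence r -> equivalence (fun x y => r (f x) (f y)).
Proof. by move=> [rr rs rt]; split=> [x|x y|y x z]; [exact: rr | exact: rs | exact: rt]. Qed.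

(** * Removing a bigon *)

Section RemoveBigon.
Variable D : tgraph.
Hypothesis DP : is_diagram D.
Variables a b : dart D.
Hypothesis ab : bigon a b.
Implicit Types x y : dart D.

Let E := remove_bigon a b.
Let nd : dart D -> dart D := @node E.
Let left_of : dart D -> dart D := [eta id with a |-> node a, edge a |-> opp a,
                              b |-> node b, edge b |-> opp a].
Let side := [:: a; node a; b; node b].
Let V x := (x \in vertex a) || (x \in vertex b).

Let ca : crossing a. Proof. by case: ab => /andP[]. Qed.
Let cb : crossing b. Proof. by case: ab => /andP[]. Qed.
Let ea : edge a = node b. Proof. by case: ab => _ _ []. Qed.
Let eb : edge b = node a. Proof. by case: ab => _ _ []. Qed.
Let ena : edge (node a) = b. Proof. by rewrite -eb edgeK. Qed.
Let enb : edge (node b) = a. Proof. by rewrite -ea edgeK. Qed.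

Let disj x y : x \in vertex a -> y \in vertex b -> (x == y) = false.
Proof.
move=> xa yb; apply/eqP=> xy; case: ab => _; rewrite same_vertexE // => /negP[].
by apply: (vertex_trans DP _ xa); rewrite vertex_sym // xy.
Qed.

Let bigon_node_in x : V x -> nd x = node (node x).
Proof. by rewrite /nd /= !same_vertexE // -/(V x) => ->. Qed.
Let bigon_node_out x : ~~ V x -> nd x = node x.
Proof. by rewrite /nd /= !same_vertexE // -/(V x) => /negPf->. Qed.
Let V_node x : V (node x) = V x. Proof. by rewrite /V !vertex_node. Qed.

Let V_crossing x : V x -> crossing x.
Proof. by case/orP=> /(crossing_vertex DP)->. Qed.

Lemma bigon_crossing x : @crossing E x = crossing x && ~~ V x.
Proof.
rewrite {1}/crossing -/nd; case: (boolP (V x)) => xd.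
  by rewrite !bigon_node_in ?V_node // nodeK4 // eqxx andbF.
by rewrite !bigon_node_out ?V_node // andbT.
Qed.

Let left_out x : x \notin side -> left_of x = x.
Proof.
rewrite !inE !negb_or => /and4P[xa xna xb xnb].
by rewrite /left_of /= ea eb (negPf xa) (negPf xna) (negPf xb) (negPf xnb).
Qed.

Let va : a \in vertex a. Proof. exact: vertex_refl. Qed.
Let vb : b \in vertex b. Proof. exact: vertex_refl. Qed.
Let a_nb : (a == node b) = false. Proof. by rewrite disj ?vertex_node. Qed.
Let na_b : (node a == b) = false. Proof. by rewrite disj ?vertex_node. Qed.
Let a_b : (a == b) = false. Proof. by rewrite disj. Qed.

Let left_a : left_of a = node a. Proof. by rewrite /left_of /= eqxx. Qed.
Let left_na : left_of (node a) = opp a.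
Proof. by rewrite /left_of /= eb ea eqxx node_injE // !(nodeE DP) a_b na_b. Qed.
Let left_b : left_of b = node b.
Proof. by rewrite /left_of /= ea [b == a]eq_sym a_b !(nodeE DP) eqxx. Qed.
Let left_nb : left_of (node b) = opp a.
Proof. by rewrite /left_of /= ea [node b == a]eq_sym a_nb eqxx. Qed.

Let side_edge x : (edge x \in side) = (x \in side).
Proof.
apply/idP/idP; rewrite !inE => /or4P[]/eqP; last first.
all: try by move=> ->; rewrite ?ea ?eb ?ena ?enb eqxx ?orbT.
all: by move/(canRL (edgeK DP))->; rewrite ?ea ?eb ?ena ?enb eqxx ?orbT.
Qed.

Let sideV x : x \in side -> V x.
Proof. by rewrite /V !inE => /or4P[]->; rewrite ?orbT. Qed.

Let out2a : node (node a) \notin side.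
Proof.
by rewrite !inE !(nodeE DP) node2_eq // !disj ?vertex_node.
Qed.
Let out3a : node (node (node a)) \notin side.
Proof.
by rewrite !inE !(nodeE DP) node2_eq // !disj ?vertex_node.
Qed.
Let out2b : node (node b) \notin side.
Proof.
rewrite !inE !(nodeE DP) node2_eq // [_ == a]eq_sym disj ?vertex_node //.
by rewrite [_ == _ a]eq_sym disj ?vertex_node.
Qed.
Let out3b : node (node (node b)) \notin side.
Proof.
rewrite !inE !(nodeE DP) node2_eq // [_ == a]eq_sym disj ?vertex_node //.
by rewrite [_ == a]eq_sym disj ?vertex_node.
Qed.

Let regE x y : @region E x y = merge region (opp a) (opp b) (left_of x) (left_of y).
Proof. by []. Qed.

(** A cycle of the result agrees on opposite darts at both vertices, so it is a cycle of D.
    Comparing colours around the bigon shows that its two tips have the same colour, as the merging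
    of their regions requires; the new colouring is the old one read through [left_of]. *)
Lemma remove_bigon_diagram : is_diagram E.
Proof.
have rE : equivalence (@region E).
  exact/pullback_equivalence/merge_equivalence/(td_region DP).
have [rr rs rt] := rE.
have n4 (x : dart E) : iter 4 node x = x.
  change (nd (nd (nd (nd x))) = x); case: (boolP (V x)) => xV.
    by rewrite !bigon_node_in ?V_node // !nodeK4.
  by rewrite !bigon_node_out ?V_node // nodeK4.
have nn (x : dart E) : node x != x.
  change (nd x != x); case: (boolP (V x)) => xV.
    by rewrite bigon_node_in //; apply: V_crossing.
  by rewrite bigon_node_out // td_node_neq.
have mr (x y : dart D) : region x y -> merge region (opp a) (opp b) x y.
  by rewrite /merge => ->.
have mtip : merge region (opp a) (opp b) (opp a) (opp b).
  by rewrite /merge !region_refl // !orbT.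
have msym x y : merge region (opp a) (opp b) x y -> merge region (opp a) (opp b) y x.
  by have [_ ms _] := merge_equivalence (opp a) (opp b) (td_region DP); rewrite ms.
have mtr x y z : merge region (opp a) (opp b) x y -> merge region (opp a) (opp b) y z ->
    merge region (opp a) (opp b) x z.
  by have [_ _ mt] := merge_equivalence (opp a) (opp b) (td_region DP); apply: mt.
have rn x := region_node DP x.
have re (x : dart D) : @region E x (edge (nd x)).
  rewrite regE; case: (boolP (V x)) => xV; last first.
    rewrite bigon_node_out // !left_out ?mr // ?side_edge; apply: contra xV => /sideV //.
    by rewrite V_node.
  rewrite bigon_node_in //; case/orP: xV; rewrite !inE => /or4P[]/eqP->.
  - by rewrite left_a left_out ?side_edge // mr.
  - by rewrite left_na left_out ?side_edge // mr.
  - by rewrite nodeK4 // ea left_nb left_out // mr // region_refl.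
  - by rewrite nodeK4 // ena left_b left_out // mr // -ea; have := rn (node (node (node a))); rewrite nodeK4.
  - by rewrite left_b left_out ?side_edge // mr.
  - by rewrite left_nb left_out ?side_edge //; apply: mtr mtip _; apply: mr.
  - by rewrite nodeK4 // eb left_na left_out //; apply: msym.
  - by rewrite nodeK4 // enb left_a left_out // mr // -eb; have := rn (node (node (node b))); rewrite nodeK4.
have conn : forall x y : dart E, connect (@slink E) x y.
  have sE : connect_sym (@slink E) by apply: slink_sym => //; exact: (td_edgeK DP).
  have cn (x : dart E) : connect (@slink E) x (nd x).
    by apply: connect1; rewrite /slink /glink -/nd eqxx orbT.
  have ce (x : dart E) : connect (@slink E) x (edge x : dart D).
    by apply: connect1; rewrite /slink /glink /= eqxx.
  have cr (x y : dart E) : @region E x y -> connect (@slink E) x y.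
    by move=> xy; apply: connect1; rewrite /slink xy orbT.
  have Va (x : dart E) : V x -> connect (@slink E) a x.
    have a_nb' : connect (@slink E) a (node b) by rewrite -ea; apply: ce.
    have a_na : connect (@slink E) a (node a).
      apply: connect_trans a_nb' _; apply: cr.
      by rewrite regE left_na left_nb mr // region_refl.
    have a_b' : connect (@slink E) a b.
      by apply: connect_trans a_na _; rewrite -[X in connect _ _ X]ena; apply: ce.
    have opp_c (x1 : dart D) : V x1 -> connect (@slink E) a x1 ->
        connect (@slink E) a (node (node x1)).
      move=> x1V /connect_trans; apply; rewrite -bigon_node_in //; exact: cn.
    case/orP; rewrite !inE => /or4P[]/eqP-> //; try exact: connect0;
      apply: opp_c; rewrite ?V_node // /V ?va ?vb ?orbT ?connect0 //.
  move=> x y; apply: connect_sub (td_conn DP x y) => {}x {}y.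
  have VV (x1 y1 : dart E) : V x1 -> V y1 -> connect (@slink E) x1 y1.
    by move=> /Va x1V /Va; apply: connect_trans; rewrite sE.
  case/orP=> [/orP[]/eqP<-|xy].
  - exact: ce.
  - by case: (boolP (V x)) => [xV|xV]; [rewrite VV ?V_node | have := cn x; rewrite bigon_node_out].
  (* Only region links at the four side darts are affected. One that leads out of [side] starts at
     [node a] or [node b], because the region of [a] and [b] is the bigon itself. *)
  have key z w : z \in side -> w \notin side -> region z w -> connect (@slink E) z w.
    move=> zs ws zw.
    have ra : region a =1 [in [:: a; b]] by case: ab.
    have rab : region a b by rewrite ra !inE eqxx orbT.
    have zneq : region a z -> False.
      move=> az; have: region a w by apply: region_trans az zw.
      by rewrite ra !inE => /orP[]/eqP wE; move: ws; rewrite wE !inE eqxx ?orbT.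
    move: zs; rewrite !inE => /or4P[]/eqP zE.
    - by case: zneq; rewrite zE region_refl.
    - rewrite zE; apply: (@connect_trans _ _ a); first by apply: VV; rewrite /V ?vertex_node ?va.
      by apply: cr; rewrite regE left_a left_out // mr // -zE.
    - by case: zneq; rewrite zE.
    - rewrite zE; apply: (@connect_trans _ _ b); first by apply: VV; rewrite /V ?vertex_node ?vb ?orbT.
      by apply: cr; rewrite regE left_b left_out // mr // -zE.
  case: (boolP (x \in side)) (boolP (y \in side)) => [xs|xs] [ys|ys].
  - by apply: VV; apply: sideV.
  - exact: key.
  - by rewrite sE; apply: key => //; rewrite region_sym.
  - by apply: cr; rewrite regE !left_out // mr.
apply: is_diagram_planar => //; try exact: (td_nonempty DP).
- exact: (td_edgeK DP).
- exact: (td_edge_neq DP).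
- move=> x; rewrite bigon_crossing => /andP[cx xV].
  change (over (nd x) = ~~ over x); rewrite bigon_node_out //; exact: td_over.
- exact: (td_tie DP).
- exact: (td_tie_edge DP).
- move=> x; change (@tie D x (@across E x)); rewrite /across bigon_crossing -/nd /opp -/nd.
  case: (boolP (V x)) => xV; first by rewrite andbF bigon_node_in // tie_opp // V_crossing.
  by rewrite andbT !bigon_node_out ?V_node //; apply: (td_tie_across DP).
move=> z ze zn.
have z2 x : V x -> z (node (node x)) = z x.
  by move=> xV; have := zn x; rewrite /even_at bigon_crossing xV andbF -/nd bigon_node_in // => /eqP->.
have [|x|chi cc zE] := diagram_planar DP (z := z); first exact: ze.
  have := zn x; rewrite /even_at bigon_crossing -/nd.
  case: (boolP (V x)) => xV; last by rewrite !bigon_node_out ?V_node // andbT.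
  by rewrite V_crossing // !z2 ?V_node // => _; case: (z _); case: (z _).
have chi_ab : chi a = chi b.
  by apply: cc; case: ab => _ _ _ -> _; rewrite !inE eqxx orbT.
have za : z a = chi a (+) chi (node b) by rewrite zE /cutset ea.
have za2 : z a = chi (node (node a)) (+) chi (node a).
  by rewrite -z2 /V ?va // zE /cutset colour_node.
have zb : z b = chi b (+) chi (node a) by rewrite zE /cutset eb.
have zb2 : z b = chi (node (node b)) (+) chi (node b).
  by rewrite -z2 /V ?vb ?orbT // zE /cutset colour_node.
have tips : chi (opp a) = chi (opp b).
  move: za za2 zb zb2; rewrite -chi_ab /opp => -> e1 -> e2.
  by move: e1 e2; case: (chi a); case: (chi _); case: (chi _); case: (chi _) => //; case: (chi _).
exists (fun x => chi (left_of x)).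
  move=> x y; rewrite regE.
  by case/or3P=> [/cc //|/andP[/cc-> /cc->]|/andP[/cc-> /cc->]].
move=> x; change (z x = chi (left_of x) (+) chi (left_of (edge x))).
have [|xs] := boolP (x \in side); last by rewrite !left_out ?side_edge // zE.
have zna : z (node a) = z b by rewrite -eb ze.
have znb : z (node b) = z a by rewrite -ea ze.
rewrite !inE => /or4P[]/eqP->.
- by rewrite ea left_a left_nb za2 addbC.
- by rewrite ena left_na left_b zna zb2 tips.
- by rewrite eb left_b left_na zb2 tips addbC.
- by rewrite enb left_a left_nb znb za2.
Qed.

End RemoveBigon.

Lemma n_comp_pullback (T : finType) (r : rel T) (l : T -> T) :
  equivalence r -> (forall x, exists y, r x (l y)) ->
  n_comp (fun x y => r (l x) (l y)) predT = n_comp r predT.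
Proof.
move=> er l_onto; have er' := pullback_equivalence l er.
rewrite [RHS](adjunction_n_comp l (e' := fun x y => r (l x) (l y))) //.
- exact: connect_sym_equivalence.
- exact: connect_sym_equivalence.
split=> [x _|x y _]; last by rewrite !connect_equivalence.
have /sigW[y xy] : exists y, r x (l y) by exact: l_onto.
by exists y; apply: connect1.
Qed.

Lemma fcard_conjugate (T : finType) (f g h : T -> T) :
  involutive f -> cancel g h -> cancel h g ->
  fcard (g \o f \o h) predT = fcard f predT.
Proof.
move=> fK gK hK; have fK' : involutive (g \o f \o h).
  by move=> x; rewrite /= gK fK hK.
have inj := inv_inj fK'; rewrite [LHS](adjunction_n_comp g (e' := frel f)) //.
- exact: fconnect_sym.
- exact/fconnect_sym/inv_inj.
split=> [x _|x y _]; first by exists (h x); rewrite hK connect0.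
by rewrite !fconnect_involutive // /= gK !(can_eq gK).
Qed.

(** * The triangle move *)

Section Flip.
Variable D : tgraph.
Hypothesis DP : is_diagram D.
Variables a b c : dart D.
Hypothesis abc : triangle a b c.
Implicit Types x y : dart D.

Let E := flip_triangle a b c.

(* The darts at the vertices of a triangle are numbered v 0, ..., v 11, those of
   each vertex counterclockwise starting with a, b, c respectively. The tables
   [next_in], [opp_in], ... below give node, opp, outward, inward, ... in terms of
   these numbers. *)
Definition tri_darts := vertex a ++ vertex b ++ vertex c.
Let s := tri_darts.
Let v := nth a s.

Let cr : [&& crossing a, crossing b & crossing c]. Proof. by case: abc. Qed.
Let ca : crossing a. Proof. by case/and3P: cr. Qed.
Let cb : crossing b. Proof. by case/and3P: cr. Qed.
Let cc : crossing c. Proof. by case/and3P: cr. Qed.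
Lemma tri_edge_a : edge a = node b. Proof. by case: abc => _ _ []. Qed.
Lemma tri_edge_b : edge b = node c. Proof. by case: abc => _ _ []. Qed.
Lemma tri_edge_c : edge c = node a. Proof. by case: abc => _ _ []. Qed.

Lemma vertex_uniq (d : dart D) : crossing d -> uniq (vertex d).
Proof.
by move=> cd; rewrite /= !inE !(nodeE DP) !eq_node2 // crossing_node.
Qed.

Lemma vertex_disjoint (d e : dart D) : ~~ same_vertex d e ->
  forall x, x \in vertex d -> x \in vertex e -> False.
Proof.
rewrite same_vertexE // => /negP de x xd xe; case: de.
by apply: (vertex_trans DP _ xd); rewrite vertex_sym.
Qed.

Lemma tri_uniq : uniq s.
Proof.
case: abc => _ /and3P[nab nbc nca] _ _ _.
rewrite !cat_uniq !vertex_uniq // andbT !andTb.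
apply/andP; split; last first.
  by apply/hasPn=> x xc; apply/negP=> xb; apply: (vertex_disjoint nbc xb xc).
apply/hasPn=> x; rewrite mem_cat => /orP[] xb; apply/negP=> xa.
  exact: (vertex_disjoint nab xa xb).
exact: (vertex_disjoint nca xb xa).
Qed.

Lemma tri_vE i j : i < 12 -> j < 12 -> (v i == v j) = (i == j).
Proof. by move=> i12 j12; rewrite nth_uniq ?tri_uniq. Qed.

Lemma tri_sP x : x \in s -> exists2 k, k < 12 & x = v k.
Proof. by move=> xs; exists (index x s); rewrite ?index_mem // /v nth_index. Qed.

Lemma tri_s_v k : k < 12 -> v k \in s. Proof. by move=> k12; apply: mem_nth. Qed.

Definition tri_side x := x \in [:: a; edge a; b; edge b; c; edge c].
Definition outward x := if tri_side x then opp x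
    else if tri_side (opp x) then edge (opp x) else x.
Definition inward x := if tri_side x then opp (edge x)
    else if tri_side (opp x) then opp x else x.
Definition tri_left := [eta id with
    a |-> edge b, node a |-> opp c, opp a |-> a, node (opp a) |-> opp b,
    b |-> edge c, node b |-> opp a, opp b |-> a, node (opp b) |-> opp c,
    c |-> edge a, node c |-> opp b, opp c |-> a, node (opp c) |-> opp a].

Lemma tri_v_nonside x : x \notin s -> tri_side x = false.
Proof.
apply: contraNF; rewrite /tri_side tri_edge_a tri_edge_b tri_edge_c !inE.
by case/or4P=> [->|->|->|/or3P[]->]; rewrite ?orbT.
Qed.

Lemma tri_side_v k : k < 12 -> tri_side (v k) = (k \in [:: 0; 5; 4; 9; 8; 1]).
Proof.
move=> k12; have e : [:: a; edge a; b; edge b; c; edge c] = [seq v i | i <- [:: 0; 5; 4; 9; 8; 1]].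
  by rewrite /= tri_edge_a tri_edge_b tri_edge_c.
rewrite /tri_side e; apply/mapP/idP=> [[i i6 /eqP]|k6]; last by exists k.
rewrite tri_vE // => [/eqP-> //|].
by move: i6; rewrite !inE => /or3P[/eqP->|/eqP->|/or4P[]/eqP->].
Qed.

Definition next_in i := nth 0 [:: 1;2;3;0;5;6;7;4;9;10;11;8] i.
Definition opp_in i := nth 0 [:: 2;3;0;1;6;7;4;5;10;11;8;9] i.
Definition out_in i := nth 0 [:: 2;3;5;8;6;7;9;0;10;11;1;4] i.
Definition inw_in i := nth 0 [:: 7;10;0;1;11;2;4;5;3;6;8;9] i.
Definition left_in i := nth 0 [:: 9;10;0;6;1;2;0;10;5;6;0;2] i.

Ltac cases12 k := do 12?[case: k => [|k]]; rewrite ?ltnS ?ltn0 //.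

Lemma tri_node_v k : k < 12 -> node (v k) = v (next_in k).
Proof. by cases12 k => _; rewrite /v /= ?nodeK4. Qed.

Lemma tri_opp_v k : k < 12 -> opp (v k) = v (opp_in k).
Proof. by cases12 k => _; rewrite /v /opp /= ?nodeK4. Qed.

Lemma tri_edge0 : edge (v 0) = v 5. Proof. exact: tri_edge_a. Qed.
Lemma tri_edge5 : edge (v 5) = v 0. Proof. by rewrite -tri_edge0 edgeK. Qed.
Lemma tri_edge4 : edge (v 4) = v 9. Proof. exact: tri_edge_b. Qed.
Lemma tri_edge9 : edge (v 9) = v 4. Proof. by rewrite -tri_edge4 edgeK. Qed.
Lemma tri_edge8 : edge (v 8) = v 1. Proof. exact: tri_edge_c. Qed.
Lemma tri_edge1 : edge (v 1) = v 8. Proof. by rewrite -tri_edge8 edgeK. Qed.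
Definition tri_edgeE := (tri_edge0, tri_edge5, tri_edge4, tri_edge9, tri_edge8, tri_edge1).

(* Only the edges of the triangle are listed; the other entries are junk. *)
Definition tri_edge_in i := nth 0 [:: 5;8;0;0;9;0;0;0;1;4] i.

Lemma tri_edge_v k : k \in [:: 0; 5; 4; 9; 8; 1] -> edge (v k) = v (tri_edge_in k).
Proof. by rewrite !inE => /or4P[|||/or3P[]] /eqP->; rewrite tri_edgeE. Qed.

Lemma tri_out_v k : k < 12 -> outward (v k) = v (out_in k).
Proof. by cases12 k => _; rewrite /outward !tri_opp_v // !tri_side_v //= ?tri_edgeE. Qed.

Lemma tri_inw_v k : k < 12 -> inward (v k) = v (inw_in k).
Proof. by cases12 k => _; rewrite /inward !tri_side_v // ?tri_edgeE !tri_opp_v //= !tri_side_v. Qed.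

Lemma tri_s_node x : (node x \in s) = (x \in s).
Proof. by rewrite !mem_cat !vertex_node. Qed.

Lemma tri_s_opp x : (opp x \in s) = (x \in s).
Proof. by rewrite /opp !tri_s_node. Qed.

Lemma tri_out_out x : x \notin s -> outward x = x.
Proof. by move=> xs; rewrite /outward !tri_v_nonside ?tri_s_opp. Qed.

Lemma tri_inw_out x : x \notin s -> inward x = x.
Proof. by move=> xs; rewrite /inward !tri_v_nonside ?tri_s_opp. Qed.

Lemma outwardK : cancel outward inward.
Proof.
move=> x; have [/tri_sP[k k12 ->]|xs] := boolP (x \in s); last by rewrite tri_out_out ?tri_inw_out.
by rewrite tri_out_v // tri_inw_v; move: k12; cases12 k.
Qed.

Lemma inwardK : cancel inward outward.
Proof.
move=> x; have [/tri_sP[k k12 ->]|xs] := boolP (x \in s); last by rewrite tri_inw_out ?tri_out_out.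
by rewrite tri_inw_v // tri_out_v; move: k12; cases12 k.
Qed.

Lemma tri_left_out x : x \notin s -> tri_left x = x.
Proof.
rewrite /s /tri_darts !mem_cat !inE !negb_or.
case/andP=> /and4P[/negPf a0 /negPf a1 /negPf a2 /negPf a3].
case/andP=> /and4P[/negPf b0 /negPf b1 /negPf b2 /negPf b3].
case/and4P=> [/negPf c0 /negPf c1 /negPf c2 /negPf c3].
by rewrite /tri_left /= /opp a0 a1 a2 a3 b0 b1 b2 b3 c0 c1 c2 c3.
Qed.

Lemma tri_left_v k : k < 12 -> tri_left (v k) = v (left_in k).
Proof.
move=> k12; have -> : tri_left = [eta id with
    v 0 |-> v 9, v 1 |-> v 10, v 2 |-> v 0, v 3 |-> v 6,
    v 4 |-> v 1, v 5 |-> v 2, v 6 |-> v 0, v 7 |-> v 10,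
    v 8 |-> v 5, v 9 |-> v 6, v 10 |-> v 0, v 11 |-> v 2].
  by rewrite /tri_left tri_edge_a tri_edge_b tri_edge_c.
by move: k12; cases12 k => _; rewrite /= !tri_vE.
Qed.

Lemma tri_rn k : k < 12 -> region (v k) (edge (v (next_in k))).
Proof. by move=> k12; rewrite -tri_node_v // region_node. Qed.

Lemma tri_region04 : region (v 0) (v 4).
Proof. by have := region_node DP b; rewrite -tri_edge_a edgeK // region_sym. Qed.

(** [outward x] takes over the edge of [x] after the move; unless that edge is a side, the region on
    its left is unchanged. This treats uniformly the edges leaving the triangle, whose far ends may
    again be at the triangle. *)
Lemma tri_leg_left x : ~~ tri_side x -> region x (tri_left (outward x)).
Proof.
have [/tri_sP[k k12 ->]|xs _] := boolP (x \in s); last first.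
  by rewrite tri_out_out // tri_left_out // region_refl.
rewrite tri_side_v // tri_out_v // tri_left_v; last by move: k12; cases12 k.
move: k12; cases12 k => _ _ //=; rewrite ?region_refl //.
- by have := tri_rn (isT : 3 < 12); rewrite /= tri_edgeE.
- by have := tri_rn (isT : 7 < 12); rewrite /= tri_edgeE.
- by have := tri_rn (isT : 11 < 12); rewrite /= tri_edgeE.
Qed.

Lemma tri_side_edge x : tri_side (edge x) = tri_side x.
Proof.
apply/idP/idP; rewrite /tri_side !inE; do 5?[case/orP]; move/eqP;
  first [move=> -> | move/(canRL (edgeK DP))->]; rewrite ?edgeK // ?eqxx ?orbT //.
Qed.

Let edge' := @edge E.
Let l := tri_left.

Lemma flip_edgeE x : edge' x = outward (edge (inward x)). Proof. by []. Qed.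

Lemma flip_edge_outward x : edge' (outward x) = outward (edge x).
Proof. by rewrite flip_edgeE outwardK. Qed.

Lemma flip_edge_v k : k \in [:: 2; 3; 6; 7; 10; 11] ->
  edge' (v k) = v (nth 0 [:: 0;0;7;10;0;0;11;2;0;0;3;6] k).
Proof.
by rewrite !inE => /or4P[|||/or3P[]] /eqP->;
  rewrite flip_edgeE tri_inw_v //= tri_edgeE tri_out_v.
Qed.

Lemma outward_glink x : connect (@glink D) x (outward x).
Proof.
have nn y : connect (@glink D) y (opp y).
  apply: (@connect_trans _ _ (node y)); apply: connect1; by rewrite /glink eqxx orbT.
rewrite /outward; case: ifP => // _; case: ifP => // _.
by apply: connect_trans (nn x) _; apply: connect1; rewrite /glink eqxx.
Qed.

Lemma tie_outward x : tie x (outward x).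
Proof.
have [xs|xs] := boolP (x \in s); last by rewrite tri_out_out // tie_refl.
have cx : crossing x.
  by move: xs; rewrite !mem_cat => /or3P[] /(crossing_vertex DP)->.
rewrite /outward; case: ifP => _; first exact: tie_opp.
case: ifP => _; last exact: tie_refl.
by apply: (tie_trans DP (tie_opp DP cx)); apply: td_tie_edge.
Qed.

Let glink_sym (F : tgraph) : involutive (@edge F) -> (forall x : dart F, iter 4 node x = x) ->
  connect_sym (@glink F).
Proof.
move=> eK n4; apply: (relU_sym (e := frel edge) (e' := frel node)); apply: fconnect_sym.
  exact: inv_inj.
by move=> x y xy; rewrite -(n4 x) -(n4 y) /= xy.
Qed.

Let eK' : involutive edge'.
Proof. by move=> x; rewrite !flip_edgeE outwardK edgeK // inwardK. Qed.

Let glink_symD : connect_sym (@glink D).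
Proof. by apply: glink_sym; [exact: edgeK | exact: td_node4]. Qed.
Let glink_symE : connect_sym (@glink E).
Proof. by apply: glink_sym; [exact: eK' | exact: (td_node4 DP)]. Qed.

Let ce' (x : dart E) : connect (@glink E) x (edge' x).
Proof. by apply: connect1; rewrite /glink eqxx. Qed.
Let cn' (x : dart E) : connect (@glink E) x (@node D x).
Proof. by apply: connect1; rewrite /glink /= eqxx orbT. Qed.

Lemma tri_glink (x y : dart D) : x \in s -> y \in s -> connect (@glink E) x y.
Proof.
suff key (z : dart D) : z \in s -> connect (@glink E) (v 2) z.
  by move=> xs ys; apply: (@connect_trans _ _ (v 2)); [rewrite glink_symE|]; apply: key.
have cnn k i : k < 12 -> connect (@glink E) (v k) (v (iter i next_in k)).
  move=> k12; elim: i => [|i IH] /=; first exact: connect0.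
  apply: connect_trans IH _; rewrite -tri_node_v; first exact: cn'.
  by elim: i => //= i; move: (iter i _ _) => {k12} k; rewrite /next_in; cases12 k.
have c27 : connect (@glink E) (v 2) (v 7).
  by rewrite (_ : v 7 = edge' (v 2)) ?ce' // flip_edge_v.
have c611 : connect (@glink E) (v 6) (v 11).
  by rewrite (_ : v 11 = edge' (v 6)) ?ce' // flip_edge_v.
have c2_11 : connect (@glink E) (v 2) (v 11).
  by apply: connect_trans c27 _; apply: connect_trans c611; exact: (cnn 7 3).
case/tri_sP=> k k12 ->; move: k12; cases12 k => _.
- exact: (cnn 2 2).
- exact: (cnn 2 3).
- exact: connect_trans c27 (cnn 7 1 isT).
- exact: connect_trans c27 (cnn 7 2 isT).
- exact: connect_trans c27 (cnn 7 3 isT).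
- exact: connect_trans c2_11 (cnn 11 1 isT).
- exact: connect_trans c2_11 (cnn 11 2 isT).
- exact: connect_trans c2_11 (cnn 11 3 isT).
Qed.

Lemma outward_s x : (outward x \in s) = (x \in s).
Proof.
have [/tri_sP[k k12 ->]|xs] := boolP (x \in s); last by rewrite tri_out_out ?(negPf xs).
by rewrite tri_out_v // tri_s_v //; move: k12; cases12 k.
Qed.

Lemma flip_glink x y : connect (@glink E) x y = connect (@glink D) x y.
Proof.
have co (z : dart E) : connect (@glink E) z (outward z).
  have [zs|zs] := boolP ((z : dart D) \in s); last by rewrite tri_out_out.
  by apply: tri_glink; rewrite ?outward_s.
apply/idP/idP; apply: connect_sub => {}x {}y; case/orP=> /eqP<-.
- change (connect (@glink D) x (edge' x)); rewrite flip_edgeE.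
  apply: connect_trans (outward_glink _); rewrite -{1}(inwardK x).
  apply: (@connect_trans _ _ (inward x)); first by rewrite glink_symD outward_glink.
  by apply: connect1; rewrite /glink eqxx.
- by apply: connect1; rewrite /glink /= eqxx orbT.
- apply: connect_trans (co x) _; apply: connect_trans (ce' _) _.
  by rewrite flip_edge_outward glink_symE co.
- exact: cn'.
Qed.

(** No region is lost. This serves twice: in counting the regions, and in replacing old region links
    by new ones in the proof of connectedness. *)
Lemma tri_left_onto x : exists2 y, region x (l y) & connect (@glink E) x y.
Proof.
have [xs|xs] := boolP (x \in s); last first.
  by exists x; rewrite ?connect0 // /l tri_left_out // region_refl.
suff [y ys xy] : exists2 y, y \in s & region x (l y).
  by exists y => //; apply: tri_glink.
case/tri_sP: xs => k k12 ->.
have ex j : j < 12 -> region (v k) (v (left_in j)) -> exists2 y, y \in s & region (v k) (l y).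
  by move=> j12 kj; exists (v j); rewrite ?tri_s_v // /l tri_left_v.
have rr x := region_refl DP x.
move: k12 ex; cases12 k => _ ex.
- exact: (ex 2).
- exact: (ex 4).
- exact: (ex 5).
- by apply: (ex 8) => //=; have := @tri_rn 3 isT; rewrite /= tri_edge0.
- by apply: (ex 2) => //=; rewrite region_sym // tri_region04.
- exact: (ex 8).
- exact: (ex 3).
- by apply: (ex 0) => //=; have := @tri_rn 7 isT; rewrite /= tri_edge4.
- apply: (ex 2) => //=; apply: (@region_trans _ DP _ (v 4)); last by rewrite region_sym // tri_region04.
  by have := @tri_rn 8 isT; rewrite /= tri_edge9.
- exact: (ex 0).
- exact: (ex 1).
- by apply: (ex 4) => //=; have := @tri_rn 11 isT; rewrite /= tri_edge8.
Qed.

Lemma flip_region_edge x : region (l x) (l (edge' (node x))).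
Proof.
have [/tri_sP[k k12 ->]|xs] := boolP (x \in s); last first.
  rewrite /l tri_left_out // flip_edgeE tri_inw_out ?tri_s_node //.
  apply: (region_trans DP (region_node DP x)); apply: tri_leg_left.
  by rewrite tri_side_edge tri_v_nonside // tri_s_node.
have leg j i : j \in [:: 3; 7; 11; 2; 6; 10] -> next_in i = j -> i < 12 ->
    region (v i) (l (outward (edge (v j)))).
  move=> jl ij i12; apply: (region_trans DP (tri_rn i12)); rewrite ij.
  apply: tri_leg_left; rewrite tri_side_edge tri_side_v.
    by move: jl; rewrite !inE => /or4P[|||/or3P[]] /eqP->.
  by move: jl; rewrite !inE => /or4P[|||/or3P[]] /eqP->.
rewrite tri_node_v // flip_edgeE tri_inw_v; last by move: k12; cases12 k.
rewrite /l tri_left_v //; move: k12; cases12 k => _; try exact: leg.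
all: rewrite tri_edge_v // tri_out_v // tri_left_v //; exact: region_refl.
Qed.

(** Here Euler's formula itself is transported, term by term: the vertices are untouched, the edges
    are conjugated by the bijection [outward], the regions are pulled back along a map that meets
    every class, and the graph components are the same. *)
Lemma flip_triangle_diagram : is_diagram E.
Proof.
have rE : equivalence (@region E) by exact/pullback_equivalence/(td_region DP).
case: (DP) => ne eK en n4 nn ov rg re ti te ta cn eu; split => //.
- move=> x; change (edge' x != x); rewrite -{2}(inwardK x) flip_edgeE.
  by rewrite (can_eq outwardK) en.
- exact: flip_region_edge.
- move=> x; change (@tie D x (edge' x)); rewrite flip_edgeE.
  apply: (tie_trans DP _ (tie_outward _)); rewrite -{1}(inwardK x).
  apply: (@tie_trans _ DP _ (inward x)); first by rewrite tie_sym // tie_outward.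
  exact: te.
- have sE : connect_sym (@slink E) by apply: slink_sym => //; exact: eK'.
  have gs x y : connect (@glink E) x y -> connect (@slink E) x y.
    by apply: connect_sub => {}x {}y xy; apply: connect1; rewrite /slink xy.
  move=> x y; apply: connect_sub (cn x y) => {}x {}y /orP[xy|xy].
    by apply: gs; rewrite flip_glink connect1.
  have [x' xx' /gs cx] := tri_left_onto x; have [y' yy' /gs cy] := tri_left_onto y.
  apply: connect_trans cx _; rewrite sE; apply: connect_trans cy _.
  apply: connect1; apply/orP; right; change (region (l y') (l x')).
  apply: (region_trans DP _ xx'); rewrite region_sym //.
  exact: (region_trans DP xy yy').
rewrite (eq_n_comp flip_glink).
transitivity (fcard (@edge D) predT + (n_comp (@glink D) predT).+1)%N.
  rewrite -eu; congr addn.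
  rewrite (n_comp_pullback (l := l)) // => x.
  by have [y xy _] := tri_left_onto x; exists y.
congr addn; symmetry; rewrite -(fcard_conjugate eK outwardK inwardK).
exact: eq_n_comp.
Qed.

End Flip.

(** * Polygons and lenses *)

Definition crossing_darts (D : tgraph) : nat := #|[pred x : dart D | crossing x]|.

Lemma isom_refl (D : tgraph) : isom D D.
Proof. by exists id; split=> //; exists id. Qed.

(** * Deleting a marked point or an empty circle *)

Section DeletePair.
Variable D : tgraph.
Hypothesis DP : is_diagram D.
Variable x : dart D.
Hypothesis cx : ~~ crossing x.
Let y := node x.
Let S := {z : dart D | z \notin [:: x; y]}.

Let valS (z : S) : val z \notin [:: x; y]. Proof. exact: (valP z). Qed.

Let nnx : node (node x) = x. Proof. exact: node2_noncrossing. Qed.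
Let ny : node y = x. Proof. exact: nnx. Qed.

Let xy : x != y. Proof. by rewrite eq_sym td_node_neq. Qed.

Let node_out z : (node z \notin [:: x; y]) = (z \notin [:: x; y]).
Proof.
by rewrite !inE /y node_injE // -[X in node z == X]nnx node_injE // orbC.
Qed.

Let nodeS (z : S) : S := Sub (node (val z)) (etrans (node_out (val z)) (valP z)).

Let card_S : #|{: S}| < #|dart D|.
Proof.
rewrite card_sig -(cardC [in [:: x; y]]) -[X in X < _]add0n ltn_add2r.
by apply/card_gt0P; exists x; rewrite !inE eqxx.
Qed.

Let card_crossing_S (F : S -> S) (o : pred S) (r t : rel S) :
  crossing_darts (TGraph F nodeS o r t) <= crossing_darts D.
Proof.
rewrite /crossing_darts -(card_image (@val_inj _ _ S)); apply: subset_leq_card.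
apply/subsetP=> z /imageP[u]; rewrite !inE => cu ->.
by move: cu; rewrite /crossing /= -(inj_eq val_inj).
Qed.

Section Unsubdivide.
Hypothesis ex_y : edge x != y.
Let p := edge x.
Let q := edge y.

Let p_out : p \notin [:: x; y].
Proof. by rewrite !inE negb_or td_edge_neq. Qed.
Let q_out : q \notin [:: x; y].
Proof.
rewrite !inE negb_or td_edge_neq // andbT; apply: contra ex_y => /eqP qx.
by rewrite -qx edgeK.
Qed.
Let p0 : S := Sub p p_out.
Let ep : edge p = x. Proof. exact: edgeK. Qed.
Let eq : edge q = y. Proof. exact: edgeK. Qed.
Let pq : p != q. Proof. by rewrite edge_injE. Qed.

Let edge_x z : (edge z == x) = (z == p). Proof. by rewrite -ep edge_injE. Qed.
Let edge_y z : (edge z == y) = (z == q). Proof. by rewrite -eq edge_injE. Qed.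

Let eS z := if z == p then q else if z == q then p else edge z.
Let eS_out z : z \notin [:: x; y] -> eS z \notin [:: x; y].
Proof.
rewrite /eS; case: ifP => // zp; case: ifP => // zq _.
by rewrite !inE negb_or edge_x edge_y zp zq.
Qed.
Let edgeS (z : S) : S := Sub (eS (val z)) (eS_out (valP z)).

Let G : tgraph := {| dart := S; edge := edgeS; node := nodeS;
  over := fun z => over (val z); region := fun z w => region (val z) (val w);
  tie := fun z w => tie (val z) (val w) |}.

(** [x] is sent to [q], not to [p], because the region to the left of [x] is that of
    [edge (node x)]; in this way [pr] preserves regions as well as ties. *)
Let pr z : dart D := if z == x then q else if z == y then p else z.
Let pr_out z : pr z \notin [:: x; y].
Proof.
rewrite /pr; case: ifP => // zx; case: ifP => // zy.
by rewrite !inE zx zy.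
Qed.
Let prS z : S := Sub (pr z) (pr_out z).
Let prx : pr x = q. Proof. by rewrite /pr eqxx. Qed.
Let pry : pr y = p. Proof. by rewrite /pr eq_sym (negPf xy) eqxx. Qed.
Let pr_id z : z \notin [:: x; y] -> pr z = z.
Proof. by rewrite !inE /pr negb_or => /andP[/negPf-> /negPf->]. Qed.

Let region_pr z : region (pr z) z.
Proof.
rewrite /pr region_sym //; case: eqP => [->|_]; first exact: region_node.
by case: eqP => [->|_]; [rewrite -/p /p -{1}ny; have := region_node DP y; rewrite ny | exact: region_refl].
Qed.

Let tie_pr z : tie (pr z) z.
Proof.
have txy : tie x y.
  by have := td_tie_across DP x; rewrite /across (negPf cx).
rewrite /pr tie_sym //; case: eqP => [->|_].
  by apply: (tie_trans DP txy); apply: td_tie_edge.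
case: eqP => [->|_]; last exact: tie_refl.
by apply: (@tie_trans _ DP _ x); [rewrite tie_sym | apply: td_tie_edge].
Qed.

Let eS_pr z : region (edge z) (eS z) /\ tie (edge z) (eS z).
Proof.
have := region_pr (edge z); have := tie_pr (edge z); rewrite ![_ _ (edge z)]tie_sym // ![_ _ (edge z)]region_sym //.
rewrite /eS; case: eqP => [->|_]; first by rewrite ep prx.
case: eqP => [->|_]; first by rewrite eq pry.
by rewrite tie_refl // region_refl.
Qed.

Lemma unsubdivide : exists (F : diagram) (d : dart F), isom D (subdivide d) /\
  #|dart F| < #|dart D| /\ crossing_darts F <= crossing_darts D.
Proof.
have eSK z : z \notin [:: x; y] -> eS (eS z) = z.
  rewrite !inE negb_or => /andP[zx zy]; rewrite /eS.
  case: (z =P p) => [->|zp]; first by rewrite [q == p]eq_sym (negPf pq) eqxx.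
  case: (z =P q) => [->|zq]; first by rewrite eqxx.
  have -> : (edge z == p) = false by rewrite edge_injE // (negPf zx).
  have -> : (edge z == q) = false by rewrite edge_injE // (negPf zy).
  exact: edgeK.
have Gcross (z : dart G) : crossing z = crossing (val z).
  by rewrite /crossing -(inj_eq val_inj).
have rE : equivalence (@region G) by exact/(pullback_equivalence val)/(td_region DP).
have GP : is_diagram G.
  apply: is_diagram_planar.
  - by apply/card_gt0P; exists p0.
  - by move=> z; apply: val_inj; rewrite /= eSK //; exact: valS.
  - move=> z; rewrite -(inj_eq val_inj) /= /eS.
    by case: (val z =P p) => [->|_]; [rewrite eq_sym | case: (val z =P q) => [->//|_]; apply: td_edge_neq].
  - by move=> z; apply: val_inj; apply: (td_node4 DP).
  - by move=> z; rewrite -(inj_eq val_inj); apply: (td_node_neq DP).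
  - by move=> z; rewrite Gcross; apply: (td_over DP).
  - exact: rE.
  - move=> z; apply: (region_trans DP (region_node DP (val z))).
    by have [] := eS_pr (node (val z)).
  - exact/(pullback_equivalence val)/(td_tie DP).
  - move=> z; apply: (tie_trans DP (td_tie_edge DP (val z))).
    by have [] := eS_pr (val z).
  - move=> z; have := td_tie_across DP (val z); rewrite /across Gcross.
    by case: ifP.
  - have sE : connect_sym (@slink G).
      apply: slink_sym => [z|z|]; last exact: rE.
        by apply: val_inj; rewrite /= eSK //; exact: valS.
      by apply: val_inj; apply: (td_node4 DP).
    move=> z w.
    suff key u v : connect (@slink D) u v -> connect (@slink G) (prS u) (prS v).
      have e (r : S) : r = prS (val r) by apply: val_inj; rewrite /= pr_id //; exact: valS.
      by rewrite (e z) (e w); apply/key/(td_conn DP).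
    case/connectP=> r rp ->{v}; elim: r u rp => [|v r IH] u /=; first by rewrite connect0.
    case/andP=> uv /IH; apply: connect_trans => {IH}.
    have epq : connect (@slink G) (prS x) (prS y).
      apply: connect1; rewrite /slink /glink -(inj_eq val_inj) /= prx pry /eS.
      by rewrite [q == p]eq_sym (negPf pq) !eqxx.
    case/orP: uv => [/orP[]/eqP<-|uv].
    + case: (boolP (u \in [:: x; y])) => [|uo].
        rewrite !inE => /orP[]/eqP->.
          by rewrite -/p (_ : prS p = prS y) //; apply: val_inj; rewrite /= pry pr_id.
        rewrite -/q (_ : prS q = prS x); first by rewrite sE.
        by apply: val_inj; rewrite /= prx pr_id.
      apply: connect1; rewrite /slink /glink -!(inj_eq val_inj) /= (pr_id uo) /eS.
      case: (u =P p) => [->|/eqP up]; first by rewrite ep prx eqxx.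
      case: (u =P q) => [->|/eqP uq]; first by rewrite eq pry eqxx.
      rewrite (_ : pr (edge u) = edge u) ?eqxx // pr_id // !inE negb_or.
    by rewrite edge_x edge_y up uq.
    + case: (boolP (u \in [:: x; y])) => [|uo].
        rewrite !inE => /orP[]/eqP->; first exact: epq.
        by rewrite ny sE epq.
      by apply: connect1; rewrite /slink /glink -!(inj_eq val_inj) /= !pr_id ?node_out // eqxx orbT.
    + apply: connect1; apply/orP; right; rewrite /=.
      apply: (region_trans DP (region_pr u)); rewrite region_sym //.
      by apply: (region_trans DP (region_pr v)); rewrite region_sym.
  move=> z ze zn.
  (* The cycle is pulled back to D along [prS], and the colouring obtained there is restricted. *)
  have [u|u|chi cc zE] := diagram_planar DP (z := fun u => z (prS u)).
  + case: (boolP (u \in [:: x; y])) => [|uo].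
      rewrite !inE => /orP[]/eqP->.
        rewrite -/p -ze; congr z; apply: val_inj.
        by rewrite /= pr_id // prx /eS eqxx.
      rewrite -/q -ze; congr z; apply: val_inj.
      by rewrite /= pr_id // pry /eS eqxx [q == p]eq_sym (negPf pq).
    rewrite -[RHS]ze; apply: congr1; apply: val_inj; rewrite /= (pr_id uo) /eS.
    case: (u =P p) => [->|/eqP up]; first by rewrite ep prx.
    case: (u =P q) => [->|/eqP uq]; first by rewrite eq pry.
    rewrite pr_id // !inE negb_or.
    by rewrite edge_x edge_y up uq.
  + case: (boolP (u \in [:: x; y])) => [|uo].
      have zpq : z (prS x) = z (prS y).
        rewrite -ze; congr z; apply: val_inj.
        by rewrite /= prx pry /eS [q == p]eq_sym (negPf pq) eqxx.
      rewrite !inE /even_at => /orP[]/eqP->; first by rewrite (negPf cx) zpq.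
      by rewrite crossing_node // (negPf cx) ny zpq.
    have := zn (prS u); rewrite /even_at Gcross /= (pr_id uo).
    have e (w : S) : w = prS (val w) by apply: val_inj; rewrite /= pr_id //; exact: valS.
    rewrite ![z (nodeS _)](congr1 z (e _)) /=.
    by rewrite !(pr_id uo).
  exists (fun u => chi (val u)); first by move=> u w /cc.
  move=> u; have := zE (val u); rewrite (_ : prS (val u) = u).
    rewrite /cutset => ->; congr addb.
    by apply: cc; have [] := eS_pr (val u).
  by apply: val_inj; rewrite /= pr_id //; exact: valS.
exists (Diagram GP), p0; split; last by split; [exact: card_S | exact: card_crossing_S].
pose h u : dart (@subdivide G p0) :=
  if u == x then inr false else if u == y then inr true else inl (prS u).
have h_x : h x = inr false by rewrite /h eqxx.
have h_y : h y = inr true by rewrite /h eq_sym (negPf xy) eqxx.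
have h_o u : u \notin [:: x; y] -> h u = inl (prS u).
  by rewrite !inE /h negb_or => /andP[/negPf-> /negPf->].
have edge_p0 : val (edgeS p0) = q by rewrite /= /eS eqxx.
exists h; split.
  exists (fun w : dart (@subdivide G p0) => match w with inl w => val w | inr false => x | inr true => y end).
    move=> u; case: (boolP (u \in [:: x; y])) => [|uo]; last by rewrite h_o //= pr_id.
    by rewrite !inE => /orP[]/eqP->; rewrite ?h_x ?h_y.
  case=> [w|[]] //=; rewrite ?h_x ?h_y // h_o; last exact: valS.
  by congr inl; apply: val_inj; rewrite /= pr_id //; exact: valS.
have hpar u : match h u with inl w => val w | inr false => q | inr true => p end = pr u.
  case: (boolP (u \in [:: x; y])) => [|uo]; last by rewrite h_o.
  by rewrite !inE => /orP[]/eqP->; rewrite ?h_x ?h_y ?prx ?pry.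
split.
- move=> u; case: (boolP (u \in [:: x; y])) => [|uo].
    rewrite !inE => /orP[]/eqP->.
      by rewrite -/p h_x h_o //=; congr inl; apply: val_inj; rewrite /= pr_id.
    by rewrite -/q h_y h_o //=; congr inl; apply: val_inj; rewrite /= pr_id // /eS ?eqxx.
  rewrite (h_o _ uo) /= -!(inj_eq val_inj) /= pr_id // /eS eqxx.
  case: (u =P p) => [->|/eqP up]; first by rewrite ep h_x.
  case: (u =P q) => [->|/eqP uq]; first by rewrite eq h_y.
  have eo : edge u \notin [:: x; y].
    rewrite !inE negb_or.
    by rewrite edge_x edge_y up uq.
  rewrite h_o //; congr inl; apply: val_inj; rewrite /= !pr_id // /eS.
  by rewrite (negPf up) (negPf uq).
- move=> u; case: (boolP (u \in [:: x; y])) => [|uo].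
    by rewrite !inE => /orP[]/eqP->; rewrite -/y ?ny ?h_x ?h_y.
  rewrite !h_o ?node_out //=; congr inl; apply: val_inj.
  by rewrite /= !pr_id ?node_out.
- move=> u cu; have uo : u \notin [:: x; y].
    rewrite !inE; apply: contraL cu => /orP[]/eqP->; first exact: cx.
    by rewrite crossing_node.
  by rewrite h_o //= pr_id.
- move=> u w; transitivity (region (pr u) (pr w)).
    rewrite -!hpar /=; case: (h u) => [?|[]]; case: (h w) => [?|[]] //=; by rewrite ?edge_p0 // /eS eqxx.
  apply/idP/idP => uw.
    by apply: (region_trans DP _ (region_trans DP uw (region_pr w))); rewrite region_sym.
  apply: (region_trans DP (region_pr u)); apply: (region_trans DP uw).
  by rewrite region_sym.
- move=> u w; transitivity (tie (pr u) (pr w)).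
    rewrite -!hpar /=; case: (h u) => [?|[]]; case: (h w) => [?|[]] //=; by rewrite ?edge_p0 // /eS eqxx.
  apply/idP/idP => uw.
    by apply: (tie_trans DP _ (tie_trans DP uw (tie_pr w))); rewrite tie_sym.
  apply: (tie_trans DP (tie_pr u)); apply: (tie_trans DP uw).
  by rewrite tie_sym.
Qed.
End Unsubdivide.

Section UnaddCircle.
Hypothesis exy : edge x = y.
Hypothesis rx : forall z, region x z -> z = x.

Let eyx : edge y = x. Proof. by rewrite -exy edgeK. Qed.

Let edge_out z : (edge z \notin [:: x; y]) = (z \notin [:: x; y]).
Proof.
by rewrite !inE -(edge_injE DP z x) -(edge_injE DP z y) exy eyx orbC.
Qed.

Let edgeS (z : S) : S := Sub (edge (val z)) (etrans (edge_out (val z)) (valS z)).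

Let G : tgraph := {| dart := S; edge := edgeS; node := nodeS;
  over := fun z => over (val z); region := fun z w => region (val z) (val w);
  tie := fun z w => tie (val z) (val w) |}.

Let txy : tie x y. Proof. by rewrite -exy td_tie_edge. Qed.

(** By [rx] the disc to the left of [x] is empty. By connectedness either nothing else exists, or
    the region on the other side has another boundary dart [d], at which the circle can be inserted
    again. *)
Lemma unadd_circle : isom D circle \/
  exists (F : diagram) (d : dart F) (t : option (dart F)), isom D (add_circle d t) /\
  #|dart F| < #|dart D| /\ crossing_darts F <= crossing_darts D.
Proof.
have rxy : region x y = false by apply/negP=> /rx /eqP; rewrite eq_sym (negPf xy).
have [/forallP all_xy|] := boolP [forall z, z \in [:: x; y]].
  left; pose h z := z == y.
  have hx : h x = false by rewrite /h (negPf xy).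
  have hy : h y = true by rewrite /h eqxx.
  have cases (Q : dart D -> Prop) : Q x -> Q y -> forall z, Q z.
    by move=> Qx Qy z; have := all_xy z; rewrite !inE => /orP[]/eqP->.
  exists h; split.
    exists (fun b : bool => if b then y else x); last by case; rewrite /= ?hx ?hy.
    by apply: (@cases); rewrite ?hx ?hy.
  split; try by apply: (@cases); rewrite /= ?exy ?eyx -/y ?ny ?hx ?hy // (negPf cx).
  - by apply: (@cases) => //; rewrite ?crossing_node // (negPf cx).
  - by apply: (@cases); apply: (@cases); rewrite /= ?hx ?hy ?region_refl ?rxy // region_sym // rxy.
  - by apply: (@cases); apply: (@cases); rewrite /= ?tie_refl // ?txy // tie_sym // txy.
rewrite negb_forall => /existsP[w0 w0_out]; right.
have [d d_out yd] : exists2 d, d \notin [:: x; y] & region y d.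
  case: (boolP [exists d, (d \notin [:: x; y]) && region y d]) => [/existsP[d /andP[]]|]; first by exists d.
  rewrite negb_exists => /forallP nod; case/negP: w0_out.
  have cl : closed (@slink D) [:: x; y].
    apply: intro_closed; first by apply: slink_sym; [exact: edgeK | exact: td_node4 | exact: td_region].
    move=> u v uv uin; move: uv uin; rewrite !inE => uv /orP[]/eqP uE; move: uv; rewrite uE.
      case/orP=> [/orP[]/eqP<-|/rx->]; rewrite ?exy -/y ?eqxx ?orbT //.
    case/orP=> [/orP[]/eqP<-|yv]; rewrite ?eyx ?ny ?eqxx ?orbT //.
    by have := nod v; rewrite yv andbT negbK !inE.
  by rewrite -(closed_connect cl (td_conn DP x w0)) inE eqxx.
pose d0 : S := Sub d d_out.
have Gcross (z : dart G) : crossing z = crossing (val z).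
  by rewrite /crossing -(inj_eq val_inj).
have rE : equivalence (@region G) by exact/(pullback_equivalence val)/(td_region DP).
pose prS z : S := insubd d0 z.
have prV (z : S) : prS (val z) = z by apply: val_inj; rewrite /= val_insubd (valS z).
have pr_out z : z \notin [:: x; y] -> val (prS z) = z.
  by move=> zo; rewrite val_insubd zo.
have pr_in z : z \in [:: x; y] -> prS z = d0.
  by move=> zi; apply: val_inj; rewrite val_insubd zi.
have GP : is_diagram G.
  apply: is_diagram_planar.
  - by apply/card_gt0P; exists d0.
  - by move=> z; apply: val_inj; rewrite /= edgeK.
  - by move=> z; rewrite -(inj_eq val_inj); apply: (td_edge_neq DP).
  - by move=> z; apply: val_inj; apply: (td_node4 DP).
  - by move=> z; rewrite -(inj_eq val_inj); apply: (td_node_neq DP).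
  - by move=> z; rewrite Gcross; apply: (td_over DP).
  - exact: rE.
  - by move=> z; apply: (region_node DP).
  - exact/(pullback_equivalence val)/(td_tie DP).
  - by move=> z; apply: (td_tie_edge DP).
  - move=> z; have := td_tie_across DP (val z); rewrite /across Gcross.
    by case: ifP.
  - have sE : connect_sym (@slink G).
      apply: slink_sym => [z|z|]; last exact: rE.
        by apply: val_inj; rewrite /= edgeK.
      by apply: val_inj; apply: (td_node4 DP).
    move=> z w; suff key u v : connect (@slink D) u v -> connect (@slink G) (prS u) (prS v).
      by rewrite -(prV z) -(prV w); apply/key/(td_conn DP).
    case/connectP=> r rp ->{v}; elim: r u rp => [|v r IH] u /=; first by rewrite connect0.
    case/andP=> uv /IH; apply: connect_trans => {IH}.
    have [ui|uo] := boolP (u \in [:: x; y]).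
      have [vi|vo] := boolP (v \in [:: x; y]); first by rewrite !pr_in // connect0.
      have uE : u = y.
        move: ui; rewrite !inE => /orP[]/eqP uE //; move: uv vo; rewrite uE.
        by case/orP=> [/orP[]/eqP<-|/rx->]; rewrite ?exy !inE eqxx ?orbT.
      move: uv vo; rewrite uE; case/orP=> [/orP[]/eqP<-|yv vo].
      + by rewrite eyx !inE eqxx.
      + by rewrite ny !inE eqxx.
      rewrite pr_in ?inE ?eqxx ?orbT //; apply: connect1; apply/orP; right.
      by rewrite /= pr_out //; apply: (region_trans DP _ yv); rewrite region_sym.
    case/orP: uv => [/orP[]/eqP<-|uv].
    + by apply: connect1; rewrite /slink /glink -!(inj_eq val_inj) /= !pr_out ?edge_out // eqxx.
    + by apply: connect1; rewrite /slink /glink -!(inj_eq val_inj) /= !pr_out ?node_out // eqxx orbT.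
    + apply: connect1; apply/orP; right; rewrite /= (pr_out u) //.
      have [vi|vo] := boolP (v \in [:: x; y]); last by rewrite pr_out.
      rewrite pr_in //=; move: vi uv; rewrite !inE => /orP[]/eqP->; rewrite region_sym //.
        by move/rx => ux; rewrite ux !inE eqxx in uo.
      by move=> yu; apply: (region_trans DP _ yd); rewrite region_sym.
  (* The cycle is extended by zero to the circle. *)
  move=> z ze zn; pose zD u := (u \notin [:: x; y]) && z (prS u).
  have [u|u|chi cc zE] := diagram_planar DP (z := zD).
  + rewrite /zD edge_out; case: (boolP (u \in _)) => //= uo; rewrite -[RHS]ze; congr z.
    by apply: val_inj; rewrite /= !pr_out ?edge_out.
  + rewrite /even_at /zD !node_out; have [uo|ui] := boolP (u \notin [:: x; y]); last by case: ifP.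
    have := zn (prS u); rewrite /even_at Gcross pr_out //=.
    have e (w : S) (w' : dart D) : w' \notin [:: x; y] -> val w = w' -> z (prS w') = z w.
      by move=> wo we; congr z; apply: val_inj; rewrite pr_out.
    rewrite (e (nodeS (prS u)) (node u)) ?(e (nodeS (nodeS (prS u))) (node (node u)))
      ?(e (nodeS (nodeS (nodeS (prS u)))) (node (node (node u)))) //;
      by rewrite /= ?node_out ?pr_out.
  exists (fun u => chi (val u)); first by move=> u w /cc.
  by move=> u; have := zE (val u); rewrite /zD (valS u) prV /=.
(* Any dart outside the circle and tied to it will do, since only its class matters. *)
pose t := omap prS [pick e | (e \notin [:: x; y]) && tie x e].
exists (Diagram GP), d0, t; split; last by split; [exact: card_S | exact: card_crossing_S].
pose h u : dart (@add_circle G d0 t) :=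
  if u == y then inr false else if u == x then inr true else inl (prS u).
have h_y : h y = inr false by rewrite /h eqxx.
have h_x : h x = inr true by rewrite /h (negPf xy) eqxx.
have h_o u : u \notin [:: x; y] -> h u = inl (prS u).
  by rewrite !inE /h negb_or => /andP[/negPf-> /negPf->].
exists h; split.
  exists (fun w : dart (@add_circle G d0 t) => match w with inl w => val w | inr false => y | inr true => x end).
    move=> u; case: (boolP (u \in [:: x; y])) => [|uo]; last by rewrite h_o ?pr_out.
    by rewrite !inE => /orP[]/eqP->; rewrite ?h_x ?h_y.
  case=> [w|[]] /=; rewrite ?h_x ?h_y // h_o; last exact: valS.
  by rewrite prV.
split.
- move=> u; case: (boolP (u \in [:: x; y])) => [|uo].
    by rewrite !inE => /orP[]/eqP->; rewrite ?exy ?eyx ?h_x ?h_y.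
  rewrite !h_o ?edge_out //=; congr inl; apply: val_inj.
  by rewrite /= !pr_out ?edge_out.
- move=> u; case: (boolP (u \in [:: x; y])) => [|uo].
    by rewrite !inE => /orP[]/eqP->; rewrite -/y ?ny ?h_x ?h_y.
  rewrite !h_o ?node_out //=; congr inl; apply: val_inj.
  by rewrite /= !pr_out ?node_out.
- move=> u cu; have uo : u \notin [:: x; y].
    rewrite !inE; apply: contraL cu => /orP[]/eqP->; first exact: cx.
    by rewrite crossing_node.
  by rewrite h_o //= pr_out.
- have rd w : region d w = region y w.
    apply/idP/idP; first exact: (region_trans DP yd).
    by apply: (region_trans DP); rewrite region_sym.
  have rx' w : w != x -> region x w = false.
    by move=> wx; apply/negP=> /rx we; rewrite we eqxx in wx.
  have nout (w : dart D) : w \notin [:: x; y] -> w != x by rewrite !inE negb_or => /andP[].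
  have nxy : y != x by rewrite eq_sym.
  move=> u w; case: (boolP (u \in [:: x; y])) (boolP (w \in [:: x; y])) => [ui|uo] [wi|wo].
  + by move: ui wi; rewrite !inE => /orP[]/eqP-> /orP[]/eqP->; rewrite ?h_x ?h_y /= ?region_refl //
      ?rx' // region_sym // rx'.
  + rewrite (h_o w) //; move: ui; rewrite !inE => /orP[]/eqP->; rewrite ?h_x ?h_y /= ?rx' ?nout //.
    by rewrite pr_out ?rd.
  + rewrite (h_o u) //; move: wi; rewrite !inE => /orP[]/eqP->; rewrite [region u _]region_sym // ?h_x ?h_y /= ?rx' ?nout //.
    by rewrite pr_out // region_sym // rd.
  + by rewrite !h_o //= !pr_out.
have tx' w : tie y w = tie x w.
  apply/idP/idP; first exact: (tie_trans DP txy).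
  by apply: (tie_trans DP); rewrite tie_sym.
have tO w : w \notin [:: x; y] -> orel (@tie G) t (Some (prS w)) = tie x w.
  move=> wo; rewrite /t; case: pickP => [e /andP[eo xe]|no] /=.
    rewrite !pr_out //; apply/idP/idP; first exact: (tie_trans DP xe).
    by apply: (tie_trans DP); rewrite tie_sym.
  by have := no w; rewrite wo /= => ->.
have tO' w : w \notin [:: x; y] -> orel (@tie G) (Some (prS w)) t = tie x w.
  by move=> wo; rewrite -tO //; case: (t) => //= e; rewrite tie_sym.
have tt : orel (@tie G) t t by case: (t) => //= e; rewrite tie_refl.
move=> u w; case: (boolP (u \in [:: x; y])) (boolP (w \in [:: x; y])) => [ui|uo] [wi|wo].
+ transitivity true.
    by move: ui wi; rewrite !inE => /orP[]/eqP-> /orP[]/eqP->; rewrite ?h_x ?h_y /= tt.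
  by move: ui wi; rewrite !inE => /orP[]/eqP-> /orP[]/eqP->; rewrite ?tx' ?tie_refl ?txy.
+ by rewrite (h_o w) //; move: ui; rewrite !inE => /orP[]/eqP->; rewrite ?h_x ?h_y /= tO ?tx'.
+ by rewrite (h_o u) //; move: wi; rewrite !inE => /orP[]/eqP->; rewrite [tie u _]tie_sym // ?h_x ?h_y ?tx'; apply: tO'.
+ by rewrite !h_o //= !pr_out.
Qed.
End UnaddCircle.

End DeletePair.

(** * Strands and simple closed walks *)

Section Walks.
Variable D : tgraph.
Implicit Types (x y d e : dart D) (w s : seq (dart D)) (chi : dart D -> bool).

Definition step x : dart D := across (edge x).
(* Consecutive boundary darts of a polygon lying to the left: the boundary
   follows a strand, or turns left at a crossing. *)
Definition straight : rel (dart D) := fun x y => y == step x.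
Definition turn : rel (dart D) := fun x y => crossing y && (node y == edge x).
Definition adj : rel (dart D) := fun x y => straight x y || turn x y.

Definition edge_in w : pred (dart D) := fun d => (d \in w) || (edge d \in w).

(** With [z] the edge set of a walk, the second condition says that no other piece of the walk
    passes through the vertex between [x] and [y]. *)
Definition simple_adj (z : pred (dart D)) : rel (dart D) := fun x y =>
  adj x y && all (fun d => z d ==> (d \in [:: edge x; y])) (vertex (edge x)).

Definition boundary chi := [pred d : dart D | chi d && ~~ chi (edge d)].

Definition inner chi : pred (dart D) := fun d => chi d && chi (edge d).

(* At each crossing a polygon has no corner, one, two adjacent ones, or all four. *)
Definition convex chi := forall x, crossing x -> chi x -> chi (opp x) -> chi (node x).

(* chi is a union of regions and s the cyclic list of its boundary darts. *)
Record polygon chi s : Prop := Polygon {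
  pg_colour : region_colouring chi;
  pg_convex : convex chi;
  pg_boundary : boundary chi =i s;
  pg_cycle : cycle adj s;
  pg_uniq : uniq s }.

Hypothesis DP : is_diagram D.

Lemma across_neq x : across x != x.
Proof. by rewrite /across; case: ifP => // _; apply: td_node_neq. Qed.

Lemma acrossK : involutive (@across D).
Proof.
move=> x; rewrite /across; case: (boolP (crossing x)) => cx.
  by rewrite /opp !crossing_node // cx nodeK4.
by rewrite crossing_node // (negPf cx) node2_noncrossing.
Qed.

Lemma across_vertex x : across x \in vertex x.
Proof. by rewrite /across /opp; case: ifP => _; rewrite !inE eqxx ?orbT. Qed.

Lemma step_inj : injective step.
Proof. by move=> x y /(can_inj acrossK) /(edge_inj DP). Qed.

Lemma step_reverse x : step (edge (step x)) = edge x.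
Proof. by rewrite /step edgeK // acrossK. Qed.

(** A strand never runs back along itself. If k + 2 steps reverse [x], then k steps reverse
    [step x]; the descent by two ends at an edge or a vertex whose two ends would coincide. *)
Lemma iter_step_neq_edge k x : iter k step x != edge x.
Proof.
suff IH n : forall k, k < n -> forall x, iter k step x != edge x by apply: (IH k.+1).
elim: n => // n IH [|[|k']] kn {}x.
- by rewrite eq_sym td_edge_neq.
- exact: across_neq.
apply/negP=> /eqP xE; have /eqP[] := IH k' (ltnW kn) (step x).
by apply: step_inj; rewrite step_reverse -xE -iterSr.
Qed.

Lemma fconnect_step_edge x y : fconnect step x y -> fconnect step (edge y) (edge x).
Proof.
case/iter_findex => <-; elim: (findex _ _ _) => [|k IH] /=; first exact: connect0.
by apply: connect_trans IH; rewrite -(step_reverse (iter k step x)); apply: fconnect1.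
Qed.

Lemma fconnect_step_neq x y : fconnect step x y -> ~~ fconnect step x (edge y).
Proof.
move=> xy; apply/negP=> xey; have: fconnect step y (edge y).
  by apply: connect_trans xey; rewrite fconnect_sym //; apply: step_inj.
by move/iter_findex=> e; have := iter_step_neq_edge (findex step y (edge y)) y; rewrite e eqxx.
Qed.

Lemma tie_step x : tie x (step x).
Proof. exact: (tie_trans DP (td_tie_edge DP x) (td_tie_across DP _)). Qed.

Lemma tie_fconnect_step x y : fconnect step x y -> tie x y.
Proof.
move/iter_findex <-; elim: (findex _ _ _) => [|k IH] /=; first exact: tie_refl.
exact: (tie_trans DP IH (tie_step _)).
Qed.

Lemma adj_vertex x y : adj x y -> y \in vertex (edge x).
Proof.
case/orP=> [/eqP->|/andP[_ /eqP <-]]; first exact: across_vertex.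
by rewrite vertex_sym // vertex_node // vertex_refl.
Qed.

Lemma even_at_node (z : dart D -> bool) x : even_at z (node x) = even_at z x.
Proof.
rewrite /even_at crossing_node // nodeK4 //; case: ifP => [_|/negbT cx]; last first.
  by rewrite node2_noncrossing // eq_sym.
by congr negb; case: (z x); case: (z _); case: (z _); case: (z _).
Qed.

Lemma even_at_vertex (z : dart D -> bool) x y : x \in vertex y -> even_at z x = even_at z y.
Proof. by rewrite !inE => /or4P[]/eqP->; rewrite ?even_at_node. Qed.

Lemma turnP x y : turn x y -> y = node (node (node (edge x))) /\ crossing (edge x).
Proof. by case/andP=> cy /eqP <-; rewrite nodeK4 // crossing_node. Qed.

Lemma straight_crossing x y : straight x y -> crossing (edge x) -> y = node (node (edge x)).
Proof. by move/eqP-> => ce; rewrite /step /across ce. Qed.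

Lemma straight_noncrossing x y : straight x y -> ~~ crossing (edge x) -> y = node (edge x).
Proof. by move/eqP-> => /negPf ce; rewrite /step /across ce. Qed.

Lemma simple_even x y (z : pred (dart D)) :
  simple_adj z x y -> z (edge x) -> z y -> edge x != y -> even_at z (edge x).
Proof.
case/andP=> xy /allP zv ze zy exy; rewrite /even_at; case: ifP => cx; last first.
  case/orP: xy => [xy|/turnP[_]]; last by rewrite cx.
  by rewrite -(straight_noncrossing xy) ?cx // ze zy.
set e := edge x in zv ze exy xy cx *.
have zF d : d \in vertex e -> d != e -> d != y -> z d = false.
  move=> dv de dy; apply: contraTF (dv) => zd; apply/negP=> /zv.
  by rewrite zd !inE (negPf de) (negPf dy).
have n1 : node e \in vertex e by rewrite vertex_node // vertex_refl.
have n2 : node (node e) \in vertex e by rewrite vertex_node.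
have n3 : node (node (node e)) \in vertex e by rewrite vertex_node.
case/orP: xy => [/straight_crossing/(_ cx)|/turnP[]]; rewrite -/e => yE; move: zF zy; rewrite yE => zF zy.
  rewrite ze zy (zF (node e)) ?(zF (node (node (node e)))) //;
  by rewrite ?(nodeE DP) // ?node2_eq // eq_node2.
move=> _; rewrite ze zy (zF (node e)) ?(zF (node (node e))) //;
by rewrite ?(nodeE DP) // ?node2_eq // ?eq_node2 ?crossing_node.
Qed.

(** Passing from the left of [x] to the left of [y] around their common vertex, one crosses at most
    one dart, and simplicity keeps it out of [z]. *)
Lemma colour_simple_adj chi (z : pred (dart D)) x y :
  region_colouring chi -> (forall d, d \in vertex (edge x) -> crossing d -> z d = cutset chi d) ->
  simple_adj z x y -> chi x = chi y.
Proof.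
move=> cc zE /andP[xy /allP zv].
have -> : chi x = chi (node (node (node (edge x)))) by rewrite -colour_edge // edgeK.
case: (boolP (crossing (edge x))) => cx; last first.
  case/orP: xy => [xy|/turnP[_]]; last by rewrite (negPf cx).
  by rewrite node2_noncrossing ?crossing_node // (straight_noncrossing xy).
case/orP: xy => [/straight_crossing/(_ cx) yE|/turnP[-> _] //].
set n3 := node _; have n3v : n3 \in vertex (edge x) by rewrite !inE eqxx !orbT.
have /negbTE : ~~ z n3.
  apply: contraL (zv _ n3v) => ->; rewrite /= !inE yE !(nodeE DP).
  by [].
rewrite zE //; last by rewrite !crossing_node.
rewrite /cutset colour_node // -yE.
by case: (chi n3); case: (chi y).
Qed.

(** A simple closed walk is a mod 2 cycle, so planarity gives a colouring cut out by it. The colour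
    is constant on the left of the walk; after complementing if necessary it is true there, and the
    boundary is the walk rather than its reverse. *)
Lemma jordan w : w != [::] -> cycle (simple_adj (edge_in w)) w ->
  (forall x, x \in w -> edge x \notin w) ->
  exists2 chi, region_colouring chi & boundary chi =i w.
Proof.
move=> w0 cw we; pose z := edge_in w.
have ze x : z (edge x) = z x by rewrite /z /edge_in edgeK // orbC.
have zw x : x \in w -> z x by rewrite /z /edge_in => ->.
have pair x : x \in w -> even_at z (edge x).
  move=> xw; have := next_cycle cw xw; set y := next w x => xy.
  have yw : y \in w by rewrite mem_next.
  have zex : z (edge x) by rewrite ze zw.
  apply: (simple_even xy zex (zw _ yw)).
  by apply/eqP=> xyE; have := we _ xw; rewrite xyE yw.
have [|v|chi cc zE] := diagram_planar DP (z := z); first exact: ze.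
  have [zv|] := boolP (has z (vertex v)); last first.
    move/hasPn => zF; have z0 d : d \in vertex v -> z d = false by move/zF/negbTE.
    by rewrite /even_at !z0 ?vertex_node ?vertex_refl // if_same.
  have [d dv zd] := hasP zv.
  suff [x xw ev] : exists2 x, x \in w & edge x \in vertex v.
    by rewrite -(even_at_vertex _ ev); apply: pair.
  case/orP: zd => [dw|edw]; last by exists (edge d); rewrite ?edgeK.
  exists (prev w d); first by rewrite mem_prev.
  have /andP[/adj_vertex dp _] := prev_cycle cw dw.
  by apply: (vertex_trans DP _ dv); rewrite vertex_sym.
have [x0 x0w] : exists x0, x0 \in w by case: (w) w0 => // x0 w' _; exists x0; rewrite inE eqxx.
have chi_w x : x \in w -> chi x = chi x0.
  move: cw x0w; rewrite -/z; case: (w) => // u w' cw x0w xw.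
  suff h x1 : x1 \in u :: w' -> chi x1 = chi u by rewrite (h x) // (h x0).
  have pth : path (fun a b => chi a == chi b) u (rcons w' u).
    apply: (@sub_path _ _ _ _ _ _ cw) => a1 b1 ab /=; apply/eqP.
    by apply: (@colour_simple_adj _ z).
  have tr : transitive (fun a b => chi a == chi b) by move=> a1 b1 c1 /eqP->.
  rewrite inE => /orP[/eqP-> //|x1w].
  have := order_path_min tr pth => /allP/(_ x1); rewrite mem_rcons inE x1w orbT => /(_ isT).
  by move/eqP.
pose b := ~~ chi x0; exists (fun x => chi x (+) b) => [x y /cc-> //|d].
have cE e : cutset chi e = z e by rewrite -zE.
rewrite inE; apply/andP/idP => [[cd ced]|dw].
  have zd : z d.
    by rewrite -cE /cutset; move: cd ced; case: (chi d); case: (chi _); case: (b) => //.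
  case/orP: zd => // edw; move: ced; rewrite (chi_w _ edw) /b.
  by case: (chi x0).
have cd := chi_w _ dw; have zd := zw _ dw.
by move: zd; rewrite -cE /cutset cd /b; case: (chi x0); case: (chi _).
Qed.

End Walks.
Arguments step {D} x.
Arguments straight {D} x y.
Arguments turn {D} x y.
Arguments adj {D} x y.

(* A clean diagram has one marked point on each crossingless circle and no other
   one; in an untied diagram no crossing joins tied strands, so that no
   component crosses itself. *)
Definition clean (D : tgraph) := forall x : dart D, ~~ crossing x -> edge x = node x.
Definition untied (D : tgraph) := forall x : dart D, crossing x -> ~~ tie x (node x).

(** * Polygons in clean untied diagrams *)

Section Polygons.
Variable D : tgraph.
Hypothesis DP : is_diagram D.
Hypothesis cleanD : clean D.
Hypothesis untiedD : untied D.
Implicit Types (x y d e : dart D) (w s u : seq (dart D)) (chi : dart D -> bool).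

Lemma untied_opp x d : crossing x -> d \in vertex x -> tie x d ->
  d \in [:: x; node (node x)].
Proof.
move=> cx; rewrite !inE => /or4P[]/eqP-> ; rewrite ?eqxx ?orbT //.
  by rewrite (negPf (untiedD cx)).
move=> t; case/negP: (untiedD cx); apply: (tie_trans DP t).
by rewrite tie_sym // tie_opp ?crossing_node.
Qed.

Lemma strand_simple x (z : pred (dart D)) :
  (forall d, d \in vertex (edge x) -> z d -> tie x d) -> simple_adj z x (step x).
Proof.
move=> zt; apply/andP; split; first by rewrite /adj /straight eqxx.
apply/allP=> d dv; apply/implyP=> zd.
have tex : tie (edge x) d.
  by apply: (tie_trans DP _ (zt d dv zd)); rewrite tie_sym // td_tie_edge.
rewrite /step /across; case: ifP => cx; first exact: untied_opp.
by move: dv; rewrite !inE node2_noncrossing ?cx // => /or4P[]/eqP->; rewrite eqxx ?orbT.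
Qed.

(** As tied strands do not cross, a component is a simple closed walk. For the last clause: a corner
    whose colour differs from both neighbouring corners would be bounded by two darts of the
    component lying on different strands of the crossing. *)
Lemma strand_colouring y : exists chi, [/\ region_colouring chi,
  boundary chi =i orbit step y &
  forall x, crossing x -> chi x = chi (opp x) -> chi (node x) = chi x].
Proof.
have os d : (d \in orbit step y) = fconnect step y d by rewrite fconnect_orbit.
have tz d : edge_in (orbit step y) d -> tie y d.
  case/orP; rewrite os => /(tie_fconnect_step DP) // t.
  by apply: (tie_trans DP t); rewrite tie_sym // td_tie_edge.
have tos d : d \in orbit step y -> tie y d by rewrite os; apply: (tie_fconnect_step DP).
have [|||chi cc cb] := @jordan D DP (orbit step y).
- by rewrite -size_eq0 size_orbit -lt0n order_gt0.
- have := cycle_orbit (@step_inj D DP) y.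
  apply: (@sub_in_cycle _ (mem (orbit step y))); last by apply/allP.
  move=> a b ao bo /eqP<-; apply: strand_simple => d _ /tz td.
  by apply: (tie_trans DP _ td); rewrite tie_sym // tos.
- by move=> d; rewrite !os => /(fconnect_step_neq DP).
exists chi; split=> // x cx xo; apply/eqP/idPn => nx.
have cut d : cutset chi d -> tie y d.
  move=> cd; apply: tz; rewrite /edge_in -!cb !inE edgeK //.
  by move: cd; rewrite /cutset; case: (chi d); case: (chi _).
have c1 : cutset chi (node x).
  by rewrite /cutset colour_node //; move: nx; case: (chi x); case: (chi _).
have c2 : cutset chi (node (node x)).
  by rewrite /cutset colour_node // -/(opp x) -xo; move: nx; case: (chi x); case: (chi _).
have /negP[] := untiedD (etrans (crossing_node DP x) cx).
by apply: (tie_trans DP _ (cut _ c2)); rewrite tie_sym // cut.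
Qed.

(* The far vertex of a boundary dart x: only the next boundary dart y leaves
   it, only x enters it, and at a straight crossing one dart enters the polygon. *)
Lemma polygon_vertex chi s x y d : polygon chi s -> x \in s -> y \in s -> adj x y ->
  d \in vertex (edge x) ->
  [/\ d \in s -> d = y, edge d \in s -> d = edge x &
      inner chi d -> [/\ crossing y, straight x y & node d = edge x]].
Proof.
move=> [cc cv cb _ _] xs ys xy dv.
have sE z : (z \in s) = chi z && ~~ chi (node (node (node z))).
  by rewrite -cb inE colour_edge.
have esE z : (edge z \in s) = chi (node (node (node z))) && ~~ chi z.
  by rewrite -cb inE edgeK // colour_edge.
have inE' z : inner chi z = chi z && chi (node (node (node z))).
  by rewrite /inner colour_edge.
have /andP[c3 /negbTE c0] : chi (node (node (node (edge x)))) && ~~ chi (edge x).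
  by rewrite -esE edgeK.
have := crossing_vertex DP (adj_vertex DP xy).
have := straight_crossing (x := x) (y := y); have := straight_noncrossing (x := x) (y := y).
have := @turnP D DP x y; have : x = edge (edge x) by rewrite edgeK.
move: dv c3 c0; move: (edge x) => e dv c3 c0 xe tP sn sc cy.
have [ce|ce] := boolP (crossing e); last first.
  have ne2 := node2_noncrossing ce.
  have xn : x = node e by rewrite -(cleanD ce).
  have yE : y = node e.
    by case/orP: xy => [/sn->|/tP[_]//]; rewrite // (negPf ce).
  have c1 : chi (node e) by rewrite ne2 in c3.
  by move: dv; rewrite !inE ne2 orbA orbb => /orP[]/eqP->;
    rewrite yE ?esE ?sE ?inE' ?nodeK4 // ?ne2 ?c0 ?c1 ?andbF; split.
have [b1 b2 yE] : [/\ chi (node e) = false,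
    chi (node (node e)) = straight x y & y = if straight x y then node (node e) else node (node (node e))].
  move: ys; rewrite sE; case: (boolP (straight x y)) => [xy'|nxy].
    by rewrite (sc xy' ce) nodeK4 // => /andP[-> /negPf->].
  have /tP[yE _] : turn x y by move: xy; rewrite /adj (negPf nxy).
  rewrite yE nodeK4 // => /andP[_ n2]; split=> //; last exact: negPf n2.
  apply: contraNF n2 => c1; apply: (cv (node e)); rewrite ?crossing_node //.
have cy' : crossing y by rewrite cy.
case: (boolP (straight x y)) => st; rewrite ?st ?(negPf st) in b2 yE; move: dv; rewrite !inE => /or4P[]/eqP->;
  rewrite ?esE ?sE ?inE' ?nodeK4 // ?c0 ?b1 ?b2 ?c3 ?andbF //=; split=> // _; by rewrite ?yE.
Qed.

Lemma polygon_in chi s x : polygon chi s -> x \in s -> chi x /\ ~~ chi (edge x).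
Proof. by move=> [_ _ cb _ _]; rewrite -cb inE => /andP. Qed.

Lemma polygon_exit_inj chi s x x' : polygon chi s -> x \in s -> x' \in s ->
  edge x' \in vertex (edge x) -> x' = x.
Proof.
move=> ps xs x's v; have xn := next_cycle (pg_cycle ps) xs.
have ns : next s x \in s by rewrite mem_next.
have [_ e _] := polygon_vertex ps xs ns xn v.
by apply: (edge_inj DP); apply: e; rewrite edgeK.
Qed.

Lemma polygon_enter_inj chi s y y' : polygon chi s -> y \in s -> y' \in s ->
  y' \in vertex y -> y' = y.
Proof.
move=> ps ys y's v; have xn := prev_cycle (pg_cycle ps) ys.
have ns : prev s y \in s by rewrite mem_prev.
have v' : y' \in vertex (edge (prev s y)).
  by apply: (vertex_trans DP v); apply: adj_vertex.
by have [-> //] := polygon_vertex ps ns ys xn v'.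
Qed.

Lemma boundary_cutset chi s : boundary chi =i s -> edge_in s =1 cutset chi.
Proof.
move=> cb d; rewrite /edge_in -!cb !inE edgeK // /cutset.
by case: (chi d); case: (chi _).
Qed.

Lemma inner_edge chi d : inner chi (edge d) = inner chi d.
Proof. by rewrite /inner edgeK // andbC. Qed.

(** The two corners beside [edge d] lie in [chi] because [d] is inner; given a third one, convexity
    supplies the fourth. *)
Lemma inner_full chi d : region_colouring chi -> convex chi -> inner chi d ->
  chi (node (edge d)) -> forall e, e \in vertex (edge d) -> chi e.
Proof.
move=> cc cv /andP[cd ce] cn e.
have c3 : chi (node (node (node (edge d)))) by rewrite -colour_edge // edgeK.
have c2 : chi (node (node (edge d))).
  have [cx|cx] := boolP (crossing (edge d)); last by rewrite node2_noncrossing.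
  by apply: (cv (node (edge d))); rewrite ?crossing_node.
by rewrite !inE => /or4P[]/eqP->.
Qed.

Lemma path_strengthen (T : eqType) (e e' : rel T) (x : T) (p : seq T) :
  (forall a b, a \in belast x p -> b \in p -> e a b -> e' a b) ->
  path e x p -> path e' x p.
Proof.
elim: p x => //= y p IH x ee' /andP[xy py]; apply/andP; split.
  by apply: ee' => //; rewrite inE eqxx.
by apply: IH py => a b ap bp; apply: ee'; rewrite inE ?ap ?bp orbT.
Qed.

Lemma last_belast (T : eqType) (x : T) p : uniq (x :: p) -> last x p \notin belast x p.
Proof. by rewrite lastI rcons_uniq => /andP[]. Qed.

Lemma path_straight_tie x p d : path straight x p -> d \in x :: p -> tie x d.
Proof.
elim: p x => [|y p IH] x /=; first by rewrite inE => _ /eqP->; apply: tie_refl.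
case/andP=> /eqP yE py; rewrite inE => /orP[/eqP->|/(IH _ py)]; first exact: tie_refl.
by apply: (tie_trans DP); rewrite yE; apply: tie_step.
Qed.

(* A chain u of straight inner darts, from the vertex between x' and y' to the
   one between L and y, cuts a polygon in two; chi is restricted to the side of s1. *)
Section HalfCut.
Variables (chi : dart D -> bool) (y y' u0 : dart D) (q1 q2 pu : seq (dart D)).
Let s1 := y :: q1.
Let s2 := y' :: q2.
Let s := s1 ++ s2.
Let u := u0 :: pu.
Let w := s1 ++ u.
Let z := edge_in w.
Let x' := last y q1.
Let L := last u0 pu.
Hypothesis ps : polygon chi s.
Hypothesis u_inner : forall d, d \in u -> inner chi d.
Hypothesis u_full : forall d, d \in belast u0 pu -> chi (node (edge d)).
Hypothesis u_path : path straight u0 pu.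
Hypothesis u_uniq : uniq u.
Hypothesis u_edge : forall d, d \in u -> edge d \notin u.
Hypotheses (turn0 : turn x' u0) (turnL : turn L y) (foot' : straight x' y').

Let cc : region_colouring chi := pg_colour ps.
Let cv : convex chi := pg_convex ps.

Let x's1 : x' \in s1. Proof. exact: mem_last. Qed.
Let ys1 : y \in s1. Proof. by rewrite inE eqxx. Qed.
Let y's2 : y' \in s2. Proof. by rewrite inE eqxx. Qed.
Let Lu : L \in u. Proof. exact: mem_last. Qed.
Let u0u : u0 \in u. Proof. by rewrite inE eqxx. Qed.
Let s1s d : d \in s1 -> d \in s. Proof. by rewrite mem_cat => ->. Qed.
Let s2s d : d \in s2 -> d \in s. Proof. by rewrite mem_cat => ->; rewrite orbT. Qed.
Let s12 d : d \in s1 -> d \in s2 -> False.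
Proof.
have := pg_uniq ps; rewrite cat_uniq => /and3P[_ /hasPn h _] ds1 /h.
by rewrite /= ds1.
Qed.

Let inner_s d : inner chi d -> d \notin s.
Proof. by case/andP=> _ ced; apply/negP=> /(polygon_in ps)[_]; rewrite ced. Qed.

Let full_s a d : a \in belast u0 pu -> d \in vertex (edge a) -> chi d.
Proof.
move=> ab; apply: inner_full => //; last exact: u_full.
by apply/u_inner/mem_belast.
Qed.

(** At an intermediate vertex of the arc all corners lie in [chi], while a boundary vertex has a
    corner outside. So the arc touches the boundary at its two ends only. *)
Let half_cut_u d x : edge_in u d -> x \in s -> d \in vertex (edge x) -> d = u0 \/ d = edge L.
Proof.
move=> zd /(polygon_in ps)[_ nx] dv.
have nfull a : a \in belast u0 pu -> d \in vertex (edge a) -> False.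
  move=> ab da; case/negP: nx; apply: full_s ab _.
  by apply: (vertex_trans DP _ da); rewrite vertex_sym.
case/orP: zd => [du|edu].
  left; move: du; rewrite inE => /orP[/eqP //|dp].
  have [a ab /eqP dE] : exists2 a, a \in belast u0 pu & straight a d.
    elim: pu u0 u_path dp => //= b p IH a /andP[ab pb]; rewrite inE => /orP[/eqP->|dp].
      by exists a; rewrite ?inE ?eqxx.
    by have [c cb cd] := IH b pb dp; exists c; rewrite // inE cb orbT.
  by case: (nfull a ab); rewrite dE across_vertex.
right; move: edu; rewrite /u lastI mem_rcons inE => /orP[/eqP edE|edb].
  by rewrite -[L]/(last u0 pu) -edE edgeK.
by case: (nfull _ edb); rewrite edgeK // vertex_refl.
Qed.

Let half_cut_simple a b : a \in s -> b \in s -> adj a b -> a != x' -> b != y -> simple_adj z a b.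
Proof.
move=> As bs ab ax by'; rewrite /simple_adj ab; apply/allP=> d dv; apply/implyP=> zd.
have [d1 d2 _] := polygon_vertex ps As bs ab dv.
have [zs|zu] : edge_in s1 d \/ edge_in u d.
  by move: zd; rewrite /z /edge_in !mem_cat => /orP[]/orP[]->; rewrite ?orbT; by [left | right].
  by case/orP: zs => /s1s => [/d1->|/d2->]; rewrite !inE eqxx ?orbT.
have adjv c e : adj c e -> edge c \in vertex e by move/(adj_vertex DP); rewrite vertex_sym.
case: (half_cut_u zu As dv) => dE.
  case/eqP: ax; apply/esym/(polygon_exit_inj ps As (s1s x's1)).
  apply: (vertex_trans DP _ dv); rewrite dE; apply: adjv.
  by rewrite /adj turn0 orbT.
case/eqP: by'; apply/esym/(polygon_enter_inj ps bs (s1s ys1)).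
have yd : y \in vertex d by rewrite dE adj_vertex // /adj turnL orbT.
apply: (vertex_trans DP yd); apply: (vertex_trans DP dv).
by rewrite vertex_sym // adj_vertex.
Qed.

Let w_edge d : d \in w -> edge d \notin w.
Proof.
rewrite !mem_cat negb_or => /orP[ds|du].
  have [cd ced] := polygon_in ps (s1s ds).
  apply/andP; split; apply/negP.
    by move/s1s/(polygon_in ps)=> [c _]; rewrite c in ced.
  by move/u_inner/andP=> [c _]; rewrite c in ced.
rewrite u_edge // andbT; apply/negP=> /s1s; apply/negP/inner_s.
by rewrite inner_edge u_inner.
Qed.

Let turn_simple a b : (a \in s) && (b \in u) || (a \in u) && (b \in s) -> turn a b ->
  (forall d, d \in s1 -> d \in vertex (edge a) -> d \in [:: edge a; b]) ->
  (forall d, edge d \in s1 -> d \in vertex (edge a) -> d \in [:: edge a; b]) ->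
  (forall d, edge_in u d -> d \in vertex (edge a) -> d \in [:: edge a; b]) ->
  simple_adj z a b.
Proof.
move=> _ tab h1 h2 h3; rewrite /simple_adj /adj tab orbT; apply/allP=> d dv; apply/implyP.
rewrite /z /edge_in !mem_cat => /orP[/orP[/h1|du]|/orP[/h2|du]]; try by apply.
  by apply: h3; rewrite /edge_in ?du.
by apply: h3; rewrite /edge_in ?du ?orbT.
Qed.

Let x'y'_adj : adj x' y'. Proof. by rewrite /adj foot'. Qed.

Let w_cycle : cycle (simple_adj z) w.
Proof.
have := pg_cycle ps; rewrite /s /s1 /= rcons_path cat_path last_cat => /andP[/andP[p1 /=]].
case/andP=> _ p2 xly; set xl := last y' q2 in xly.
have xls : xl \in s2 by apply: mem_last.
have uq1 : uniq s1 by have := pg_uniq ps; rewrite cat_uniq => /andP[].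
rewrite /w /s1 /= rcons_path cat_path last_cat; apply/andP; split; last first.
  have yv : y \in vertex (edge L) by rewrite adj_vertex // /adj turnL orbT.
  have yv' : y \in vertex (edge xl) by rewrite adj_vertex.
  have LE d : d \in vertex (edge L) -> d \in vertex (edge xl).
    move=> dv; apply: (vertex_trans DP _ yv'); apply: (vertex_trans DP dv).
    by rewrite vertex_sym.
  have pv d := polygon_vertex ps (s2s xls) (s1s ys1) xly (d := d).
  change (simple_adj z L y); apply: turn_simple => //; first by rewrite Lu (s1s ys1) orbT.
  - by move=> d ds1 /LE/pv[/(_ (s1s ds1))-> _ _]; rewrite !inE eqxx orbT.
  - move=> d eds1 /LE/pv[_ /(_ (s1s eds1)) dE _]; case: (@s12 xl) => //.
    by rewrite dE edgeK in eds1.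
  - move=> d du dv; case: (half_cut_u du (s2s xls) (LE _ dv)) => dE; last by rewrite dE inE eqxx.
    case: (@s12 x') => //; rewrite (_ : x' = xl) //.
    apply: (polygon_exit_inj ps (s2s xls) (s1s x's1)); apply: (vertex_trans DP _ (LE _ dv)).
    by rewrite dE vertex_sym // adj_vertex // /adj turn0 orbT.
have sub1 d : d \in belast y q1 -> d != x' /\ d \in s.
  move=> db; split; last by apply/s1s/mem_belast.
  by apply: contraNneq (last_belast uq1) => dE; rewrite -[last y q1]/x' -dE.
have subq d : d \in q1 -> d != y /\ d \in s.
  move=> dq; split; last by apply: s1s; rewrite inE dq orbT.
  by apply: contraTneq dq => ->; move: uq1 => /= /andP[].
have pv d := polygon_vertex ps (s1s x's1) (s2s y's2) x'y'_adj (d := d).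
apply/andP; split.
  apply: path_strengthen p1 => a b /sub1[ax As] /subq[by' bs] ab.
  exact: half_cut_simple.
apply/andP; split.
  apply: turn_simple => //; first by rewrite (s1s x's1) u0u.
  - by move=> d ds1 /pv[/(_ (s1s ds1)) dE _ _]; case: (@s12 d) => //; rewrite dE.
  - by move=> d eds1 /pv[_ /(_ (s1s eds1))-> _]; rewrite !inE eqxx.
  - move=> d du dv; case: (half_cut_u du (s1s x's1) dv) => dE; first by rewrite dE !inE eqxx orbT.
    case: (@s12 y) => //; rewrite (_ : y = y') //.
    apply: (polygon_enter_inj ps (s2s y's2) (s1s ys1)).
    have yd : y \in vertex d by rewrite dE adj_vertex // /adj turnL orbT.
    apply: (vertex_trans DP yd); apply: (vertex_trans DP dv).
    by rewrite vertex_sym // adj_vertex.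
apply: path_strengthen u_path => a b ab bp /eqP->; apply: strand_simple => d dv.
rewrite /z /edge_in !mem_cat.
have tu c : c \in u -> tie a c.
  move=> cu; have au := mem_belast ab.
  by apply: (tie_trans DP _ (path_straight_tie u_path cu)); rewrite tie_sym // (path_straight_tie u_path).
have cd := full_s ab dv.
have ced : chi (edge d).
  by rewrite colour_edge //; apply: (full_s ab); rewrite !vertex_node.
case/orP=> /orP[].
- by move/s1s/(polygon_in ps)=> [_]; rewrite ced.
- exact: tu.
- by move/s1s/(polygon_in ps)=> [_]; rewrite edgeK // cd.
- by move/tu=> t; apply: (tie_trans DP t); rewrite tie_sym // td_tie_edge.
Qed.

(** The walk [w] is closed and simple, hence bounds some chi', and the new polygon is the
    intersection of chi' with [chi]. The remaining boundary [s2] stays outside chi': the colour is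
    constant along it, and it is false at [y'] by the turn from [x'] into [u0]. The area drops
    because [edge u0] lies in [chi] but not in chi'. *)
Lemma half_cut : exists psi, [/\ polygon psi w, forall d, psi d -> chi d &
  #|[pred d | psi d]| < #|[pred d | chi d]|].
Proof.
have [chi' cc' cb'] := jordan DP (isT : w != [::]) w_cycle w_edge.
have zE := boundary_cutset cb'.
have chi'_w d : d \in w -> chi' d /\ chi' (edge d) = false.
  by rewrite -cb' inE => /andP[-> /negPf].
have chi'_s2 d : d \in s2 -> chi' d = false.
  have y'0 : chi' y' = false.
    have /chi'_w[_] : u0 \in w by rewrite mem_cat u0u orbT.
    have /(turnP DP)[uE cx] := turn0.
    by rewrite colour_edge // uE nodeK4 // (straight_crossing foot' cx).
  have := pg_cycle ps; rewrite /s /s1 /= rcons_path cat_path last_cat => /andP[/andP[_ /=]].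
  case/andP=> _ p2 _.
  have p2' : path (fun a b => chi' a == chi' b) y' q2.
    apply: path_strengthen p2 => a b ab bq aab; apply/eqP.
    have as2 : a \in s2 by apply: mem_belast.
    have bs2 : b \in s2 by rewrite inE bq orbT.
    apply: (@colour_simple_adj D DP chi' z a b cc') => [c _ _|]; first exact: zE.
    apply: half_cut_simple aab _ _; rewrite ?s2s //.
      by apply/eqP=> ax; apply: (@s12 a) => //; rewrite ax.
    by apply/eqP=> bE; apply: (@s12 b) => //; rewrite bE.
  rewrite inE => /orP[/eqP-> //|dq2].
  have tr : transitive (fun a b => chi' a == chi' b) by move=> a b c /eqP->.
  by have := order_path_min tr p2' => /allP/(_ _ dq2)/eqP <-.
exists (fun d => chi d && chi' d); split; first split.
- by move=> a b ab; rewrite (cc ab) (cc' _ _ ab).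
(* If convexity failed for chi', then all corners at [x] would lie in [chi], so [w] would pass there
   along [u] only; but [u] is one strand and cannot use both strands of an untied crossing. *)
- move=> x cx /andP[c0 c0'] /andP[c2 c2'].
  have c1 := cv cx c0 c2; rewrite c1 /=; apply/idPn => n1.
  have c3 : chi (node (node (node x))).
    by apply: (cv (x := node (node x))); rewrite ?crossing_node // /opp nodeK4.
  have zu d : d \in vertex x -> edge_in w d -> edge_in u d.
    have full e : e \in vertex x -> chi e by rewrite !inE => /or4P[]/eqP->.
    move=> dv; rewrite /edge_in !mem_cat => /orP[]/orP[/s1s/(polygon_in ps)[]|->]; rewrite ?orbT //.
      by rewrite colour_edge // (full (node (node (node d)))) // !vertex_node.
    by rewrite edgeK // (full d).
  have tu d : d \in vertex x -> cutset chi' d -> tie u0 d.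
    move=> dv; rewrite -zE => /(zu _ dv) /orP[]/(path_straight_tie u_path) // t.
    by apply: (tie_trans DP t); rewrite tie_sym // td_tie_edge.
  have t1 : tie u0 (node x).
    apply: tu; first by rewrite vertex_node // vertex_refl.
    by rewrite /cutset colour_node // c0' addbT.
  have t2 : tie u0 (node (node x)).
    apply: tu; first by rewrite !vertex_node // vertex_refl.
    by rewrite /cutset colour_node // (negPf n1) addbF.
  have /negP[] := untiedD (etrans (crossing_node DP x) cx).
  by apply: (tie_trans DP _ t2); rewrite tie_sym.
- move=> d; rewrite inE; apply/andP/idP => [[/andP[cd cd']]|dw].
    rewrite negb_and => /orP[ced|ced'].
      have : d \in s by rewrite -(pg_boundary ps) inE cd.
      rewrite mem_cat => /orP[ds1|/chi'_s2]; last by rewrite cd'.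
      by rewrite mem_cat ds1.
    by rewrite -cb' inE cd'.
  have [-> ->] := chi'_w _ dw; rewrite andbF andbT.
  move: dw; rewrite mem_cat => /orP[/s1s/(polygon_in ps)[] //|/u_inner/andP[] //].
- by apply: sub_cycle w_cycle => a b /andP[].
- rewrite cat_uniq u_uniq andbT; apply/andP; split.
    by have := pg_uniq ps; rewrite cat_uniq => /andP[].
  apply/hasPn=> d /u_inner/inner_s; apply: contra; exact: s1s.
- by move=> d /andP[].
apply: proper_card; apply/properP; split; first by apply/subsetP=> d /andP[].
exists (edge u0).
  by rewrite inE; have /andP[] := u_inner u0u.
rewrite !inE negb_and; have /chi'_w[_ ->] : u0 \in w by rewrite mem_cat u0u orbT.
by rewrite orbT.
Qed.

End HalfCut.
End Polygons.

Lemma in_split (T : eqType) (x : T) s : x \in s -> exists s1 s2, s = s1 ++ x :: s2.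
Proof. by case/splitPr=> s1 s2; exists s1, s2. Qed.

(** * Cutting a polygon along a strand *)

Section Cut.
Variable D : tgraph.
Hypothesis DP : is_diagram D.
Hypothesis cleanD : clean D.
Hypothesis untiedD : untied D.
Implicit Types (x y d e : dart D) (w s u : seq (dart D)) (chi : dart D -> bool).

Definition area chi := #|[pred d | chi d]|.

Lemma polygon_rot chi s n : polygon chi s -> polygon chi (rot n s).
Proof.
move=> [cc cv cb cs us]; split=> //; rewrite ?rot_cycle ?rot_uniq // => d.
by rewrite mem_rot.
Qed.

Lemma polygon_catC chi s1 s2 : polygon chi (s1 ++ s2) -> polygon chi (s2 ++ s1).
Proof. by move/(polygon_rot (size s1)); rewrite rot_size_cat. Qed.

Lemma inner_step chi d : region_colouring chi -> convex chi -> inner chi d ->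
  chi (node (edge d)) -> inner chi (step d).
Proof.
move=> cc cv id cn; have full := inner_full DP cc cv id cn.
rewrite /inner colour_edge // !full ?vertex_node ?across_vertex //.
Qed.

Lemma foot_inner chi s x y : polygon chi s -> x \in s -> y \in s -> straight x y ->
  crossing y -> inner chi (node y).
Proof.
move=> ps xs ys xy cy; have [cx _] := polygon_in ps xs; have [cy' _] := polygon_in ps ys.
have ce : crossing (edge x).
  by rewrite -(crossing_vertex DP (x := y)) // adj_vertex // /adj xy.
have cc := pg_colour ps; rewrite /inner colour_edge // nodeK4 // cy' andbT.
by rewrite (straight_crossing xy ce) -colour_edge // edgeK.
Qed.

(** [r] is the dart by which a strand enters the polygon at a straight crossing of the boundary.
    Followed for as long as it stays inside, it must reach the boundary: otherwise it would come
    back to [r], but no inner dart leads to [r], where the strand arrives from outside. *)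
Lemma arc chi s x y (r := node y) :
  polygon chi s -> x \in s -> y \in s -> straight x y -> crossing y ->
  exists p, [/\ path straight r p, uniq (r :: p),
    forall d, d \in r :: p -> inner chi d /\ edge d \notin r :: p,
    forall d, d \in belast r p -> chi (node (edge d)) & ~~ chi (node (edge (last r p)))].
Proof.
move=> ps xs ys xy cy; have ir : inner chi r := foot_inner ps xs ys xy cy.
have cc := pg_colour ps; have cv := pg_convex ps.
have no_ret d : inner chi d -> step d != r.
  move=> /andP[_ ced]; apply/eqP=> dr; have [_ /negP[]] := polygon_in ps ys.
  rewrite colour_edge // -[node (node (node y))]/(opp r).
  have -> : opp r = across r by rewrite /across /r crossing_node // cy.
  by rewrite -dr acrossK.
have inn m : (forall i, i < m -> chi (node (edge (iter i step r)))) -> inner chi (iter m step r).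
  elim: m => // m IH full; apply: inner_step => //; last exact: full.
  by apply: IH => i im; apply: full; apply: ltnW.
have [m stop] : exists m, ~~ chi (node (edge (iter m step r))).
  case: (boolP [exists m : 'I_(order step r), ~~ chi (node (edge (iter m step r)))]) => [/existsP[m]|].
    by exists m.
  rewrite negb_exists => /forallP full.
  have := no_ret (iter (order step r).-1 step r); rewrite -iterS orderSpred.
  rewrite iter_order ?eqxx; last exact: step_inj.
  move=> h; have /h // : inner chi (iter (order step r).-1 step r).
  apply: inn => i io; have io' : i < order step r by apply: leq_trans io (leq_pred _).
  by have := full (Ordinal io'); rewrite negbK.
have [m0 stop0 min0] := ex_minnP (ex_intro (fun m => ~~ chi (node (edge (iter m step r)))) m stop).
have full i : i < m0 -> chi (node (edge (iter i step r))).
  by move=> im; apply/negPn/negP => /min0; rewrite leqNgt im.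
have innm i : i <= m0 -> inner chi (iter i step r).
  by move=> im; apply: inn => j ji; apply: full; apply: leq_trans im.
pose p := traject step (step r) m0.
have tE : r :: p = traject step r m0.+1 by [].
have lastE : last r p = iter m0 step r by rewrite last_traject.
exists p; split.
- rewrite (@eq_path _ _ (frel step)) ?fpath_traject // => a b.
  by rewrite /straight eq_sym.
- rewrite tE looping_uniq; apply/negP=> /trajectP[i im e].
  have [k ke] : exists k, (m0 = i + k.+1)%N by exists (m0 - i).-1; rewrite prednK ?subn_gt0 // subnKC // ltnW.
  have {e} : iter k.+1 step r = r.
    have iinj j a b : iter j (@step D) a = iter j step b -> a = b.
      by elim: j => //= j IH /(step_inj DP)/IH.
    by apply: (iinj i); rewrite -iterD -ke e.
  rewrite iterS => /eqP; rewrite (negPf (no_ret _ _)) //; apply: innm.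
  by rewrite ke (leq_trans (leqnSn k)) // leq_addl.
- move=> d; rewrite tE => /trajectP[i im ->]; split; first exact: innm.
  apply/negP=> /trajectP[j jm].
  have key a b : a <= b -> edge (iter a step r) = iter b step r -> False.
    move=> ab e; have := iter_step_neq_edge DP (b - a) (iter a step r).
    by rewrite -iterD subnK // -e eqxx.
  have [ij|ji] := leqP i j; first exact: key.
  by move=> e; apply: (key j i (ltnW ji)); rewrite -e edgeK.
- have -> : belast r p = traject step r m0.
    have : rcons (belast r p) (last r p) = rcons (traject step r m0) (iter m0 step r).
      by rewrite -lastI -trajectSr.
    by case/rcons_inj.
  by move=> d /trajectP[i im ->]; apply: full.
- by rewrite lastE.
Qed.

(** The corner at [node e] is missing, so by convexity the one at [opp e] is missing too. The
    boundary therefore goes straight through this vertex, and the arc leaves at another foot. *)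
Lemma inner_exit chi s d (e := edge d) : polygon chi s -> inner chi d -> ~~ chi (node e) ->
  [/\ crossing e, node (node (node e)) \in s, edge (node e) \in s &
      straight (edge (node e)) (node (node (node e)))].
Proof.
move=> ps /andP[cd ced] stop; have cc := pg_colour ps; have cv := pg_convex ps.
have c3 : chi (node (node (node e))) by rewrite -colour_edge // /e edgeK.
have ce : crossing e.
  by have [//|nce] := boolP (crossing e); case/negP: stop; move: c3; rewrite (node2_noncrossing nce).
have c2 : chi (node (node e)) = false.
  by apply: contraNF stop => c2; apply: (cv e ce ced c2).
split=> //.
- by rewrite -(pg_boundary ps) inE colour_edge // nodeK4 // c3 c2.
- by rewrite -(pg_boundary ps) inE edgeK // colour_node // ced stop.
- by rewrite /straight /step edgeK // /across crossing_node // ce.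
Qed.

Definition smaller chi1 chi := (forall d, chi1 d -> chi d) /\ area chi1 < area chi.

(** The arc entering at the foot [y] leaves at a foot [y'], and [half_cut] applies to one side with
    the arc and to the other side with the reversed arc. The two feet differ, for otherwise the last
    dart of the arc would be the reverse of its first one. *)
Lemma cut chi y q : polygon chi (y :: q) -> straight (last y q) y -> crossing y ->
  exists (q1 q2 t t' : seq (dart D)) (y' : dart D), exists (chi1 chi2 : dart D -> bool),
  [/\ q = q1 ++ y' :: q2, straight (last y q1) y' /\ crossing y',
   sorted straight t /\ sorted straight t',
   polygon chi1 ((y :: q1) ++ t') /\ smaller chi1 chi &
   polygon chi2 ((y' :: q2) ++ t) /\ smaller chi2 chi].
Proof.
move=> ps xy cy; set s := y :: q in ps; set x := last y q in xy.
have xs : x \in s := mem_last y q; have ys : y \in s by rewrite inE eqxx.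
have [p [sp up ip fp stop]] := arc ps xs ys xy cy.
set r := node y in sp up ip fp stop; set L := last r p in stop.
have cc := pg_colour ps; have cv := pg_convex ps.
have Lt : L \in r :: p by apply: mem_last.
have [iL _] := ip _ Lt; have [ce y's x's x'y'] := inner_exit ps iL stop.
set e := edge L in stop ce y's x's x'y'.
pose y' := node (node (node e)); pose x' := edge (node e).
have cy' : crossing y' by rewrite !crossing_node.
have LrE : L != edge r.
  by apply: contraTneq (Lt) => ->; have [_] := ip r (mem_head _ _).
have yy' : y' != y.
  apply: contraNneq LrE => yE; apply/eqP/(edge_inj DP); rewrite edgeK // -/e.
  by rewrite /r -yE /y' nodeK4.
have : y' \in q by move: y's; rewrite inE (negPf yy').
case/in_split=> q1 [q2 qE].
have sE : s = (y :: q1) ++ y' :: q2 by rewrite /s qE.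
have xE : x = last y' q2 by rewrite /x qE last_cat.
set s1 := y :: q1 in sE; set s2 := y' :: q2 in sE.
have s1s d : d \in s1 -> d \in s by rewrite sE mem_cat => ->.
have s2s d : d \in s2 -> d \in s by rewrite sE mem_cat => ->; rewrite orbT.
have x'E : last y q1 = x'.
  apply: (polygon_exit_inj DP cleanD ps x's); first exact/s1s/mem_last.
  have : adj (last y q1) y'.
    have := pg_cycle ps; rewrite sE /s1 /= rcons_path cat_path => /andP[/andP[_]].
    by case/andP.
  move/(adj_vertex DP); rewrite vertex_sym // => h; apply: (vertex_trans DP h).
  by apply: adj_vertex => //; rewrite /adj x'y'.
have nrE : node r = edge x.
  have : crossing (edge x) by rewrite -(crossing_vertex DP (x := y)) // adj_vertex // /adj xy.
  by rewrite /r => /(straight_crossing xy)->; rewrite nodeK4.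
have cr : crossing r by rewrite /r crossing_node.
rewrite sE in ps.
have [|||chi2 [p2 sub2 lt2]] := @half_cut D DP cleanD untiedD chi y' y r q2 q1 p (polygon_catC ps)
  (fun d dt => proj1 (ip d dt)) fp sp up (fun d dt => proj2 (ip d dt)).
- by rewrite -xE /turn cr nrE eqxx.
- by rewrite /turn cy' /y' nodeK4 // eqxx.
- by rewrite -xE.
pose p' := [seq edge d | d <- rev (belast r p)].
have revE : e :: p' = [seq edge d | d <- rev (r :: p)] by rewrite (lastI r p) rev_rcons.
have sp' : path straight e p'.
  rewrite path_map rev_path; apply: sub_path sp => a b /eqP-> /=.
  by rewrite /straight step_reverse.
have memt d : (d \in e :: p') = (edge d \in r :: p).
  by rewrite revE -[d in LHS](edgeK DP) mem_map ?mem_rev //; apply: edge_inj.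
have lastE : last e p' = edge r by rewrite -[last e p']/(last e (e :: p')) revE rev_cons map_rcons last_rcons.
have up' : uniq (e :: p') by rewrite revE map_inj_uniq ?rev_uniq //; apply: edge_inj.
have [||||||chi1 [p1 sub1 lt1]] := @half_cut D DP cleanD untiedD chi y y' e q1 q2 p' ps _ _ sp' up'.
- by move=> d; rewrite memt -inner_edge // => /ip[].
- move=> d db; have : edge d \in r :: p by rewrite -memt mem_belast.
  have dl : d != edge r.
    by apply: contraNneq (last_belast up') => dE; rewrite lastE -dE.
  rewrite inE => /orP[/eqP dE|dp]; first by rewrite -dE edgeK // eqxx in dl.
  have [a ab /eqP dE] : exists2 a, a \in belast r p & straight a (edge d).
    elim: (p) (r) sp dp => //= b p0 IH a /andP[ab pb]; rewrite inE => /orP[/eqP->|dp].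
      by exists a; rewrite ?inE ?eqxx.
    by have [c cb cd] := IH b pb dp; exists c; rewrite // inE cb orbT.
  have [ia _] := ip a (mem_belast ab).
  apply: (inner_full DP cc cv ia (fp a ab)); rewrite vertex_node // dE.
  exact: across_vertex.
- by move=> d; rewrite !memt edgeK // => /ip[_]; apply: contra => ?; rewrite edgeK.
- by rewrite x'E /turn ce /x' edgeK // eqxx.
- by rewrite lastE /turn cy edgeK // eqxx.
- by rewrite x'E.
exists q1, q2, (r :: p), (e :: p'), y', chi1, chi2.
by split=> //; rewrite ?x'E; split.
Qed.
End Cut.

Lemma cat_eq_split (T : Type) (s1 s2 t1 t2 : seq T) (x : T) :
  s1 ++ s2 = t1 ++ x :: t2 ->
  (exists s, s1 = t1 ++ x :: s /\ t2 = s ++ s2) \/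
  (exists s, t1 = s1 ++ s /\ s2 = s ++ x :: t2).
Proof.
elim: s1 t1 => [|y s1 IH] t1 /= E; first by right; exists t1.
case: t1 E => [|z t1] /= [-> E]; first by left; exists s1; rewrite E.
case: (IH _ E) => [[s [-> ->]]|[s [-> ->]]]; [left | right]; by exists s.
Qed.

(** * Lenses of minimal area *)

Section MinimalLens.
Variable D : tgraph.
Hypothesis DP : is_diagram D.
Hypothesis cleanD : clean D.
Hypothesis untiedD : untied D.
Implicit Types (x y d e a b : dart D) (w s u al be : seq (dart D)) (chi : dart D -> bool).

(* If be is empty, the boundary is a single closed strand, or an arc with
   one corner. *)
Record lens chi al be : Prop := Lens {
  lens_polygon : polygon chi (al ++ be);
  lens_left : sorted straight al;
  lens_right : sorted straight be;
  lens_neq0 : al ++ be != [::] }.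

Definition min_area m := forall chi al be, lens chi al be -> m <= area chi.

Lemma straight_crossing_neq x y : straight x y -> x != y -> crossing y.
Proof.
move=> xy nxy; have [//|ny] := boolP (crossing y); case/eqP: nxy.
have ne : ~~ crossing (edge x).
  by rewrite -(crossing_vertex DP (x := y)) // adj_vertex // /adj xy.
by rewrite (straight_noncrossing xy ne) -(cleanD ne) edgeK.
Qed.

Lemma straight_next chi s x y : polygon chi s -> x \in s -> y \in s -> adj x y -> next s x = y.
Proof.
move=> ps xs ys xy; apply: (polygon_enter_inj DP cleanD ps ys); rewrite ?mem_next //.
have v : next s x \in vertex (edge x).
  by apply: adj_vertex => //; apply: next_cycle xs; apply: pg_cycle ps.
by apply: (vertex_trans DP v); rewrite vertex_sym // adj_vertex.
Qed.

Lemma straight_turn x y : straight x y -> turn x y -> False.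
Proof.
move=> xy /(turnP DP)[yE cx]; have := straight_crossing xy cx; rewrite yE => /eqP.
by rewrite node_eq.
Qed.

(** A strand can leave the polygon only through a foot. Without feet, an inner dart lies on a
    component that stays inside; on the side away from [s] this component bounds a lens of area less
    than [m]. *)
Lemma no_foot_inner chi s m : polygon chi s -> s != [::] -> min_area m -> area chi <= m ->
  (forall x y, x \in s -> y \in s -> straight x y -> crossing y -> False) ->
  forall d, chi d -> d \in s.
Proof.
move=> ps s0 minm le_m nofoot d0 cd0; apply/negPn/negP=> d0s.
have cc := pg_colour ps; have cv := pg_convex ps.
have i0 : inner chi d0.
  by rewrite /inner cd0; apply: contraR d0s => ced; rewrite -(pg_boundary ps) inE cd0.
have inn d : fconnect step d0 d -> inner chi d.
  move/iter_findex <-; elim: (findex _ _ _) => // k IH; apply: inner_step => //.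
  apply/negPn/negP=> stop; have [ce y's x's x'y'] := inner_exit DP ps IH stop.
  by apply: (nofoot _ _ x's y's x'y'); rewrite !crossing_node.
have [chi' [cc' cb' cv']] := strand_colouring DP untiedD d0.
have orbE d : (d \in orbit step d0) = fconnect step d0 d by rewrite fconnect_orbit.
have const x y : x \in s -> y \in s -> adj x y -> chi' x = chi' y.
  move=> xs ys /orP[xy|/(turnP DP)[-> _]]; last by rewrite -colour_edge // edgeK.
  have [cy|ncy] := boolP (crossing y); first by case: (nofoot x y).
  congr chi'; apply/eqP/negPn/negP=> /(straight_crossing_neq xy).
  by rewrite (negPf ncy).
have [a0 a0s] : exists a0, a0 \in s by case: (s) s0 => // a0 s' _; exists a0; rewrite inE eqxx.
have chi'_s d : d \in s -> chi' d = chi' a0.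
  move=> ds; have [i s' rs] := rot_to a0s; have ps' := polygon_rot i ps; rewrite rs in ps'.
  have mem_s' c : (c \in a0 :: s') = (c \in s) by rewrite -rs mem_rot.
  have := ds; rewrite -mem_s' inE => /orP[/eqP-> //|dq].
  have p2' : path (fun a b => chi' a == chi' b) a0 s'.
    have := pg_cycle ps'; rewrite /= rcons_path => /andP[p2 _].
    apply: path_strengthen p2 => a b ab bq aab; apply/eqP; apply: const => //.
      by rewrite -mem_s' mem_belast.
    by rewrite -mem_s' inE bq orbT.
  have tr : transitive (fun a b => chi' a == chi' b) by move=> a b c /eqP->.
  by have := order_path_min tr p2' => /allP/(_ _ dq)/eqP <-.
(* [psi] is the side of the component that does not contain the boundary [s], and [d1] orients the
   component so that this side is on its left. *)
pose bb := chi' a0; pose psi d := chi d && (chi' d (+) bb).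
pose d1 := if bb then edge d0 else d0.
have d1E d : (d \in orbit step d1) = fconnect step d0 (if bb then edge d else d).
  rewrite -fconnect_orbit /d1; case: (bb) => //.
  apply/idP/idP => [/(fconnect_step_edge DP)|/(fconnect_step_edge DP)]; rewrite ?edgeK //.
    by rewrite fconnect_sym //; apply: step_inj.
  by rewrite fconnect_sym //; apply: step_inj.
have innD d : d \in orbit step d1 -> inner chi d.
  by rewrite d1E; case: (bb) => [/inn|/inn //]; rewrite inner_edge.
have bpsi d : d \in orbit step d1 -> chi' d = ~~ bb /\ chi' (edge d) = bb.
  rewrite d1E -orbE -cb' inE; case: (bb); rewrite ?edgeK // => /andP[e1 /negbTE e2].
    by rewrite e1 e2.
  by rewrite e1 e2.
have bpsi' d : chi' d = ~~ bb -> chi' (edge d) = bb -> d \in orbit step d1.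
  by rewrite d1E -orbE -cb' inE; case: (bb); rewrite ?edgeK // => -> ->.
have lp : lens psi (orbit step d1) [::].
  have cyc : fcycle step (orbit step d1) by apply: cycle_orbit; apply: step_inj.
  split; rewrite ?cats0.
  - split.
    + by move=> a b ab; rewrite /psi (cc _ _ ab) (cc' _ _ ab).
    + move=> x cx /andP[c1 c1'] /andP[c2 c2']; rewrite /psi (cv x cx c1 c2) /=.
      rewrite (cv' x cx) //; move: c1' c2'; case: (bb); by case: (chi' x); case: (chi' (opp x)).
    + move=> d; rewrite inE; apply/idP/idP => [/andP[/andP[cd cd']]|dO]; last first.
        have /andP[e1 e2] := innD _ dO; have [e3 e4] := bpsi _ dO.
        by rewrite /psi e1 e3 e4 addbb andbF; case: (bb).
      have cd'E : chi' d = ~~ bb by move: cd'; case: (bb); case: (chi' d).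
      rewrite negb_and => /orP[ced|ced'].
        have : d \in s by rewrite -(pg_boundary ps) inE cd.
        by move/chi'_s; rewrite cd'E -/bb; case: (bb).
      by apply: bpsi' => //; move: ced'; case: (bb); case: (chi' _).
    + by apply: sub_cycle cyc => a b /eqP <-; rewrite /adj /straight eqxx.
    + exact: orbit_uniq.
  - rewrite /orbit; case: (order _ _) => //= n; apply: sub_path (fpath_traject _ _ _) => a b.
    by rewrite /straight eq_sym.
  - by [].
  - by rewrite -size_eq0 size_orbit -lt0n order_gt0.
have := leq_trans le_m (minm _ _ _ lp); rewrite leqNgt => /negP; apply.
have d1O : d1 \in orbit step d1 by rewrite in_orbit.
apply: proper_card; apply/properP; split; first by apply/subsetP=> d; rewrite !inE /psi => /andP[].
exists (edge d1); have /andP[e1 e2] := innD _ d1O; have [e3 e4] := bpsi _ d1O.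
  by rewrite inE.
by rewrite inE /psi e4 addbb andbF.
Qed.

(** An arc enters at the foot [y] of the side [A]. Leaving through [A] again, it would cut off a
    lens smaller than [m]; so it leaves through [B] or [C] and cuts off a triangle at the corner
    with that side. When [C] is nonempty, the strict bound excludes an exit exactly between [B] and
    [C], where the two would form one strand and the whole polygon would be a lens. *)
Lemma foot_cut m chi A B C A1 x y A2 :
  polygon chi (A ++ B ++ C) -> sorted straight A -> sorted straight B -> sorted straight C ->
  A = A1 ++ x :: y :: A2 -> min_area m -> area chi <= m -> (C = [::] \/ area chi < m) ->
  exists y' t t' (chi1 chi2 : dart D -> bool),
  [/\ sorted straight t, sorted straight t', smaller chi1 chi, smaller chi2 chi &
   (exists b B1 B2, [/\ B = (b :: B1) ++ y' :: B2, straight (last b B1) y' &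
      polygon chi1 ((y :: A2) ++ (b :: B1) ++ t')]) \/
   (exists c C1 C2, C = (c :: C1) ++ y' :: C2 /\
      polygon chi2 ((y' :: C2) ++ (rcons A1 x) ++ t))].
Proof.
move=> ps sA sB sC AE minm le_m hC; rewrite AE in sA ps.
have sx : sorted straight (rcons A1 x).
  by have := sA; rewrite -cat_rcons => /cat_sorted2[].
have sy : sorted straight (y :: A2).
  by have := sA; rewrite -cat_rcons => /cat_sorted2[].
have xy : straight x y.
  by have := sA => /cat_sorted2[_] /= /andP[].
have cy : crossing y.
  apply: (straight_crossing_neq xy); apply: contraTneq (pg_uniq ps) => ->.
  by rewrite -!catA /= cat_uniq /= inE eqxx /= !andbF.
have {}ps : polygon chi (y :: A2 ++ B ++ C ++ rcons A1 x).
  have := ps; rewrite -!catA -cat_rcons => /polygon_catC.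
  by rewrite /= -!catA.
have lst : last y (A2 ++ B ++ C ++ rcons A1 x) = x by rewrite !last_cat last_rcons.
have [||q1 [q2 [t [t' [y' [chi1 [chi2 [qE [xy' cy'] [st st'] [p1 s1] [p2 s2]]]]]]]]] := cut DP cleanD untiedD ps.
- by rewrite lst.
- exact: cy.
have bad chi' al be : smaller chi' chi -> lens chi' al be -> False.
  by move=> [_ lt] /minm h; move: (leq_trans lt le_m); rewrite ltnNge h.
exists y', t, t', chi1, chi2; split => //.
case: (cat_eq_split qE) => [[s [A2E q2E]]|[s [q1E R1E]]].
  case: (bad _ (y :: q1) t' s1); split=> //.
  by have := sy; rewrite A2E -cat_cons => /cat_sorted2[].
case: (cat_eq_split R1E) => [[s' [BE q2E]]|[s' [sE R2E]]].
  left; case: s BE q1E {R1E} => [|b B1] BE q1E.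
    case: (bad _ (y :: q1) t' s1); split=> //; rewrite q1E cats0; exact: sy.
  exists b, B1, s'; split=> //.
    by move: xy'; rewrite q1E last_cat.
  by move: p1; rewrite q1E -cat_cons -catA.
case: (cat_eq_split R2E) => [[s'' [CE q2E]]|[s'' [s'E RE]]].
  right; case: s' CE sE {R2E} => [|c C1] CE sE; last first.
    by exists c, C1, s''; split=> //; move: p2; rewrite q2E -cat_cons -catA.
  rewrite cats0 in sE; case: B ps sB sE {lst qE R1E} => [|b B] ps sB sE.
    by case: (bad _ (y :: q1) t' s1); split=> //; rewrite q1E sE cats0.
  case: hC => [C0|lt]; first by rewrite C0 in CE.
  have sBC : sorted straight ((b :: B) ++ C).
    rewrite CE /= cat_path -[path _ b B]/(sorted straight (b :: B)) sB /= .
    have := sC; rewrite CE /= => ->; rewrite andbT.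
    by move: xy'; rewrite q1E sE last_cat.
  have := minm chi (A1 ++ x :: y :: A2) ((b :: B) ++ C).
  rewrite leqNgt lt => /(_ _)/negP[]; split=> //; last by case: (A1).
  have e : y :: A2 ++ (b :: B) ++ C ++ rcons A1 x = (y :: A2 ++ (b :: B) ++ C) ++ rcons A1 x.
    by rewrite /= -!catA /= -!catA.
  by rewrite e in ps; have := polygon_catC ps; rewrite cat_rcons -!catA.
case: (bad _ (y' :: q2) t s2); split=> //.
by have := sx; rewrite RE => /cat_sorted2[].
Qed.

End MinimalLens.

(** * The shape of a minimal lens *)

Section Trichotomy.
Variable D : tgraph.
Hypothesis DP : is_diagram D.
Hypothesis cleanD : clean D.
Hypothesis untiedD : untied D.
Implicit Types (x y d e a b c : dart D) (w s u al be : seq (dart D)) (chi : dart D -> bool).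

Definition bigon_face a b :=
  [/\ crossing a && crossing b, ~~ same_vertex a b,
      edge a = node b /\ edge b = node a &
      forall x, region a x = (x \in [:: a; b])].

Definition triangle_face a b c :=
  [/\ [&& crossing a, crossing b & crossing c],
      [&& ~~ same_vertex a b, ~~ same_vertex b c & ~~ same_vertex c a],
      [/\ edge a = node b, edge b = node c & edge c = node a] &
      forall x, region a x = (x \in [:: a; b; c])].

Section MinArea.
Variables (m : nat) (chi : dart D -> bool) (al be : seq (dart D)).
Hypothesis minm : min_area D m.
Hypothesis chim : area chi = m.

(* base is a segment of the side al of the lens, ending at a crossing of al. *)
Definition on_side base := {subset base <= al} /\
  exists x base' y, [/\ base = rcons base' x, y \in al & straight x y].

(* A triangle with its base on al and one leg of a single edge x; when it is not
   a face, an arc entering it through base or leg cuts off a smaller one. *)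
Lemma tri_search n chi1 x base leg : area chi1 <= n -> smaller chi1 chi ->
  sorted straight base -> sorted straight leg -> on_side base ->
  polygon chi1 (x :: base ++ leg) \/ polygon chi1 (base ++ x :: leg) ->
  exists chi2 a b c, [/\ smaller chi2 chi, polygon chi2 [:: a; b; c] & on_side [:: a]].
Proof.
elim: n chi1 x base leg => [|n IH] chi1 x base leg.
  rewrite leqn0 => /eqP a0 _ _ _ _ ps.
  have {ps} [s ps xs] : exists2 s, polygon chi1 s & x \in s.
    by case: ps => ps; eexists; try exact: ps; rewrite ?mem_cat !inE eqxx ?orbT.
  have [cx _] := polygon_in ps xs.
  have : 0 < area chi1 by apply/card_gt0P; exists x.
  by rewrite a0.
move=> le_n sm1 sb sl os ps.
have lt_m : area chi1 < m by case: sm1 => _; rewrite chim.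
have le_m := ltnW lt_m.
have smaller_trans chi2 : smaller chi2 chi1 -> smaller chi2 chi /\ area chi2 <= n.
  case: sm1 => sub1 lt1 [sub2 lt2]; split; last by rewrite -ltnS (leq_trans lt2).
  by split; [move=> d /sub2/sub1 | exact: ltn_trans lt1].
have no_lens al' be' : polygon chi1 (al' ++ be') -> sorted straight al' ->
    sorted straight be' -> al' ++ be' <> [::] -> False.
  move=> p1 s1 s2 /eqP n0; have := minm (Lens p1 s1 s2 n0); by rewrite leqNgt lt_m.
have single e : sorted straight [:: e] by [].
case: leg sl ps => [|l0 leg] sl ps.
  case: (no_lens base [:: x]) => //; last by case: (base).
  case: ps => ps //; rewrite cats0 -cat1s in ps; exact: polygon_catC ps.
have no2 (B1 B2 : seq (dart D)) b e y : [:: e] = (b :: B1) ++ y :: B2 -> False.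
  by case: B1.
have {}ps : polygon chi1 (base ++ (l0 :: leg) ++ [:: x]) \/
    polygon chi1 (base ++ [:: x] ++ (l0 :: leg)).
  case: ps => ps; [left | by right].
  by rewrite catA; apply: polygon_catC.
have base_end B1 y B2 : base = B1 ++ y :: B2 -> on_side (y :: B2).
  case: os => sub [x1 [base' [y1 [bE y1al x1y1]]]] E; split.
    by move=> d dB; apply: sub; rewrite E mem_cat dB orbT.
  exists x1; move: bE; rewrite E; case/lastP: B2 {E} => [|B2 z].
    by rewrite cats1 => /rcons_inj[_ yE]; exists [::], y1; split; rewrite ?yE.
  by rewrite -rcons_cons -rcons_cat => /rcons_inj[_ zE]; exists (y :: B2), y1; split; rewrite ?zE.
have base_start b B1 y B2 : base = (b :: B1) ++ y :: B2 -> straight (last b B1) y ->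
    on_side (b :: B1).
  case: os => sub _ E st; split.
    by move=> d dB; apply: sub; rewrite E mem_cat dB.
  exists (last b B1), (belast b B1), y; split=> //; first by rewrite lastI.
  by apply: sub; rewrite E mem_cat mem_head orbT.
case: ps => ps.
  (* If the leg has a foot, the one nearest to the base is used: its arc cannot leave through the
     single edge [x], so it ends on the base and cuts off a smaller triangle with single edge [l0].
     If the leg is a single edge, an arc entering through the base has no exit, so the base is a
     single edge as well. The other cyclic order is treated in the same way. *)
  case: leg sl ps => [|l1 leg] sl ps.
    case: base sb os base_end base_start ps => [|b0 [|b1 base]] sb os base_end base_start ps.
    - by case: os => _ [? [[|? ?] [? []]]].
    - by exists chi1, b0, l0, x; split.
    have := foot_cut DP cleanD untiedD (A1 := [::]) ps sb sl (single x) (erefl _) minm le_m (or_intror lt_m).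
    case=> y' [t [t' [chi2 [chi3 [_ _ _ _ [[b [B1 [B2 [/no2 //]]]]|[c [C1 [C2 [/no2 //]]]]]]]]]].
  have ps' : polygon chi1 ((l0 :: l1 :: leg) ++ [:: x] ++ base).
    by rewrite catA; apply: polygon_catC.
  have := foot_cut DP cleanD untiedD (A1 := [::]) ps' sl (single x) sb (erefl _) minm le_m (or_intror lt_m).
  case=> y' [t [t' [chi2 [chi3 [stt stt' s2 s3 [[b [B1 [B2 [/no2 //]]]]|[c [C1 [C2 [bE p3]]]]]]]]]].
  have [sm3 an] := smaller_trans _ s3.
  apply: (IH chi3 l0 (y' :: C2) t) => //; last by right.
    by have := sb; rewrite bE => /cat_sorted2[].
  exact: base_end bE.
case/lastP: leg sl ps => [|leg l'] sl ps.
  case: base sb os base_end base_start ps => [|b0 [|b1 base]] sb os base_end base_start ps.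
  - by case: os => _ [? [[|? ?] [? []]]].
  - by exists chi1, b0, x, l0; split.
  have := foot_cut DP cleanD untiedD (A1 := [::]) ps sb (single x) (single l0) (erefl _) minm le_m (or_intror lt_m).
  case=> y' [t [t' [chi2 [chi3 [_ _ _ _ [[b [B1 [B2 [/no2 //]]]]|[c [C1 [C2 [/no2 //]]]]]]]]]].
have lE : l0 :: rcons leg l' = belast l0 leg ++ last l0 leg :: l' :: [::].
  by rewrite -cat_rcons -lastI cats1.
have ps' : polygon chi1 ((l0 :: rcons leg l') ++ base ++ [:: x]).
  by have := ps; rewrite catA => /polygon_catC.
have := foot_cut DP cleanD untiedD ps' sl sb (single x) lE minm le_m (or_intror lt_m).
case=> y' [t [t' [chi2 [chi3 [stt stt' s2 s3 [[b [B1 [B2 [bE st p2]]]]|[c [C1 [C2 [/no2 //]]]]]]]]]].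
have [sm2 an] := smaller_trans _ s2.
apply: (IH chi2 l' (b :: B1) t') => //; last by left.
  by have := sb; rewrite bE => /cat_sorted2[].
exact: base_start bE st.
Qed.

End MinArea.

Lemma polygon_same_vertex chi s x y : polygon chi s -> x \in s -> y \in s -> x != y ->
  ~~ same_vertex x y.
Proof.
move=> ps xs ys; apply: contra; rewrite same_vertexE // => v.
by rewrite (polygon_enter_inj DP cleanD ps xs ys v).
Qed.

Lemma turns_no_foot chi s : polygon chi s -> (forall x, x \in s -> turn x (next s x)) ->
  forall x y, x \in s -> y \in s -> straight x y -> crossing y -> False.
Proof.
move=> ps ts x y xs ys xy _; have ad : adj x y by rewrite /adj xy.
have := ts x xs; rewrite (straight_next DP cleanD ps xs ys ad).
exact: straight_turn xy.
Qed.

Lemma turn_region x y : turn x y -> region y x.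
Proof.
by case/andP=> _ /eqP e; have := region_node DP y; rewrite e edgeK.
Qed.

(* The triangular face with sides a, b, c rests on the side a of the lens. *)
Record flippable chi al1 a y al2 be b c : Prop := Flippable {
  fl_triangle : triangle_face a b c;
  fl_polygon : polygon chi ((al1 ++ a :: y :: al2) ++ be);
  fl_left : sorted straight (al1 ++ a :: y :: al2);
  fl_right : sorted straight be;
  fl_in : chi b /\ chi c;
  fl_tip : al1 = [::] -> turn (last y be) a;
  fl_size : 1 < size be }.

(** An arc entering a lens with only one side would cut off a smaller lens. So the boundary is a
    crossingless circle, and minimality leaves nothing inside. *)
Lemma straight_lens m chi al : lens chi al [::] -> min_area D m -> area chi = m ->
  exists x, [/\ ~~ crossing x, edge x = node x & forall z, region x z -> z = x].
Proof.
move=> [ps sal _ al0] minm am; rewrite cats0 in al0.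
have le_m : area chi <= m by rewrite am.
have single e : sorted (@straight D) [:: e] by [].
case: al ps sal al0 => [//|x [|y al]] ps sal _; last first.
  have := foot_cut DP cleanD untiedD (A1 := [::]) (B := [::]) (C := [::]) ps sal isT isT (erefl _) minm le_m (or_introl (erefl _)).
  case=> y' [t [t' [chi2 [chi3 [_ _ _ _ [[b [B1 [B2 [//]]]]|[c [C1 [C2 [//]]]]]]]]]].
rewrite cats0 in ps; have xs : x \in [:: x] by rewrite inE.
have adx : adj x x by have := pg_cycle ps; rewrite /= andbT.
have stx : straight x x.
  case/orP: adx => // /andP[cx /eqP e]; case/negP: (untiedD cx).
  by rewrite e td_tie_edge.
have [cx|ncx] := boolP (crossing x).
  by have [//||[|? ?] [? [? [? [? [? [? []]]]]]]] := cut DP cleanD untiedD ps.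
exists x; split=> //; first exact: cleanD.
move=> z xz; apply/eqP; rewrite -mem_seq1; apply: (no_foot_inner DP cleanD untiedD ps _ minm le_m) => //.
  by move=> u v; rewrite !inE => /eqP-> /eqP-> _; apply/negP.
by rewrite -(pg_colour ps xz); have [] := polygon_in ps xs.
Qed.

(** If a corner is not a genuine turn, the lens has only one side. If [be] is a single edge, an arc
    entering through [al] has no exit, so [al] is a single edge too and the lens is a bigon.
    Otherwise the last foot of [be] is used: its arc ends on [al] and cuts off a triangle with the
    single edge [b'], in which [tri_search] finds a face. *)
Lemma minimal_lens m chi al be : lens chi al be -> min_area D m -> area chi = m ->
  [\/ exists x, [/\ ~~ crossing x, edge x = node x & forall z, region x z -> z = x],
      exists a b, bigon_face a b |
      exists chi' al1 a y al2 be' b c, flippable chi' al1 a y al2 be' b c /\ area chi' = m].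
Proof.
move=> lp minm am; have le_m : area chi <= m by rewrite am.
have single e : sorted (@straight D) [:: e] by [].
case: be lp => [|b p2] lp; first by apply: Or31; apply: straight_lens lp minm am.
case: al lp => [|a p] lp.
  apply: Or31; apply: (straight_lens (al := b :: p2)) minm am.
  by case: lp => ps sa sb n0; split; rewrite ?cats0.
have [ps sa sb _] := lp.
have turn_ab : straight (last a p) b -> exists x, [/\ ~~ crossing x, edge x = node x & forall z, region x z -> z = x].
  move=> st; apply: (straight_lens (al := (a :: p) ++ b :: p2)) minm am; split; rewrite ?cats0 //.
  by rewrite /= cat_path /= st -![path _ _ _]/(sorted straight (_ :: _)) sa.
have turn_ba : straight (last b p2) a -> exists x, [/\ ~~ crossing x, edge x = node x & forall z, region x z -> z = x].
  move=> st; apply: (straight_lens (al := (b :: p2) ++ a :: p)) minm am; split; rewrite ?cats0 //.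
    exact: polygon_catC.
  by rewrite /= cat_path /= st -![path _ _ _]/(sorted straight (_ :: _)) sb.
have := pg_cycle ps; rewrite /= rcons_path cat_path last_cat /= => /andP[/andP[_ /andP[ab _]] ba].
case/orP: ab => [/turn_ab ?|ab]; first exact: Or31.
case/orP: ba => [/turn_ba ?|ba]; first exact: Or31.
case/lastP: p2 lp ps sb ba {turn_ab turn_ba} => [|be0 b'] lp ps sb ba.
  case: p lp ps sa ab => [|a' p] lp ps sa ab.
    apply: Or32; exists a, b.
    have as' : a \in [:: a; b] by rewrite inE eqxx.
    have bs' : b \in [:: a; b] by rewrite !inE eqxx orbT.
    have nab : a != b by have := pg_uniq ps; rewrite /= inE andbT.
    have := ab; have := ba; rewrite /turn /= => /andP[ca /eqP eb] /andP[cb /eqP ea].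
    split=> //; [by rewrite ca | exact: polygon_same_vertex ps as' bs' nab |].
    move=> x; apply/idP/idP => [ax|].
      apply: (no_foot_inner DP cleanD untiedD ps _ minm le_m) => //.
        apply: turns_no_foot ps _ => z; rewrite !inE => /orP[]/eqP->; rewrite /= ?eqxx //.
        by rewrite ?[b == a]eq_sym (negPf nab) ?eqxx.
      by rewrite -(pg_colour ps ax); have [] := polygon_in ps as'.
    rewrite !inE => /orP[]/eqP->; first exact: region_refl.
    by apply: turn_region; exact: ba.
  have := foot_cut DP cleanD untiedD (A1 := [::]) (C := [::]) (B := [:: b]) _ sa sb isT (erefl _) minm le_m (or_introl (erefl _)).
  rewrite cats0 => /(_ ps).
  by case=> y' [t [t' [chi2 [chi3 [_ _ _ _ [[? [[|? ?] [B2 [//]]]]|[c [C1 [C2 [//]]]]]]]]]].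
have lE : b :: rcons be0 b' = belast b be0 ++ last b be0 :: b' :: [::].
  by rewrite -cat_rcons -lastI cats1.
have ps' : polygon chi ((b :: rcons be0 b') ++ (a :: p) ++ [::]).
  by rewrite cats0; apply: polygon_catC.
have := foot_cut DP cleanD untiedD ps' sb sa isT lE minm le_m (or_introl (erefl _)).
case=> y' [t [t' [chi1 [chi2 [stt stt' s1 s2 [[a0 [B1 [B2 [aE st p1]]]]|[c [C1 [C2 [//]]]]]]]]]].
have os : on_side (a :: p) (a0 :: B1).
  split; first by move=> d dB; rewrite aE mem_cat dB.
  exists (last a0 B1), (belast a0 B1), y'; split=> //; first by rewrite lastI.
  by rewrite aE mem_cat mem_head orbT.
have sB : sorted straight (a0 :: B1) by have := sa; rewrite aE => /cat_sorted2[].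
have [chi3 [a1 [b1 [c1 [sm3 p3 os3]]]]] :=
  tri_search minm am (leqnn _) s1 sB stt' os (or_introl p1).
apply: Or33; have [sub1 [a2 [[|? l] [y1 [a2E y1al st1]]]]] := os3; last by case: a2E => _; case: (l).
case: a2E => a2E; rewrite -{a2}a2E in st1.
have a1al : a1 \in a :: p by apply: sub1; rewrite inE.
have lt3 : area chi3 < m by case: sm3 => _; rewrite am.
have no_lens al' be' : polygon chi3 (al' ++ be') -> sorted straight al' ->
    sorted straight be' -> al' ++ be' <> [::] -> False.
  move=> q1 q2 q3 /eqP n0; have := minm _ _ _ (Lens q1 q2 q3 n0); by rewrite leqNgt lt3.
have as3 : a1 \in [:: a1; b1; c1] by rewrite inE eqxx.
have bs3 : b1 \in [:: a1; b1; c1] by rewrite !inE eqxx orbT.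
have cs3 : c1 \in [:: a1; b1; c1] by rewrite !inE eqxx !orbT.
have := pg_cycle p3; rewrite /= andbT => /and3P[adab adbc adca].
have ab1 : turn a1 b1.
  case/orP: adab => // st'; case: (no_lens [:: a1; b1] [:: c1]) => //=; by rewrite st'.
have bc1 : turn b1 c1.
  case/orP: adbc => // st'; case: (no_lens [:: b1; c1] [:: a1]) => //=; last by rewrite st'.
  exact: (polygon_catC (s1 := [:: a1]) (s2 := [:: b1; c1])).
have ca1 : turn c1 a1.
  case/orP: adca => // st'; case: (no_lens [:: c1; a1] [:: b1]) => //=; last by rewrite st'.
  exact: (polygon_catC (s1 := [:: a1; b1]) (s2 := [:: c1])).
have /= := pg_uniq p3; rewrite !inE negb_or andbT => /andP[/andP[nab nac] nbc].
have nf : forall x y, x \in [:: a1; b1; c1] -> y \in [:: a1; b1; c1] -> straight x y -> crossing y -> False.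
  apply: turns_no_foot p3 _ => z; rewrite !inE => /or3P[]/eqP->; rewrite /= ?eqxx //.
    by rewrite [b1 == a1]eq_sym (negPf nab) ?eqxx.
  by rewrite [c1 == a1]eq_sym (negPf nac) [c1 == b1]eq_sym (negPf nbc) ?eqxx.
have tri : triangle_face a1 b1 c1.
  have := ab1; have := bc1; have := ca1.
  rewrite /turn => /andP[ca /eqP ec] /andP[cc /eqP eb] /andP[cb /eqP ea].
  split=> //; first by rewrite ca cb.
    rewrite !(polygon_same_vertex p3) //.
    by rewrite eq_sym.
  move=> z; apply/idP/idP => [az|].
    apply: (no_foot_inner DP cleanD untiedD p3 _ minm (ltnW lt3)) => //.
    by rewrite -(pg_colour p3 az); have [] := polygon_in p3 as3.
  rewrite !inE => /or3P[]/eqP->; first exact: region_refl.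
    by rewrite region_sym //; apply: turn_region ab1.
  exact: turn_region ca1.
(* [a1] is not the last dart of [al]: it is followed by [y1], which lies in [al], whereas the last
   dart is followed by [b]. *)
have [al1 [[|z al2] alE]] := in_split a1al.
  have y1s : y1 \in (a :: p) ++ b :: rcons be0 b' by rewrite mem_cat y1al.
  have a1s : a1 \in (a :: p) ++ b :: rcons be0 b' by rewrite mem_cat a1al.
  have bs : b \in (a :: p) ++ b :: rcons be0 b' by rewrite mem_cat mem_head orbT.
  have e1 : next ((a :: p) ++ b :: rcons be0 b') a1 = y1.
    by apply: (straight_next DP cleanD ps) => //; rewrite /adj st1.
  have e2 : next ((a :: p) ++ b :: rcons be0 b') a1 = b.
    apply: (straight_next DP cleanD ps) => //; rewrite /adj.
    by have := ab; rewrite -[last a p]/(last a (a :: p)) alE last_cat /= => ->; rewrite orbT.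
  have := pg_uniq ps; rewrite cat_uniq => /and3P[_ /hasPn/(_ b (mem_head _ _))].
  by rewrite /= -e2 e1 y1al.
have zE : z = y1.
  have := sa; rewrite alE => /cat_sorted2[_] /= /andP[/eqP-> _].
  by rewrite (eqP st1).
rewrite zE in alE; exists chi, al1, a1, y1, al2, (b :: rcons be0 b'), b1, c1; split=> //.
split=> //.
- by rewrite -alE.
- by rewrite -alE.
- case: sm3 => sub3 _; split; apply: sub3.
    by have [] := polygon_in p3 bs3.
  by have [] := polygon_in p3 cs3.
- by move=> al10; move: alE; rewrite al10 => -[<- _].
- by rewrite /= size_rcons.
Qed.

End Trichotomy.

(* The lens loses the triangle abc: in its boundary the side a is replaced by the
   other two sides of the flipped triangle. *)
Section FlipLens.
Variable D : tgraph.
Hypothesis DP : is_diagram D.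
Hypothesis cleanD : clean D.
Hypothesis untiedD : untied D.
Implicit Types (x d : dart D).
Variables (chi : dart D -> bool) (al1 : seq (dart D)) (a y : dart D)
  (al2 be : seq (dart D)) (b c : dart D).
Hypothesis fl : flippable chi al1 a y al2 be b c.
Hypothesis abc : triangle a b c.

Let E := flip_triangle a b c.
Let l := tri_left a b c.
Let tri := tri_darts a b c.
Let v := nth a tri.
Let s := (al1 ++ a :: y :: al2) ++ be.
Let ps : polygon chi s := fl_polygon fl.
Let cc : region_colouring chi := pg_colour ps.
Let cv : convex chi := pg_convex ps.
Let out := outward a b c.
Let side := tri_side a b c.

(** Two shapes have to be distinguished: either the boundary goes straight through the vertex where
    [a] starts, or [a] starts at a corner of the lens. *)
Let t := al1 != [::].

Ltac cases12 k := do 12?[case: k => [|k]]; rewrite ?ltnS ?ltn0 //.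

Let regE x : region a x = (x \in [:: v 0; v 4; v 8]).
Proof. by case: abc. Qed.

Let cr_v k : k < 12 -> crossing (v k).
Proof.
have /and3P[ca cb cc'] : [&& crossing a, crossing b & crossing c] by case: abc.
by cases12 k => _; rewrite /v /= ?crossing_node.
Qed.

Let opp_v i : i < 12 -> opp (v i) = v (opp_in i).
Proof. exact: tri_opp_v. Qed.
Let node_v i : i < 12 -> node (v i) = v (next_in i).
Proof. exact: tri_node_v. Qed.
Let vE i j : i < 12 -> j < 12 -> (v i == v j) = (i == j).
Proof. exact: tri_vE. Qed.
Let left_v i : i < 12 -> l (v i) = v (left_in i).
Proof. exact: tri_left_v. Qed.
Let out_v i : i < 12 -> out (v i) = v (out_in i).
Proof. exact: tri_out_v. Qed.
Let side_v i : i < 12 -> side (v i) = (i \in [:: 0; 5; 4; 9; 8; 1]).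
Proof. exact: tri_side_v. Qed.

Let as_ : a \in s. Proof. by rewrite !mem_cat mem_head orbT. Qed.
Let ys_ : y \in s. Proof. by rewrite !mem_cat !inE eqxx !orbT. Qed.

Let st_ay : straight a y.
Proof. by have /cat_sorted2[_ /= /andP[]] := fl_left fl. Qed.

Let edge0 : edge (v 0) = v 5 := tri_edge0 abc.

Let yE : y = v 7.
Proof.
have := straight_crossing st_ay; rewrite -[a]/(v 0) edge0 cr_v // => /(_ isT) ->.
exact: (opp_v (isT : 5 < 12)).
Qed.

Let cy : crossing y. Proof. by rewrite yE cr_v. Qed.

Let prev_in i := nth 0 [:: 3;0;1;2;7;4;5;6;11;8;9;10] i.

Let chi_edge k : k < 12 -> chi (edge (v k)) = chi (v (prev_in k)).
Proof.
move=> k12; have -> : v k = node (v (prev_in k)).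
  by move: k12; cases12 k => _; rewrite node_v.
exact: colour_node.
Qed.

(** The values of [chi] at v 0, ..., v 11. *)
Let col := [:: true; t; false; false; true; false; false; true; true; true; t; t].

Let colE k : k < 12 -> chi (v k) = nth false col k.
Proof.
have [c0 c5] := polygon_in ps as_; rewrite -[a]/(v 0) edge0 in c0 c5.
have [c7 c6] := polygon_in ps ys_; rewrite yE chi_edge // in c7 c6.
have c4 : chi (v 4) by rewrite -(cc (x := v 0)) // regE !inE eqxx orbT.
have c8 : chi (v 8) by rewrite -(cc (x := v 0)) // regE !inE eqxx !orbT.
have c9 : chi (v 9).
  have /andP[_] := foot_inner DP ps as_ ys_ st_ay cy.
  by rewrite yE (node_v (isT : 7 < 12)) (tri_edge4 abc).
have c3 : chi (v 3) = false.
  by have := chi_edge (isT : 0 < 12); rewrite edge0 /= (negPf c5).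
have e1 : chi (v 11) = chi (v 1).
  by have := chi_edge (isT : 8 < 12); rewrite (tri_edge8 abc).
have conv i : i < 12 -> chi (v i) -> chi (v (opp_in i)) -> chi (v (next_in i)).
  move=> i12 ci; rewrite -(opp_v i12) -(node_v i12).
  exact: cv (cr_v i12) ci.
have [c1 c2 c10] : [/\ chi (v 1) = t, chi (v 2) = false & chi (v 10) = t].
  have := fl; have := ps; rewrite /s /t; case: (al1) => [|z al] ps' fl'.
    have := fl_tip fl' (erefl _); set w := last y be => /andP[_ /eqP ew].
    have wE : w = v 8.
      by rewrite -(edgeK DP w) -ew -[a]/(v 0) (node_v (isT : 0 < 12)) (tri_edge1 DP abc).
    have ws : w \in (a :: y :: al2) ++ be.
      by rewrite /w; case: (be) => [|z be'] //=; rewrite !inE ?eqxx ?orbT // mem_cat mem_last !orbT.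
    have [_] := polygon_in ps' ws; rewrite wE (tri_edge8 abc) => c1.
    split; first exact: negPf.
      by apply: contraNF c1 => c2; apply: (conv 0).
    by apply: contraNF c1 => c10; rewrite -e1; apply: (conv 10).
  set w := last z al; have st : straight w a.
    have := fl_left fl'; rewrite /= cat_path => /andP[_]; rewrite -/w.
    by case/andP.
  have ws : w \in (z :: al ++ a :: y :: al2) ++ be by rewrite mem_cat -cat_cons mem_cat mem_last.
  have [cw cew] := polygon_in ps' ws.
  have ew : edge w = v 2.
    have := st; rewrite /straight => /eqP /(canLR (acrossK DP)) <-.
    by rewrite /across -[a]/(v 0) cr_v // (opp_v (isT : 0 < 12)).
  have c1 : chi (v 1) by rewrite -(edgeK DP w) ew chi_edge in cw.
  split=> //; first by rewrite ew in cew; apply: negPf.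
  by apply: (conv 9) => //=; rewrite e1.
rewrite /col -c1; cases12 k => _ //=; rewrite ?(negPf c5) ?(negPf c6) // c10 //.
Qed.

Let sE k : k < 12 -> (v k \in s) = nth false col k && ~~ nth false col (prev_in k).
Proof.
move=> k12; rewrite -(pg_boundary ps) inE chi_edge // !colE //.
by move: k12; cases12 k.
Qed.

Let triP x : x \in tri -> exists2 k, k < 12 & x = v k.
Proof. exact: tri_sP. Qed.

(** The old disc without the triangular face, read off at the darts of the new diagram. *)
Let chi' : dart E -> bool := fun x => chi (l x) && ~~ region a (l x).

Let chi'_v k : k < 12 ->
  chi' (v k) = nth false [:: true; t; false; false; t; false; false; t; false; false; false; false] k.
Proof.
move=> k12; rewrite /chi' (left_v k12).
have l12 : left_in k < 12 by move: k12; cases12 k.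
rewrite (colE l12) regE !inE !vE //.
by move: k12 {l12}; cases12 k => _; rewrite /= ?andbT ?andbF.
Qed.

Let chi'_out x : ~~ side x -> chi' (out x) = chi x.
Proof.
move=> ns; rewrite /chi'; have r := tri_leg_left DP abc ns.
rewrite -/out -/l in r; rewrite -(cc r).
suff -> : region a (l (out x)) = false by rewrite andbT.
have -> : region a (l (out x)) = region a x.
  by apply/idP/idP => h; apply: (region_trans DP h); rewrite // region_sym.
rewrite regE; apply: contraNF ns; rewrite !inE => /or3P[] /eqP->; by rewrite side_v.
Qed.

Let out_id x : x \notin tri -> out x = x. Proof. exact: tri_out_out. Qed.

Let side_tri x : side x -> x \in tri.
Proof. by apply: contraLR => /(tri_v_nonside abc); rewrite /side => ->. Qed.

Lemma flip_clean : clean E.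
Proof.
move=> x ncx; have xt : (x : dart D) \notin tri.
  by apply: contra ncx => /triP[k k12 xE]; rewrite xE; exact: (cr_v k12).
change (outward a b c (edge (inward a b c x)) = @node D x).
rewrite tri_inw_out // (cleanD (x := x) ncx) tri_out_out //.
by rewrite (tri_s_node DP a b c).
Qed.

Let edge_out' x : x \notin tri -> @edge E x = out (edge x).
Proof. by move=> xt; change (outward a b c (edge (inward a b c x)) = out (edge x)); rewrite tri_inw_out. Qed.

Let tri_vertex x z : x \in vertex z -> (x \in tri) = (z \in tri).
Proof.
move=> xz; rewrite /tri /tri_darts !mem_cat.
have e w : (x \in vertex w) = (z \in vertex w).
  by apply/idP/idP => h; apply: (vertex_trans DP _ h); rewrite // vertex_sym.
by rewrite !e.
Qed.

Let edge_out x : @edge E (out x) = out (edge x).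
Proof. exact: flip_edge_outward. Qed.

Let adj_edge' u x : u \notin tri -> x \notin tri -> adj u x -> @edge E u = edge u.
Proof.
move=> ut xt ux; rewrite edge_out' // out_id //.
rewrite (tri_vertex (z := x)) //.
by rewrite vertex_sym // adj_vertex.
Qed.

Let adj_edge_a x : x \notin tri -> adj y x -> @edge E a = edge y.
Proof.
move=> xt yx; have -> : a = out y by rewrite yE (out_v (isT : 7 < 12)).
rewrite edge_out out_id //.
rewrite (tri_vertex (z := x)) //.
by rewrite vertex_sym // adj_vertex.
Qed.

Let straightE u x (w : dart D) : @edge E u = edge w -> @straight E u x = straight w x.
Proof. by move=> e; rewrite /straight /step e. Qed.

Let adjE u x (w : dart D) : @edge E u = edge w -> @adj E u x = adj w x.
Proof. by move=> e; rewrite /adj (straightE _ e) /turn e. Qed.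

Let path_adj R : {in R, forall x, x \notin tri} -> path adj y R -> path (@adj E) a R.
Proof.
case: R => // z R Rt /= /andP[yz zR]; apply/andP; split.
  by rewrite (adjE _ (w := y)) // (adj_edge_a (x := z)) // Rt ?mem_head.
apply: path_strengthen zR => u w ub wR uw; rewrite (adjE _ (w := u)) //.
by apply: (adj_edge' (x := w)) => //; apply: Rt; [exact: mem_belast | rewrite inE wR orbT].
Qed.

Let path_straight z R : {in z :: R, forall x, x \notin tri} -> path straight z R ->
  path (@straight E) z R.
Proof.
move=> Rt; apply: path_strengthen => u w ub wR uw; rewrite (straightE _ (w := u)) //.
apply: (adj_edge' (x := w)); last by rewrite /adj uw.
  by apply/Rt/mem_belast.
by apply: Rt; rewrite inE wR orbT.
Qed.

Let path_straight_a R : {in R, forall x, x \notin tri} -> path straight y R ->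
  path (@straight E) a R.
Proof.
case: R => // z R Rt /= /andP[yz zR]; apply/andP; split; last exact: path_straight.
rewrite (straightE _ (w := y)) // (adj_edge_a (x := z)) //; first by rewrite Rt ?mem_head.
by rewrite /adj yz.
Qed.

Lemma flip_polygon s' : cycle (@adj E) s' -> uniq s' ->
  (forall x, ~~ side x -> (out x \in s') = (x \in s)) ->
  (forall k, k \in [:: 2; 7; 6; 11; 10; 3] -> (v k \in s') = t && (k == 7)) ->
  @polygon E chi' s' /\ area chi' < area chi.
Proof.
move=> cs' us' s'out s's; split.
  split=> //.
  - move=> x x' xx'; change (is_true (@region D (l x) (l x'))) in xx'.
    rewrite /chi' (cc xx'); congr (_ && ~~ _).
    by apply/idP/idP => h; apply: (region_trans DP h); rewrite // region_sym.
  - move=> x; change (@crossing D x -> chi' x -> chi' (@opp D x) -> chi' (@node D x)).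
    have [/triP[k k12 ->] _|xt] := boolP ((x : dart D) \in tri).
      rewrite (opp_v k12) (node_v k12) !chi'_v //; try by move: k12; cases12 k.
    have ns z : z \notin tri -> ~~ side z by apply: contra; apply: side_tri.
    have c' z : z \notin tri -> chi' z = chi z.
      by move=> zt; rewrite -{1}(out_id zt) chi'_out // ns.
    by rewrite !c' ?(tri_s_opp DP a b c) ?(tri_s_node DP a b c) //; apply: cv.
  - move=> d; rewrite inE; set x := inward a b c d.
    have dE : d = out x by rewrite /out (inwardK DP abc).
    have [sx|nsx] := boolP (side x); last first.
      rewrite dE s'out // -(pg_boundary ps) inE chi'_out //.
      by rewrite edge_out // chi'_out // /side tri_side_edge.
    have [k k12 xE] := triP (side_tri sx).
    have dk : d = v (out_in k) by rewrite dE xE out_v.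
    rewrite dk; move: sx; rewrite xE side_v // => ks.
    have oks : out_in k \in [:: 2; 7; 6; 11; 10; 3].
      by move: ks; rewrite !inE => /or4P[|||/or3P[]]/eqP->.
    have bnd (P : nat -> bool) : all P [:: 0; 5; 4; 9; 8; 1] -> P k by move/allP; apply.
    rewrite s's // chi'_v; last exact: (bnd (fun k => out_in k < 12)).
    have ee : @edge E (v (out_in k)) = v (nth 0 [:: 0;0;7;10;0;0;11;2;0;0;3;6] (out_in k)).
      have ok2 : out_in k \in [:: 2; 3; 6; 7; 10; 11].
        by move: ks {oks}; rewrite !inE => /or4P[|||/or3P[]]/eqP->.
      exact: (flip_edge_v DP abc ok2).
    rewrite ee chi'_v; last exact: (bnd (fun k => nth 0 [:: 0;0;7;10;0;0;11;2;0;0;3;6] (out_in k) < 12)).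
    move: ks; rewrite !inE => /or4P[|||/or3P[]]/eqP->; rewrite /= ?andbF ?andbT //.
have out_inj : injective out by apply: can_inj (outwardK DP abc).
have -> : area chi' = #|[pred x | chi' (out x)]|.
  rewrite -(card_image out_inj); apply: eq_card => d; rewrite inE.
  apply/idP/imageP => [cd|[x xx ->] //]; exists (inward a b c d).
    by rewrite inE /out (inwardK DP abc).
  by rewrite /out (inwardK DP abc).
pose A := [pred d | chi d].
(* Transported back by the bijection [out], the new disc loses the darts v 0 and v 4 and gains at
   most v 5. *)
have sub : [pred x | chi' (out x)] \subset [predU1 v 5 & [predD1 [predD1 A & v 0] & v 4]].
  apply/subsetP=> x; rewrite !inE => cx.
  have [sx|nsx] := boolP (side x); last first.
    rewrite chi'_out // in cx; rewrite cx andbT; apply/orP; right.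
    by apply/andP; split; apply: contraNneq nsx => ->; rewrite side_v.
  have [k k12 xE] := triP (side_tri sx); move: sx cx; rewrite xE side_v // out_v //.
  rewrite !inE => /or4P[|||/or3P[]]/eqP->; rewrite chi'_v //= => _.
  by rewrite eqxx.
apply: leq_ltn_trans (subset_leq_card sub) _.
rewrite /area -/A (cardD1 (v 0) A) (cardD1 (v 4) [predD1 A & v 0]) cardU1.
rewrite !inE (colE (isT : 0 < 12)) (colE (isT : 4 < 12)) vE //=.
apply: leq_ltn_trans (leq_add (leq_b1 _) (leqnn _)) _.
by rewrite vE.
Qed.

Let s_tri x : x \in s -> x \in tri -> [\/ x = a, x = y | ~~ t /\ x = v 8].
Proof.
move=> xs /triP[k k12 xE]; move: xs; rewrite xE yE sE // /col.
move: k12 {xE}; cases12 k => _ //=; rewrite ?andbF ?andbT //.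
- by move=> _; apply: Or31.
- by move=> _; apply: Or32.
- by move=> nt; apply: Or33.
- by case: (t).
Qed.

Let out_mem (s' : seq (dart D)) : (forall x, x \notin tri -> (x \in s') = (x \in s)) ->
  (forall k, k < 12 -> (v k \in s') = (k == 0) || t && (k == 7)) ->
  (forall x, ~~ side x -> (out x \in s') = (x \in s)) /\
  (forall k, k \in [:: 2; 7; 6; 11; 10; 3] -> (v k \in s') = t && (k == 7)).
Proof.
move=> hout hin; split=> [x nsx|k].
  have [/triP[k k12 xE]|xt] := boolP (x \in tri); last by rewrite out_id // hout.
  move: nsx; rewrite xE side_v // out_v // sE // hin; last by move: k12 {xE}; cases12 k.
  move: k12 {xE}; cases12 k => _ //= _; rewrite ?andbF ?andbT //; by case: (t).
by rewrite !inE => /or4P[|||/or3P[]]/eqP->; rewrite hin //= ?andbF.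
Qed.

(** If the side extends beyond [a] at both ends, its strand meets the other two in the reverse
    order, and [a] and [y] are exchanged in the boundary. If [a] starts at a corner, the corner
    moves across the triangle: [y] and the last dart of [be], which is [c], disappear from the
    boundary, and [fl_size] keeps [be] nonempty. *)
Lemma flip_lens : exists al' be', @lens E chi' al' be' /\ area chi' < area chi.
Proof.
have us := pg_uniq ps; have cs := pg_cycle ps.
have sal := fl_left fl; have sbe := fl_right fl.
have mem_v k : k < 12 -> (v k \in s) = nth false col k && ~~ nth false col (prev_in k) by exact: sE.
case E1: al1 => [|z al0]; last first.
  have tT : t by rewrite /t E1.
  pose R := al2 ++ be ++ al1.
  have psR : polygon chi (a :: y :: R).
    have := ps; rewrite /s -catA => /polygon_catC.
    by rewrite -catA.
  have [/= aR /andP[yR uR]] : a \notin y :: R /\ uniq (y :: R).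
    by have := pg_uniq psR; rewrite cons_uniq => /andP.
  have Rs x : x \in R -> x \in s.
    by rewrite /R /s !mem_cat !inE => /or3P[]->; rewrite ?orbT.
  have Rt : {in R, forall x, x \notin tri}.
    move=> x xR; apply/negP=> xt; case: (s_tri (Rs x xR) xt) => [xE|xE|[]]; last by rewrite tT.
      by move: aR; rewrite inE negb_or -xE xR andbF.
    by move: yR; rewrite -xE xR.
  have wE : last y R = last z al0 by rewrite /R E1 !last_cat.
  have := pg_cycle psR; rewrite /= rcons_path wE => /andP[_ /andP[pR adwa]].
  set w := last z al0 in wE adwa.
  have wR : w \in R by rewrite /R E1 !mem_cat mem_last !orbT.
  have stw : straight w a.
    by have := sal; rewrite E1 /= cat_path => /andP[_ /andP[]].
  have ew : edge w = v 2.
    have := stw; rewrite /straight => /eqP /(canLR (acrossK DP)) <-.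
    by rewrite /across -[a]/(v 0) cr_v // opp_v.
  have stw' : @straight E w y.
    rewrite (straightE _ (w := edge (v 5))); last by rewrite edge_out' ?Rt // ew out_v ?edgeK.
    by rewrite /straight /step edgeK // /across cr_v // opp_v // yE.
  have sty' : @straight E y a.
    rewrite (straightE _ (w := edge (v 2))).
      by rewrite /straight /step edgeK // /across cr_v // opp_v.
    by rewrite edgeK // yE; exact: (flip_edge_v DP abc (isT : 7 \in [:: 2; 3; 6; 7; 10; 11])).
  have wE' : last a R = w by rewrite /w /R E1 !last_cat.
  have cyc : cycle (@adj E) (y :: a :: R).
    rewrite [cycle _ _]/= rcons_path path_adj // wE'.
    by rewrite {1}/adj sty' /adj stw'.
  pose s' := (al1 ++ y :: a :: al2) ++ be.
  have s'E : s' = al1 ++ (y :: a :: al2 ++ be) by rewrite /s' -catA.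
  have RE : y :: a :: R = (y :: a :: al2 ++ be) ++ al1 by rewrite /R /= -catA.
  have cs' : cycle (@adj E) s'.
    by rewrite s'E -(rot_cycle (size al1)) rot_size_cat -RE.
  have us' : uniq s'.
    rewrite s'E uniq_catC -RE !cons_uniq uR andbT; move: aR; rewrite !inE !negb_or => /andP[ay ->].
    by rewrite eq_sym ay yR.
  have mem_s' x : (x \in s') = (x \in s).
    by rewrite /s /s' !mem_cat !inE; congr orb; congr orb; rewrite orbCA.
  have [h1 h2] : (forall x, ~~ side x -> (out x \in s') = (x \in s)) /\
    (forall k, k \in [:: 2; 7; 6; 11; 10; 3] -> (v k \in s') = t && (k == 7)).
    apply: out_mem => [x _|k k12]; first exact: mem_s'.
    rewrite mem_s' sE // /col tT; move: k12; cases12 k.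
  have [pE lt] := flip_polygon cs' us' h1 h2.
  exists (al1 ++ y :: a :: al2), be; split=> //; split=> //.
  - rewrite E1 /= cat_path /= -/w stw' sty' /= path_straight //=.
      have := sal; rewrite E1 /= cat_path => /andP[_ /= /and3P[_ _ p2]].
      by apply: path_straight_a => // x xa; apply: Rt; rewrite /R mem_cat xa.
    by move=> x xa; apply: Rt; rewrite /R E1 !mem_cat xa !orbT.
    by have := sal; rewrite E1 /= cat_path => /andP[].
  - case: (be) sbe @R Rt {cs' us' s' s'E RE mem_s' h1 h2 pE psR aR yR uR Rs wE pR wR wE' cyc} => // b0 be0 sb R Rt.
    apply: path_straight => // x xb; apply: Rt; by rewrite /R !mem_cat xb !orbT.
  - by rewrite E1.
have tF : t = false by rewrite /t E1.
have [b0 [be1 [c' beE]]] : exists b0 be1 c', be = rcons (b0 :: be1) c'.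
  have := fl_size fl; case/lastP: (be) => // [[|b0 be1] c'] //= _.
  by exists b0, be1, c'.
have := fl_tip fl E1; rewrite beE last_rcons => /andP[_ /eqP ec].
have cE : c' = v 8.
  by rewrite -(edgeK DP c') -ec -[a]/(v 0) node_v // (tri_edge1 DP abc).
pose R := al2 ++ b0 :: be1.
have psR : polygon chi (c' :: a :: y :: R).
  have sR : s = (a :: y :: R) ++ [:: c'] by rewrite /s E1 beE -cats1 /R /= -catA.
  by have := ps; rewrite sR => /polygon_catC.
have [/= cR [aR [yR uR]]] : c' \notin [:: a, y & R] /\ a \notin y :: R /\ y \notin R /\ uniq R.
  by have := pg_uniq psR; rewrite !cons_uniq => /and4P[].
have Rs x : x \in R -> x \in s.
  rewrite /R /s beE E1 !mem_cat !inE mem_rcons !inE => /orP[->|/orP[->|->]]; by rewrite ?orbT.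
have Rt : {in R, forall x, x \notin tri}.
  move=> x xR; apply/negP=> xt; case: (s_tri (Rs x xR) xt) => [xE|xE|[_ xE]].
  - by move: aR; rewrite inE negb_or -xE xR andbF.
  - by move: yR; rewrite -xE xR.
  - by move: cR; rewrite cE -xE !inE xR !orbT.
have := pg_cycle psR; rewrite /= rcons_path => /and4P[_ _ pR _].
have wE z : last z R = last b0 be1 by rewrite /R last_cat.
set w := last b0 be1 in wE.
have wR : w \in R by rewrite /R mem_cat mem_last orbT.
have stw : straight w c'.
  by have := sbe; rewrite beE /= rcons_path => /andP[].
have ew : edge w = v 10.
  have := stw; rewrite /straight => /eqP /(canLR (acrossK DP)) <-.
  by rewrite /across cE cr_v // opp_v.
have tw' : @adj E w a.
  apply/orP; right; rewrite /turn edge_out' ?Rt // ew out_v //.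
  change (@crossing D a && (@node D a == v (out_in 10))).
  by rewrite -[a]/(v 0) cr_v // node_v // eqxx.
have cyc : cycle (@adj E) (a :: R).
  by rewrite [cycle _ _]/= rcons_path path_adj // wE.
have sub x : x \in a :: R -> x \in s.
  rewrite inE => /orP[/eqP->|/Rs //]; exact: as_.
have mem_s' x : (x \in a :: R) = (x \in s) && (x != y) && (x != c').
  apply/idP/idP => [xR|/andP[/andP[xs xy] xc]].
    rewrite sub //=; apply/andP; split.
      apply: contraTneq xR => ->; rewrite inE negb_or yR andbT.
      by move: aR; rewrite inE negb_or eq_sym => /andP[].
    apply: contraTneq xR => ->; move: cR; rewrite !inE !negb_or.
    by case/and3P=> -> _ ->.
  move: xs; rewrite /s beE E1 /R !(mem_cat, inE, mem_rcons) (negPf xy) (negPf xc) /=.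
  by rewrite !orbA.
have [h1 h2] : (forall x, ~~ side x -> (out x \in a :: R) = (x \in s)) /\
    (forall k, k \in [:: 2; 7; 6; 11; 10; 3] -> (v k \in a :: R) = t && (k == 7)).
  apply: out_mem => [x xt|k k12].
    rewrite mem_s'; have -> : x != y.
      by apply: contraNneq xt => ->; rewrite yE; exact: tri_s_v.
    have -> : x != c' by apply: contraNneq xt => ->; rewrite cE; exact: tri_s_v.
    by rewrite !andbT.
  rewrite mem_s' yE cE !vE // sE // /col tF; move: k12; cases12 k.
have us' : uniq (a :: R).
  by rewrite cons_uniq uR andbT; move: aR; rewrite inE negb_or => /andP[].
have [pE lt] := flip_polygon cyc us' h1 h2.
exists (a :: al2), (b0 :: be1); split=> //; split=> //.
  have := sal; rewrite E1 /= => /andP[_ p2].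
  by apply: path_straight_a => // x xa; apply: Rt; rewrite /R mem_cat xa.
have := sbe; rewrite beE /= rcons_path => /andP[p2 _].
by apply: path_straight => // x xa; apply: Rt; rewrite /R mem_cat xa orbT.
Qed.

End FlipLens.

Lemma lens_exists (D : tgraph) : is_diagram D -> clean D -> untied D ->
  exists chi al be, @lens D chi al be.
Proof.
move=> DP cD uD; have /card_gt0P[x0 _] := td_nonempty DP.
have [chi [cc cb cv]] := strand_colouring DP uD x0.
have cyc : fcycle step (orbit step x0) by apply/cycle_orbit/step_inj.
exists chi, (orbit step x0), [::]; split=> //; rewrite ?cats0.
- split=> //.
  + by move=> x cx c0 c2; rewrite cv // c0 c2.
  + by apply: sub_cycle cyc => a b /eqP <-; rewrite /adj /straight eqxx.
- rewrite /orbit; case: (order _ _) => //= n; apply: sub_path (fpath_traject _ _ _) => a b.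
  by rewrite /straight eq_sym.
- by rewrite -size_eq0 size_orbit -lt0n order_gt0.
Qed.

Lemma crossing_darts_smooth (D : tgraph) (d : dart D) : is_diagram D -> crossing d ->
  crossing_darts (smooth d) < crossing_darts D.
Proof.
move=> DP cd; apply: proper_card; apply/properP; split.
  by apply/subsetP=> x; rewrite !inE smooth_crossing // => /andP[].
by exists d; rewrite !inE ?smooth_crossing // vertex_refl andbF.
Qed.

Lemma crossing_darts_remove_bigon (D : tgraph) (a b : dart D) : is_diagram D -> bigon a b ->
  crossing_darts (remove_bigon a b) < crossing_darts D.
Proof.
move=> DP ab; apply: proper_card; apply/properP; split.
  by apply/subsetP=> x; rewrite !inE bigon_crossing // => /andP[].
have ca : crossing a by case: ab => /andP[].
by exists a; rewrite !inE ?bigon_crossing // vertex_refl andbF.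
Qed.

Lemma flippable_switch (D : tgraph) (d : dart D) chi al1 a y al2 be b c :
  @flippable D chi al1 a y al2 be b c -> @flippable (switch d) chi al1 a y al2 be b c.
Proof. by case=> tf [? ? ? ? ?] *; split=> //; split. Qed.

(** * Induction on diagrams *)

Section DiagramInd.
Variable P : diagram -> Prop.
Hypothesis P_subdivide : forall (D E : diagram) (d : dart E), isom D (subdivide d) -> P E -> P D.
Hypothesis P_circle : forall D : diagram, isom D circle -> P D.
Hypothesis P_add_circle : forall (D E : diagram) (d : dart E) (t : option (dart E)),
  isom D (add_circle d t) -> P E -> P D.
Hypothesis P_skein : forall (D DA DB : diagram) (d : dart D),
  crossing d -> over d -> tie d (node d) ->
  isom DA (A_smoothing d) -> isom DB (B_smoothing d) -> P DA -> P DB -> P D.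
Hypothesis P_switch : forall (D D' De Df : diagram) (d : dart D),
  crossing d -> isom D' (switch d) -> isom De (smooth d) -> isom Df (smooth (node d)) ->
  P D' -> P De -> P Df -> P D.
Hypothesis P_R2 : forall (D E : diagram) (a b : dart D),
  bigon a b -> isom E (remove_bigon a b) -> P E -> P D.
Hypothesis P_R3 : forall (D E : diagram) (a b c : dart D),
  triangle a b c -> isom E (flip_triangle a b c) -> P E -> P D.

Section Step.
Variable n : nat.
Hypothesis IHn : forall D : diagram, crossing_darts D < n -> P D.

Lemma ind_tied (D : diagram) (d : dart D) : crossing_darts D <= n ->
  crossing d -> tie d (node d) -> P D.
Proof.
have DP := dgmP D; move=> Dn.
have key (e : dart D) : crossing e -> over e -> tie e (node e) -> P D.
  move=> ce oe te; have cne : crossing (node e) by rewrite crossing_node.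
  pose DA := Diagram (smooth_diagram DP cne); pose DB := Diagram (smooth_diagram DP ce).
  apply: (P_skein (DA := DA) (DB := DB) ce oe te); try exact: isom_refl.
    by apply/IHn/(leq_trans _ Dn)/crossing_darts_smooth.
  by apply/IHn/(leq_trans _ Dn)/crossing_darts_smooth.
move=> cd td; have [od|nod] := boolP (over d); first exact: key td.
apply: (key (node d)); rewrite ?crossing_node //; first by rewrite (td_over DP).
by apply: (tie_trans DP _ (tie_opp DP cd)); rewrite tie_sym.
Qed.

Lemma ind_switch (D : diagram) (d : dart D) : crossing_darts D <= n -> crossing d ->
  P (Diagram (switch_diagram d (dgmP D))) -> P D.
Proof.
have DP := dgmP D; move=> Dn cd PS.
have cnd : crossing (node d) by rewrite crossing_node.
apply: (P_switch (De := Diagram (smooth_diagram DP cd)) (Df := Diagram (smooth_diagram DP cnd))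
  cd _ _ _ PS); try exact: isom_refl.
  by apply/IHn/(leq_trans _ Dn)/crossing_darts_smooth.
by apply/IHn/(leq_trans _ Dn)/crossing_darts_smooth.
Qed.

(** [Phi] stands for a configuration of the plane graph, insensitive to switches. Moves II and III
    need the side [a] over at both ends; at most two switches achieve this, each at the cost of
    diagrams with fewer crossings. *)
Lemma ind_over (Phi : forall G : diagram, dart G -> dart G -> Prop) :
  (forall (G : diagram) (a e : dart G), Phi G a e ->
     [/\ crossing_darts G <= n, crossing a, crossing e & ~~ same_vertex a e]) ->
  (forall (G : diagram) (a e d : dart G), Phi G a e ->
     Phi (Diagram (switch_diagram d (dgmP G))) a e) ->
  (forall (G : diagram) (a e : dart G), Phi G a e -> over a -> over e -> P G) ->
  forall (G : diagram) (a e : dart G), Phi G a e -> P G.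
Proof.
move=> Phi0 PhiS PhiP.
have step1 (G : diagram) (a e : dart G) : Phi G a e -> over a -> P G.
  move=> ph oa; have [Gn ca ce nae] := Phi0 _ _ _ ph.
  have [oe|noe] := boolP (over e); first exact: PhiP ph oa oe.
  apply: (ind_switch (d := e)) => //; apply: (PhiP _ _ _ (PhiS _ _ _ e ph)) => /=.
    rewrite oa /same_vertex fconnect_sym -/(same_vertex a e); last exact: node_inj (dgmP G).
    by rewrite (negPf nae).
  by rewrite (negPf noe) /same_vertex connect0.
move=> G a e ph; have [Gn ca ce nae] := Phi0 _ _ _ ph.
have [oa|noa] := boolP (over a); first exact: step1 ph oa.
apply: (ind_switch (d := a)) => //; apply: (step1 _ _ _ (PhiS _ _ _ a ph)) => /=.
by rewrite (negPf noa) /same_vertex connect0.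
Qed.

Lemma ind_bigon (D : diagram) (a b : dart D) : crossing_darts D <= n -> bigon_face a b -> P D.
Proof.
move=> Dn ab; apply: (@ind_over (fun G a e => crossing_darts G <= n /\
  exists2 b, bigon_face a b & e = edge a) _ _ _ D a (edge a)); last by split=> //; exists b.
- move=> G a1 e [Gn [b1 [/andP[ca cb] nab [ea eb] ra] ->]]; split=> //.
    by rewrite ea (crossing_node (dgmP G)).
  by rewrite ea same_vertexE ?vertex_node -?same_vertexE //; exact: dgmP.
- by move=> G a1 e d [Gn [b1 ab' eE]]; split=> //; exists b1.
- move=> G a1 e [Gn [b1 [cab nab eab ra] ->]] oa oe.
  have big : bigon a1 b1 by split=> //; rewrite oa.
  apply: (P_R2 (E := Diagram (remove_bigon_diagram (dgmP G) big)) big (isom_refl _)).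
  by apply/IHn/(leq_trans _ Gn)/crossing_darts_remove_bigon => //; exact: dgmP.
Qed.

Section DartStep.
Variable m : nat.
Hypothesis IHm : forall D : diagram, crossing_darts D <= n -> #|dart D| < m -> P D.

Lemma ind_clean (D : diagram) : crossing_darts D <= n -> #|dart D| <= m -> ~ clean D -> P D.
Proof.
move=> Dn Dm ncl; have [x ncx ex] : exists2 x : dart D, ~~ crossing x & edge x != node x.
  apply: NNPP => no; apply: ncl => x ncx; apply/eqP/negPn/negP=> ex.
  by case: no; exists x.
have [F [d [iso [lt le]]]] := unsubdivide (dgmP D) ncx ex.
by apply: P_subdivide iso _; apply: IHm; [exact: leq_trans Dn | exact: leq_trans Dm].
Qed.

Lemma ind_circle (D : diagram) (x : dart D) : crossing_darts D <= n -> #|dart D| <= m ->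
  ~~ crossing x -> edge x = node x -> (forall z, region x z -> z = x) -> P D.
Proof.
move=> Dn Dm ncx ex rx.
case: (unadd_circle (dgmP D) ncx ex rx) => [|[F [d [t [iso [lt le]]]]]]; first exact: P_circle.
by apply: P_add_circle iso _; apply: IHm; [exact: leq_trans Dn | exact: leq_trans Dm].
Qed.

(** Either D has a smaller lens, or this one is minimal. In the latter case a triangle move, after
    switches that do not affect lenses, produces a smaller lens in another diagram with the same
    number of darts; hence the quantification over D inside the induction on area. *)
Lemma ind_lens k (D : diagram) (chi : dart D -> bool) al be : crossing_darts D <= n -> #|dart D| <= m ->
  clean D -> untied D -> lens chi al be -> area chi < k -> P D.
Proof.
elim: k D chi al be => // k IHk D chi al be Dn Dm cD uD lp lt_k.
have [[chi1 [al' [be' [lp1 lt1]]]]|no] :=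
  classic (exists chi1 al' be', @lens D chi1 al' be' /\ @area D chi1 < @area D chi).
  by apply: (IHk D chi1 al' be') => //; apply: leq_trans lt1 _.
have minm : min_area D (@area D chi).
  move=> chi1 al' be' lp1; rewrite leqNgt; apply/negP=> lt1; apply: no.
  by exists chi1, al', be'.
case: (minimal_lens (dgmP D) cD uD lp minm erefl) => [[x [ncx ex rx]]|[a [b ab]]|].
- exact: ind_circle ex rx.
- exact: ind_bigon ab.
case=> chi' [al1 [a [y [al2 [be' [b [c [fl ar]]]]]]]].
apply: (@ind_over (fun G a e => [/\ crossing_darts G <= n, #|dart G| <= m, clean G, untied G &
  exists (chi' : dart G -> bool) al1 y al2 be' b c,
    [/\ flippable chi' al1 a y al2 be' b c, area chi' < k.+1 & e = edge a]])
  _ _ _ D a (edge a)); last first.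
  by split=> //; exists chi', al1, y, al2, be', b, c; split=> //; rewrite ar.
- move=> G a1 e [Gn Gm cG uG [ch [l1 [y1 [l2 [b' [b1 [c1 [fl1 ar1 ->]]]]]]]]] oa oe.
  have tri : triangle a1 b1 c1 by case: (fl_triangle fl1) => ? ? ? ?; split=> //; rewrite oa.
  have [al3 [be3 [lp3 lt3]]] := flip_lens (dgmP G) fl1 tri.
  pose E := Diagram (flip_triangle_diagram (dgmP G) tri).
  apply: (P_R3 (E := E) tri (isom_refl _)).
  apply: (IHk E _ al3 be3 _ _ _ _ lp3) => //.
  + exact: (flip_clean (dgmP G) cG tri).
  + exact: leq_trans lt3 _.
- move=> G a1 e d [Gn Gm cG uG [ch [l1 [y1 [l2 [b' [b1 [c1 [fl1 ar1 ->]]]]]]]]].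
  split=> //; exists ch, l1, y1, l2, b', b1, c1; split=> //.
  exact: flippable_switch.
move=> G a1 e [Gn Gm cG uG [ch [l1 [y1 [l2 [b' [b1 [c1 [fl1 ar1 ->]]]]]]]]].
have [/and3P[ca cb cc] /and3P[nab _ _] [ea _ _] _] := fl_triangle fl1.
split=> //; first by rewrite ea (crossing_node (dgmP G)).
by rewrite ea same_vertexE ?vertex_node -?same_vertexE //; exact: dgmP.
Qed.

End DartStep.

Lemma ind_darts m (D : diagram) : crossing_darts D <= n -> #|dart D| < m -> P D.
Proof.
elim: m D => // m IHm D Dn; rewrite ltnS => Dm.
have [cD|] := classic (clean D); last exact: (ind_clean IHm).
have [uD|nuD] := classic (untied D); last first.
  apply: NNPP => nP; apply: nuD => x cx; apply/negP=> tx; apply: nP.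
  exact: ind_tied tx.
have [chi [al [be lp]]] := lens_exists (dgmP D) cD uD.
exact: (ind_lens IHm Dn Dm cD uD lp (ltnSn _)).
Qed.

End Step.

(** The measure is lexicographic: number of crossing darts, number of darts, area of a lens. The
    principle is used for two predicates: agreement of two brackets, and existence of a Laurent
    polynomial with prescribed values. *)
Theorem diagram_ind_moves (D : diagram) : P D.
Proof.
have [n] := ubnP (crossing_darts D); elim: n D => // n IH D; rewrite ltnS => Dn.
exact: (ind_darts IH Dn (ltnSn _)).
Qed.

End DiagramInd.

Local Open Scope ring_scope.

(** * The state sum *)

Section VertexProduct.
Variable R : comPzRingType.

(* One factor for each orbit of f; w is meant to be f-invariant. *)
Definition vertex_prod (T : finType) (f : T -> T) (Q : pred T) (w : T -> R) :=
  \prod_(x | froots f x && Q x) w x.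

Variables (T : finType) (f : T -> T).
Hypothesis f_inj : injective f.
Implicit Types (Q : pred T) (w : T -> R).

Lemma invariant_fconnect (A : Type) (w : T -> A) x y :
  (forall z, w (f z) = w z) -> fconnect f x y -> w y = w x.
Proof. by move=> wf /iter_findex <-; elim: (findex _ _ _) => //= k <-. Qed.

Lemma vertex_prod_extract Q w x :
  (forall z, Q (f z) = Q z) -> (forall z, w (f z) = w z) -> Q x ->
  vertex_prod f Q w = w x * vertex_prod f (fun y => Q y && ~~ fconnect f x y) w.
Proof.
move=> Qf wf Qx; have sf := fconnect_sym f_inj.
have xr : fconnect f x (froot f x) by apply: connect_root.
rewrite /vertex_prod (bigD1 (froot f x)) /=; last first.
  by rewrite roots_root //= (invariant_fconnect Qf xr).
rewrite (invariant_fconnect wf xr); congr (_ * _); apply: eq_bigl => y.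
rewrite -!andbA; case: (boolP (froots f y)) => //= ry; congr (_ && ~~ _).
apply/eqP/idP => [->//|xy]; rewrite -(eqP ry).
by apply/esym/(fingraph.rootP sf).
Qed.

(** [f] and [g] may differ outside [Q], as [node] does when a move changes a few vertices; since [Q]
    is closed under [f], the orbits inside it are the same. *)
Lemma eq_vertex_prod (g : T -> T) Q Q' w w' :
  Q =1 Q' -> (forall z, Q (f z) = Q z) -> (forall z, Q z -> f z = g z) ->
  (forall z, Q z -> w z = w' z) -> vertex_prod f Q w = vertex_prod g Q' w'.
Proof.
move=> QQ Qf fg ww; apply: eq_big => [y|y /andP[_ /ww //]]; rewrite -QQ.
case: (boolP (Q y)) => Qy; rewrite ?andbF // !andbT.
have it k : iter k f y = iter k g y /\ Q (iter k f y).
  by elim: k => //= k [<- Qk]; rewrite Qf fg.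
rewrite /roots /fingraph.root; congr (odflt y _ == y).
apply: eq_pick => z; apply/idP/idP => /iter_findex <-.
  by rewrite (it _).1 fconnect_iter.
by rewrite -(it _).1 fconnect_iter.
Qed.

End VertexProduct.

Lemma vertex_prod_onto (R : comPzRingType) (S T : finType) (f : S -> S) (g : T -> T)
    (h : S -> T) (h' : T -> S) (Q : pred T) (w : S -> R) (w' : T -> R) :
  injective f -> injective g -> cancel h h' -> (forall x, Q (h x)) ->
  (forall y, Q y -> h (h' y) = y) -> (forall x, h (f x) = g (h x)) ->
  (forall z, w (f z) = w z) -> (forall x, w' (h x) = w x) ->
  vertex_prod f predT w = vertex_prod g Q w'.
Proof.
move=> fi gi hK Qh h'K hf wf wh.
have hit k x : h (iter k f x) = iter k g (h x) by elim: k => //= k <-.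
have fhg x y : fconnect f x y = fconnect g (h x) (h y).
  apply/idP/idP => /iter_findex e; first by rewrite -e hit fconnect_iter.
  by rewrite -(hK y) -e -hit hK fconnect_iter.
have sg := fconnect_sym gi; have sf := fconnect_sym fi.
(* The chosen roots of corresponding orbits need not correspond under [h], so the reindexing goes
   from root to root. *)
pose psi x := h' (froot g (h x)).
have hpsi x : h (psi x) = froot g (h x).
  rewrite /psi; have /iter_findex <- := connect_root (frel g) (h x).
  by rewrite -hit hK.
rewrite /vertex_prod (reindex_onto (fun x => h (psi x)) (fun y => froot f (h' y))) /=.
  apply: eq_big => [x|x _].
    rewrite andbT Qh andbT hpsi roots_root //= /roots; congr (_ == x).
    apply/(fingraph.rootP sf); rewrite -hpsi hK fhg hpsi; exact: connect_root.
  rewrite wh; symmetry; apply: (invariant_fconnect wf); rewrite fhg hpsi; exact: connect_root.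
move=> y /andP[ry Qy]; rewrite hpsi -[RHS](eqP ry).
apply/(fingraph.rootP sg); rewrite sg -[X in fconnect g X _](h'K _ Qy) -fhg.
exact: connect_root.
Qed.

(** * Labels of edges *)

Section Labels.
Variables (R : pzRingType) (T : finType) (M : nat) (e : T -> T).
Hypothesis eK : involutive e.

Definition edge_labelling (mu : T -> 'I_M) := [forall x, mu (e x) == mu x].

Definition relabel (mu : T -> 'I_M) x i : {ffun T -> 'I_M} :=
  [ffun z => if (z == x) || (z == e x) then i else mu z].

(** Exchanging the label of the edge of [x] with the spare label i is an involution on pairs, and it
    matches the terms of the two sides. *)
Lemma sum_relabel (F : {ffun T -> 'I_M} -> R) x :
  \sum_(mu : {ffun T -> 'I_M} | edge_labelling mu) \sum_i F (relabel mu x i) =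
  M%:R * \sum_(mu : {ffun T -> 'I_M} | edge_labelling mu) F mu.
Proof.
have -> : M%:R * \sum_(mu : {ffun T -> 'I_M} | edge_labelling mu) F mu =
    \sum_(mu : {ffun T -> 'I_M} | edge_labelling mu) \sum_(i : 'I_M) F mu.
  by rewrite mulr_sumr; apply: eq_bigr => mu _; rewrite sumr_const card_ord mulr_natl.
rewrite !pair_big_dep /=.
pose phi (p : {ffun T -> 'I_M} * 'I_M) := (relabel p.1 x p.2, p.1 x).
have ok (mu : {ffun T -> 'I_M}) i : edge_labelling mu -> edge_labelling (relabel mu x i).
  move/forallP=> h; apply/forallP=> z; rewrite !ffunE.
  have ee u v : (e u == e v) = (u == v) by apply: can_eq eK _ _.
  by rewrite ee -[X in e z == X]eK ee orbC (eqP (h z)).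
have phiK (p : {ffun T -> 'I_M} * 'I_M) : edge_labelling p.1 -> phi (phi p) = p.
  case: p => mu i /forallP h; rewrite /phi /= ffunE eqxx; congr (_, _).
  apply/ffunP=> z; rewrite !ffunE; case: ifP => [/orP[]/eqP-> //|-> //].
  by rewrite (eqP (h x)).
symmetry; rewrite (reindex_onto phi phi) /= => [|p]; last by rewrite andbT => /phiK.
apply: eq_big => [[mu i]|[mu i] //] /=; rewrite !andbT.
apply/andP/idP => [[h /eqP e1]|h]; last by rewrite ok // [X in X == _](phiK (mu, i)).
by have /(congr1 fst) /= <- := e1; apply: ok.
Qed.

End Labels.

(** * Vertex tensors and their identities *)

Section Tensors.
Variables (R : fieldType) (M : nat) (A A' : R).
Hypotheses (AA' : A * A' = 1) (MA : M%:R = - (A ^+ 2 + A' ^+ 2)).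
Implicit Types i j k x y z : 'I_M.

Definition delta x y : R := (x == y)%:R.

Lemma deltaC x y : delta x y = delta y x. Proof. by rewrite /delta eq_sym. Qed.
Lemma deltaxx x : delta x x = 1. Proof. by rewrite /delta eqxx. Qed.

Lemma sum_delta x (F : 'I_M -> R) : \sum_i delta i x * F i = F x.
Proof.
rewrite (bigD1 x) //= deltaxx mul1r big1 ?addr0 // => i /negPf ix.
by rewrite /delta ix mul0r.
Qed.

(* x0, ..., x3 are the labels counterclockwise around a vertex; [smoothings]
   with B = A, B' = A^-1 is the crossing whose overstrand carries x0 and x2. *)
Definition smoothings (B B' : R) x0 x1 x2 x3 :=
  B * (delta x1 x2 * delta x0 x3) + B' * (delta x0 x1 * delta x2 x3).
Definition passing x0 x1 x2 x3 := delta x0 x2 * delta x1 x3.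

Lemma sum_split (F G : 'I_M -> R) c d x y (H : 'I_M -> R) :
  (forall i, H i = delta i x * (c * F i) + delta i y * (d * G i)) ->
  \sum_i H i = c * F x + d * G y.
Proof.
move=> HE; rewrite (eq_bigr _ (fun i _ => HE i)) big_split /=.
by rewrite (sum_delta x (fun i => c * F i)) (sum_delta y (fun i => d * G i)).
Qed.

Lemma passing_sum C C' p q r s :
  \sum_i \sum_j (C * passing i j p q) * (C' * passing i r s j) =
  (C * C') * (delta p s * delta q r).
Proof.
transitivity (\sum_i delta i p * (C * C' * (delta i s * delta q r))).
  apply: eq_bigr => i _; rewrite -(sum_delta q (fun j => delta i p * (C * C' * (delta i s * delta j r)))).
  by apply: eq_bigr => j _; rewrite /passing (deltaC r j); ring.
by rewrite sum_delta.
Qed.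

(** Of the four pairs of smoothings, one gives the right-hand side with coefficient A A' = 1. The
    other three, one of which closes a loop, give another pairing, with total coefficient A^2 + A'^2
    + A A' M = 0. *)
Lemma R2_smoothings p q r s :
  \sum_i \sum_j smoothings A A' i j p q * smoothings A A' i r s j =
  delta p s * delta q r.
Proof.
transitivity (\sum_i (A * (delta i q * smoothings A A' i r s p) +
                      A' * (delta p q * smoothings A A' i r s i))).
  apply: eq_bigr => i _; apply: (sum_split (x := p) (y := i)
    (F := fun j => delta i q * smoothings A A' i r s j) (G := fun j => delta p q * smoothings A A' i r s j)) => j.
  by rewrite /smoothings (deltaC i j); ring.
rewrite big_split /= -!mulr_sumr (sum_delta q (fun i => smoothings A A' i r s p)).
have -> : \sum_i smoothings A A' i r s i = A * (M%:R * delta r s) + A' * delta r s.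
  rewrite /smoothings big_split /= -!mulr_sumr; congr (_ * _ + _ * _).
    rewrite (eq_bigr (fun=> 1)) => [|i _]; last by rewrite deltaxx.
    by rewrite sumr_const card_ord mulrC.
  by rewrite (sum_delta r (fun i => delta s i)) deltaC.
rewrite MA /smoothings (deltaC s p) (deltaC q p).
have -> : A * (A * (delta r s * delta p q) + A' * (delta q r * delta p s)) +
    A' * (delta p q * (A * (- (A ^+ 2 + A' ^+ 2) * delta r s) + A' * delta r s)) =
    delta p s * delta q r * (A * A') +
    delta r s * delta p q * (A ^+ 2 + A' ^+ 2 - (A * A') * (A ^+ 2 + A' ^+ 2)) by ring.
by rewrite AA'; ring.
Qed.

Definition half_turn (W : 'I_M -> 'I_M -> 'I_M -> 'I_M -> R) :=
  forall x0 x1 x2 x3, W x2 x3 x0 x1 = W x0 x1 x2 x3.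

Lemma half_turn_smoothings B B' : half_turn (smoothings B B').
Proof.
move=> x0 x1 x2 x3; rewrite /smoothings.
by rewrite (deltaC x3 x0) (deltaC x2 x1) (deltaC x2 x3); ring.
Qed.

Lemma half_turn_passing C : half_turn (fun x0 x1 x2 x3 => C * passing x0 x1 x2 x3).
Proof. by move=> x0 x1 x2 x3; rewrite /passing (deltaC x2) (deltaC x3). Qed.

(* Expanding the crossing of the two lower strands, one smoothing makes both sides
   equal term by term, and the other one reduces them to move II. *)
Lemma R3_smoothings W Wa Wb (C Ca Cb B B' : R) oa oea ob oeb oc oec :
  half_turn W ->
  (forall p q r s, \sum_i \sum_j W i j p q * W i r s j = C * (delta p s * delta q r)) ->
  (forall x y z t, Wa x y z t = Ca * W x y z t) ->
  (forall x y z t, Wb x y z t = Cb * W x y z t) ->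
  \sum_i \sum_j \sum_k Wa i k oa oec * Wb i ob oea j * smoothings B B' k j oc oeb =
  \sum_i \sum_j \sum_k Wa oea oc i k * Wb oa j i oeb * smoothings B B' oec ob k j.
Proof.
move=> hW R2 Wa_W Wb_W.
transitivity (B * (\sum_i Wa i oeb oa oec * Wb i ob oea oc) +
              B' * delta oc oeb * (\sum_i \sum_j Wa i j oa oec * Wb i ob oea j)).
  rewrite !mulr_sumr -big_split /=; apply: eq_bigr => i _.
  transitivity (\sum_j (delta j oc * (B * (Wa i oeb oa oec * Wb i ob oea j)) +
                        B' * delta oc oeb * (Wa i j oa oec * Wb i ob oea j))).
    apply: eq_bigr => j _.
    rewrite (sum_split (c := delta j oc * B) (d := B' * delta oc oeb) (x := oeb) (y := j)
      (F := fun k => Wa i k oa oec * Wb i ob oea j) (G := fun k => Wa i k oa oec * Wb i ob oea j)).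
      by ring.
    by move=> k; rewrite /smoothings; ring.
  rewrite big_split /= -mulr_sumr; congr (_ + _).
  by rewrite (sum_delta oc (fun j => B * (Wa i oeb oa oec * Wb i ob oea j))).
transitivity (B * (\sum_i Wa oea oc i ob * Wb oa oec i oeb) +
              B' * delta oec ob * (\sum_i \sum_j Wa oea oc i j * Wb oa j i oeb)); last first.
  rewrite !mulr_sumr -big_split /=; apply: eq_bigr => i _.
  transitivity (\sum_j (delta j oec * (B * (Wa oea oc i ob * Wb oa j i oeb)) +
                        B' * delta oec ob * (Wa oea oc i j * Wb oa j i oeb))).
    rewrite big_split /= -mulr_sumr; congr (_ + _).
    by rewrite (sum_delta oec (fun j => B * (Wa oea oc i ob * Wb oa j i oeb))).
  apply: eq_bigr => j _; symmetry.
  rewrite (sum_split (c := delta j oec * B) (d := B' * delta oec ob) (x := ob) (y := j)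
      (F := fun k => Wa oea oc i k * Wb oa j i oeb) (G := fun k => Wa oea oc i k * Wb oa j i oeb)).
    by ring.
  by move=> k; rewrite /smoothings (deltaC ob k) (deltaC oec j); ring.
congr (_ * _ + _); first by apply: eq_bigr => i _; rewrite !Wa_W !Wb_W -!(hW i); ring.
have sum_ab p q r s :
    \sum_i \sum_j Wa i j p q * Wb i r s j = Ca * Cb * C * (delta p s * delta q r).
  rewrite -mulrA -R2 mulr_sumr; apply: eq_bigr => i _; rewrite mulr_sumr.
  by apply: eq_bigr => j _; rewrite Wa_W Wb_W; ring.
rewrite sum_ab.
have -> : \sum_i \sum_j Wa oea oc i j * Wb oa j i oeb =
    Ca * Cb * C * (delta oea oa * delta oc oeb).
  rewrite -sum_ab; apply: eq_bigr => i _; apply: eq_bigr => j _.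
  by rewrite !Wa_W !Wb_W -hW -[W oa _ _ _]hW.
by rewrite (deltaC oa); ring.
Qed.

(** The strand common to the first and the third vertex passes freely through both, so it can be
    moved across the second vertex, whatever stands there. In [R3_passing_r] the free strand is the
    one common to the second and the third vertex. *)
Lemma R3_passing_l C C' Wb oa oea ob oeb oc oec :
  \sum_i \sum_j \sum_k (C * passing i k oa oec) * Wb i ob oea j * (C' * passing k j oc oeb) =
  \sum_i \sum_j \sum_k (C * passing oea oc i k) * Wb oa j i oeb * (C' * passing oec ob k j).
Proof.
transitivity (C * C' * (delta oc oec * Wb oa ob oea oeb)).
  rewrite -(sum_delta oa (fun i => C * C' * (delta oc oec * Wb i ob oea oeb))).
  apply: eq_bigr => i _.
  transitivity (\sum_j delta j oeb * (delta i oa * (C * C' * (delta oc oec * Wb i ob oea j)))).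
    apply: eq_bigr => j _.
    rewrite -(sum_delta oc (fun k => delta j oeb * (delta i oa * (C * C' * (delta k oec * Wb i ob oea j))))).
    by apply: eq_bigr => k _; rewrite /passing; ring.
  by rewrite sum_delta.
rewrite -(sum_delta oea (fun i => C * C' * (delta oc oec * Wb oa ob i oeb))).
apply: eq_bigr => i _; symmetry.
transitivity (\sum_j delta j ob * (delta i oea * (C * C' * (delta oc oec * Wb oa j i oeb)))).
  apply: eq_bigr => j _.
  rewrite -(sum_delta oec (fun k => delta j ob * (delta i oea * (C * C' * (delta oc k * Wb oa j i oeb))))).
  by apply: eq_bigr => k _; rewrite /passing (deltaC oea) (deltaC oec) (deltaC ob); ring.
by rewrite sum_delta.
Qed.

Lemma R3_passing_r C C' Wa oa oea ob oeb oc oec :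
  \sum_i \sum_j \sum_k Wa i k oa oec * (C * passing i ob oea j) * (C' * passing k j oc oeb) =
  \sum_i \sum_j \sum_k Wa oea oc i k * (C * passing oa j i oeb) * (C' * passing oec ob k j).
Proof.
transitivity (C * C' * (delta ob oeb * Wa oea oc oa oec)).
  rewrite -(sum_delta oea (fun i => C * C' * (delta ob oeb * Wa i oc oa oec))).
  apply: eq_bigr => i _.
  transitivity (\sum_j delta j oeb * (delta i oea * (C * C' * (delta ob j * Wa i oc oa oec)))).
    apply: eq_bigr => j _.
    rewrite -(sum_delta oc (fun k => delta j oeb * (delta i oea * (C * C' * (delta ob j * Wa i k oa oec))))).
    by apply: eq_bigr => k _; rewrite /passing; ring.
  by rewrite sum_delta.
rewrite -(sum_delta oa (fun i => C * C' * (delta ob oeb * Wa oea oc i oec))).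
apply: eq_bigr => i _; symmetry.
transitivity (\sum_j delta j ob * (delta i oa * (C * C' * (delta j oeb * Wa oea oc i oec)))).
  apply: eq_bigr => j _.
  rewrite -(sum_delta oec (fun k => delta j ob * (delta i oa * (C * C' * (delta j oeb * Wa oea oc i k))))).
  by apply: eq_bigr => k _; rewrite /passing (deltaC oa) (deltaC oec) (deltaC ob); ring.
by rewrite sum_delta.
Qed.
Variable N : nat.
Implicit Types p q r : 'I_N.

(** [p] is the colour of the overstrand. The sign is antisymmetric in the colours, hence reversed by
    a switch; as it depends only on the two colours and on which strand is over, it is the same at
    both vertices of a removable bigon and is unchanged by a triangle move. *)
Definition tensor p q x0 x1 x2 x3 : R :=
  if p == q then smoothings A A' x0 x1 x2 x3
  else (if (p < q)%N then -1 else 1) * passing x0 x1 x2 x3.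

Lemma tensor_eq p q x0 x1 x2 x3 : p = q -> tensor p q x0 x1 x2 x3 = smoothings A A' x0 x1 x2 x3.
Proof. by rewrite /tensor => ->; rewrite eqxx. Qed.

Lemma tensor_neq p q x0 x1 x2 x3 : p != q ->
  tensor p q x0 x1 x2 x3 = (if (p < q)%N then -1 else 1) * passing x0 x1 x2 x3.
Proof. by rewrite /tensor => /negPf->. Qed.

Lemma half_turn_tensor p q : half_turn (tensor p q).
Proof.
move=> x0 x1 x2 x3; have [->|pq] := eqVneq p q.
  by rewrite !tensor_eq // half_turn_smoothings.
by rewrite !tensor_neq // half_turn_passing.
Qed.

Lemma tensor_switch p q x0 x1 x2 x3 :
  tensor p q x0 x1 x2 x3 + tensor q p x1 x2 x3 x0 =
  if p == q then (A + A') * (delta x0 x1 * delta x2 x3 + delta x1 x2 * delta x3 x0) else 0.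
Proof.
have [->|pq] := eqVneq p q.
  by rewrite !tensor_eq // /smoothings (deltaC x1 x0) (deltaC x0 x3); ring.
have qp : q != p by rewrite eq_sym.
rewrite (tensor_neq _ _ _ _ pq) (tensor_neq _ _ _ _ qp) /passing (deltaC x2 x0).
by case: ltngtP pq => [_ _|_ _|/val_inj ->]; rewrite ?eqxx //; ring.
Qed.

Lemma R2_tensor (u v : 'I_N) (p q r s : 'I_M) :
  \sum_i \sum_j tensor u v i j p q * tensor u v i r s j =
  \sum_i \sum_j (delta i p * delta j q) * (delta j r * delta i s).
Proof.
have -> : \sum_i \sum_j (delta i p * delta j q) * (delta j r * delta i s) = delta p s * delta q r.
  rewrite -[RHS]mul1r -[1 in RHS]mulr1 -passing_sum.
  by apply: eq_bigr => i _; apply: eq_bigr => j _; rewrite /passing (deltaC r j); ring.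
have [->|uv] := eqVneq u v.
  by rewrite -R2_smoothings; apply: eq_bigr => i _; apply: eq_bigr => j _; rewrite !tensor_eq.
under eq_bigr => i _ do under eq_bigr => j _ do rewrite !tensor_neq //.
by rewrite passing_sum; case: ifP => _; ring.
Qed.

(** [u] is the colour of the top strand, [v] and [w] those of the lower ones. If w = v, the lower
    crossing is expanded into smoothings. Otherwise the lower strands pass freely through each other
    and [u] differs from one of their colours, so one of the lower strands passes freely through
    both of its crossings. *)
Lemma R3_tensor (u v w : 'I_N) Wc oa oea ob oeb oc oec :
  (w = v -> exists B B', forall x y z t, Wc x y z t = smoothings B B' x y z t) ->
  (w != v -> exists C, forall x y z t, Wc x y z t = C * passing x y z t) ->
  \sum_i \sum_j \sum_k tensor u w i k oa oec * tensor u v i ob oea j * Wc k j oc oeb =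
  \sum_i \sum_j \sum_k tensor u w oea oc i k * tensor u v oa j i oeb * Wc oec ob k j.
Proof.
have [->|wv] := eqVneq w v; move=> Wc1 Wc2; last first.
  have {Wc1 Wc2}[C WC] := Wc2 isT.
  under eq_bigr => i _ do under eq_bigr => j _ do under eq_bigr => k _ do rewrite WC.
  under [RHS]eq_bigr => i _ do under eq_bigr => j _ do under eq_bigr => k _ do rewrite WC.
  have [uw|uw] := eqVneq u w.
    have uv : u != v by rewrite uw.
    under eq_bigr => i _ do under eq_bigr => j _ do under eq_bigr => k _ do
      rewrite (tensor_neq _ _ _ _ uv).
    under [RHS]eq_bigr => i _ do under eq_bigr => j _ do under eq_bigr => k _ do
      rewrite (tensor_neq _ _ _ _ uv).
    exact: R3_passing_r.
  under eq_bigr => i _ do under eq_bigr => j _ do under eq_bigr => k _ do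
    rewrite (tensor_neq _ _ _ _ uw).
  under [RHS]eq_bigr => i _ do under eq_bigr => j _ do under eq_bigr => k _ do
    rewrite (tensor_neq _ _ _ _ uw).
  exact: R3_passing_l.
have {Wc1 Wc2}[B [B' WB]] := Wc1 erefl.
under eq_bigr => i _ do under eq_bigr => j _ do under eq_bigr => k _ do rewrite WB.
under [RHS]eq_bigr => i _ do under eq_bigr => j _ do under eq_bigr => k _ do rewrite WB.
have [uv|uv] := eqVneq u v.
  apply: (R3_smoothings (W := smoothings A A') (C := 1) (Ca := 1) (Cb := 1)).
  - exact: half_turn_smoothings.
  - by move=> p q r s; rewrite R2_smoothings mul1r.
  - by move=> x y z t; rewrite mul1r tensor_eq.
  - by move=> x y z t; rewrite mul1r tensor_eq.
apply: (R3_smoothings (W := fun x y z t => 1 * passing x y z t) (C := 1 * 1)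
  (Ca := if (u < v)%N then -1 else 1) (Cb := if (u < v)%N then -1 else 1)).
- exact: half_turn_passing.
- by move=> p q r s; rewrite passing_sum.
- by move=> x y z t; rewrite mul1r tensor_neq.
- by move=> x y z t; rewrite mul1r tensor_neq.
Qed.

End Tensors.

Section FfunSums.
Variables (R : nmodType) (S T X : finType).

Lemma sum_ffun_onto (h : S -> T) (h' : T -> S) (P : pred {ffun T -> X})
    (F : {ffun T -> X} -> R) :
  cancel h h' -> (forall m : {ffun T -> X}, P m -> forall y, m (h (h' y)) = m y) ->
  \sum_(m | P m) F m =
  \sum_(n : {ffun S -> X} | P [ffun y => n (h' y)]) F [ffun y => n (h' y)].
Proof.
move=> hK Ph.
rewrite (reindex_onto (fun n : {ffun S -> X} => [ffun y => n (h' y)])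
  (fun m => [ffun x => m (h x)])) => [|m Pm]; last first.
  by apply/ffunP=> y; rewrite !ffunE Ph.
apply: eq_bigl => n; rewrite andbC; suff -> : [ffun x => [ffun y => n (h' y)] (h x)] == n by [].
by apply/eqP/ffunP=> x; rewrite !ffunE hK.
Qed.

Definition extend (n : S -> X) (c : X) : {ffun S + bool -> X} :=
  [ffun u => if u is inl x then n x else c].

Lemma sum_extend (P : pred {ffun S + bool -> X}) (F : {ffun S + bool -> X} -> R) :
  (forall m : {ffun S + bool -> X}, P m -> m (inr true) = m (inr false)) ->
  \sum_(m | P m) F m =
  \sum_(c : X) \sum_(n : {ffun S -> X} | P (extend n c)) F (extend n c).
Proof.
move=> Ptf; rewrite pair_big_dep /=.
rewrite (reindex_onto (fun p : X * {ffun S -> X} => extend p.2 p.1)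
  (fun m => (m (inr true), [ffun x => m (inl x)]))) /= => [|m Pm]; last first.
  by apply/ffunP=> -[x|[]]; rewrite !ffunE // Ptf.
apply: eq_bigl => -[c n] /=; rewrite ffunE andbC.
suff -> : [ffun x => extend n c (inl x)] = n by rewrite eqxx.
by apply/ffunP=> x; rewrite !ffunE.
Qed.

End FfunSums.

Lemma vertex_prod_sum (R : comPzRingType) (S : finType) (f : S -> S)
    (g : S + bool -> S + bool) (w : S + bool -> R) (d : S) :
  injective f -> (forall x, g (inl x) = inl (f x)) -> (forall i, g (inr i) = inr (~~ i)) ->
  (forall z, w (g z) = w z) ->
  vertex_prod g predT w = w (inr true) * vertex_prod f predT (fun x => w (inl x)).
Proof.
move=> fi gl gr wg.
have gi : injective g.
  move=> [x|i] [y|j]; rewrite ?gl ?gr // => -[]; first by move/fi->.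
  by move/negb_inj ->.
have gc y : fconnect g (inr true) y = ~~ (if y is inl _ then true else false).
  apply/idP/idP => [/iter_findex <-|].
    by elim: (findex _ _ _) => //= k; case: (iter k g _) => //= i _; rewrite gr.
  case: y => // -[] _; first exact: connect0.
  have <- : g (inr true) = inr false by rewrite gr.
  exact: fconnect1.
rewrite (vertex_prod_extract gi (x := inr true)) //; congr (_ * _); symmetry.
apply: (vertex_prod_onto (h := inl) (h' := fun u => if u is inl x then x else d)) => //.
- by move=> x; rewrite /= gc.
- by move=> [x|i] //=; rewrite gc.
- by move=> z; rewrite -gl wg.
Qed.

(** * Colourings, weights and the state sum *)

Section StateSum.
Variables (R : fieldType) (N M : nat) (A A' : R).

Section Weight.
Variable D : tgraph.
Implicit Types (k : dart D -> 'I_N) (m : dart D -> 'I_M).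

Definition tied_colouring k := [forall x, forall y, tie x y ==> (k x == k y)].

Lemma tied_colouringP k :
  reflect (forall x y, tie x y -> k x = k y) (tied_colouring k).
Proof.
apply: (iffP idP) => [/forallP kt x y xy|kt].
  by have /forallP/(_ y)/implyP/(_ xy)/eqP := kt x.
by apply/forallP=> x; apply/forallP=> y; apply/implyP=> /kt ->.
Qed.

(* Between strands of different colours, the sign changes with the crossing. *)
Definition weight k m x : R :=
  if crossing x then
    let y := if over x then x else node x in
    tensor A A' (k y) (k (node y)) (m y) (m (node y)) (m (opp y)) (m (node (opp y)))
  else delta R (m x) (m (node x)).

Lemma weight_over k m x : crossing x -> over x ->
  weight k m x =
  tensor A A' (k x) (k (node x)) (m x) (m (node x)) (m (opp x)) (m (node (opp x))).
Proof. by rewrite /weight => -> ->. Qed.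

Lemma weight_under k m x : crossing x -> ~~ over x -> weight k m x =
  tensor A A' (k (node x)) (k (opp x)) (m (node x)) (m (opp x)) (m (node (opp x)))
    (m (opp (opp x))).
Proof. by rewrite /weight => -> /negPf->. Qed.

Lemma weight_marked k m x : ~~ crossing x -> weight k m x = delta R (m x) (m (node x)).
Proof. by rewrite /weight => /negPf->. Qed.

Hypothesis DP : is_diagram D.

Lemma tied_opp k x : tied_colouring k -> crossing x -> k (opp x) = k x.
Proof. by move=> kt cx; apply/esym/(tied_colouringP _ kt)/(tie_opp DP). Qed.

(** Thanks to the half-turn symmetry of the tensors the weight belongs to the vertex, whichever of
    its darts is used; this gives a meaning to the product over vertices. *)
Lemma weight_node k m x : tied_colouring k -> weight k m (node x) = weight k m x.
Proof.
move=> kt; case: (boolP (crossing x)) => cx; last first.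
  rewrite !weight_marked ?(crossing_node DP) // deltaC.
  by rewrite [node (node x)](node2_noncrossing cx).
have nx := td_over DP cx; case: (boolP (over x)) => ox.
  rewrite [RHS]weight_over // weight_under ?(crossing_node DP) ?nx ?ox //.
  rewrite -half_turn_tensor /opp (nodeK4 DP) /opp.
  by rewrite (tied_opp kt cx) (tied_opp (x := node x) kt) // (crossing_node DP).
by rewrite [RHS]weight_under // weight_over ?(crossing_node DP) ?nx.
Qed.

Definition state_sum : R :=
  \sum_(k : {ffun dart D -> 'I_N} | tied_colouring k)
   \sum_(m : {ffun dart D -> 'I_M} | edge_labelling edge m)
    vertex_prod node predT (weight k m).

End Weight.

Lemma weight_hom (D E : tgraph) (h : dart D -> dart E) kD mD kE mE x :
  injective h -> (forall y, same_vertex x y -> h (node y) = node (h y)) ->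
  (crossing x -> over (h x) = over x) ->
  (forall y, same_vertex x y -> kE (h y) = kD y /\ mE (h y) = mD y) ->
  weight kE mE (h x) = weight kD mD x.
Proof.
move=> hi hn ho hl.
have v k : same_vertex x (iter k node x) by apply: fconnect_iter.
have hk k : iter k node (h x) = h (iter k node x) by elim: k => //= k ->; rewrite hn.
have kk k : kE (iter k node (h x)) = kD (iter k node x) by rewrite hk (hl _ (v k)).1.
have mk k : mE (iter k node (h x)) = mD (iter k node x) by rewrite hk (hl _ (v k)).2.
have cE : crossing (h x) = crossing x by rewrite /crossing [node (node _)](hk 2) (inj_eq hi).
rewrite /weight cE; case: ifP => cx; last by rewrite (mk 0%N) (mk 1%N).
rewrite ho //; case: ifP => _ /=.
  by rewrite (kk 0%N) (kk 1%N) (mk 0%N) (mk 1%N) (mk 2) (mk 3).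
by rewrite (kk 1%N) (kk 2) (mk 1%N) (mk 2) (mk 3) (mk 4).
Qed.

Lemma weight_local (D : tgraph) (k k' : dart D -> 'I_N) (m m' : dart D -> 'I_M) x :
  (forall y, same_vertex x y -> k y = k' y /\ m y = m' y) ->
  weight k m x = weight k' m' x.
Proof. by move=> hl; apply: (@weight_hom D D id). Qed.

End StateSum.

(** * Isotopy, circles and the rules at one crossing *)

Section Moves.
Variables (R : fieldType) (N M : nat) (A A' : R).

Local Notation Z D := (state_sum N M A A' D).
Local Notation wt := (weight A A').

Lemma edge_labellingP (T : finType) (e : T -> T) (m : T -> 'I_M) :
  reflect (forall x, m (e x) = m x) (edge_labelling e m).
Proof. exact: (iffP 'forall_eqP). Qed.

Lemma state_sum_isom (D E : tgraph) : is_diagram D -> isom D E -> Z E = Z D.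
Proof.
move=> DP [h [[h' hK h'K] [he hn ho _ ht]]].
have hi := can_inj hK.
have En : injective (@node E).
  move=> x y; rewrite -(h'K x) -(h'K y) -!hn => /hi /(node_inj DP) ->; exact: erefl.
rewrite /state_sum (sum_ffun_onto _ hK); last by move=> m _ y; rewrite h'K.
apply: eq_big => [k|k /tied_colouringP kt].
  apply/tied_colouringP/tied_colouringP => kt x y.
    by move=> xy; have := kt (h x) (h y); rewrite ht !ffunE !hK => ->.
  by rewrite -(h'K x) -(h'K y) ht !ffunE !hK => /kt.
have {}kt : tied_colouring k.
  by apply/tied_colouringP=> x y xy; have := kt (h x) (h y); rewrite ht !ffunE !hK => ->.
rewrite (sum_ffun_onto _ hK); last by move=> m _ y; rewrite h'K.
apply: eq_big => [m|m _].
  apply/edge_labellingP/edge_labellingP => me x.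
    by have := me (h x); rewrite -he !ffunE !hK.
  by rewrite -(h'K x) -he !ffunE !hK.
symmetry; apply: (vertex_prod_onto (h := h) (h' := h') (Q := predT)) => //.
- exact: node_inj.
- by move=> z; apply: weight_node.
- by move=> x; apply: weight_hom => [//|y _|cx|y _]; rewrite ?ffunE ?hK ?hn ?ho.
Qed.

Lemma state_sum_circle : Z circle = N%:R * M%:R.
Proof.
pose c (T : finType) (i : T) : {ffun bool -> T} := [ffun=> i].
have cst (T : finType) (f : {ffun bool -> T}) : f true = f false -> f = c T (f true).
  by move=> e; apply/ffunP=> -[]; rewrite ffunE.
have sumc (T : finType) (P : pred {ffun bool -> T}) (F : {ffun bool -> T} -> R) :
    (forall f, P f = (f true == f false)) -> \sum_(f | P f) F f = \sum_i F (c T i).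
  move=> PE; rewrite (reindex_onto (c T) (fun f => f true)) => [|f]; last first.
    by rewrite PE => /eqP/cst.
  by apply: eq_bigl => i; rewrite PE !ffunE !eqxx.
rewrite /state_sum sumc => [|f]; last first.
  apply/tied_colouringP/eqP => [e|e x y _]; first exact: (e true false).
  by rewrite (cst _ _ e) !ffunE.
rewrite (eq_bigr (fun=> M%:R)) ?sumr_const ?card_ord ?mulr_natl // => k _.
rewrite sumc => [|f]; last first.
  by apply/edge_labellingP/eqP => [/(_ false)|e []] //=; rewrite e.
rewrite (eq_bigr (fun=> 1)) ?sumr_const ?card_ord // => m _.
apply: big1 => x _; rewrite weight_marked ?ffunE ?deltaxx //.
by case: x.
Qed.

(** The circle has a free label, and also a free colour unless a tie determines it. *)
Lemma state_sum_add_circle (D : tgraph) (d : dart D) t : is_diagram D ->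
  Z (add_circle d t) = (if t is Some _ then M%:R else N%:R * M%:R) * Z D.
Proof.
move=> DP; rewrite /state_sum.
have tieE (u v : dart (add_circle d t)) : tie u v =
  orel tie (if u is inl x then Some x else t) (if v is inl x then Some x else t) by [].
have inner (k : {ffun dart D -> 'I_N}) c :
    tied_colouring (D := add_circle d t) (extend k c) -> tied_colouring k ->
    \sum_(m : {ffun dart (add_circle d t) -> 'I_M} | edge_labelling edge m)
      vertex_prod node predT (wt (D := add_circle d t) (extend k c) m) =
    M%:R * \sum_(m : {ffun dart D -> 'I_M} | edge_labelling edge m)
      vertex_prod node predT (wt k m).
  move=> kE kD; rewrite sum_extend => [|m /edge_labellingP/(_ (inr false)) //].
  rewrite -[M in M%:R]card_ord -sumr_const mulr_suml; apply: eq_bigr => c' _; rewrite mul1r.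
  apply: eq_big => [m|m _].
    apply/edge_labellingP/edge_labellingP => me x; first by have := me (inl x); rewrite !ffunE.
    by case: x => [x|i]; rewrite !ffunE /= ?me.
  have wl x : wt (D := add_circle d t) (extend k c) (extend m c') (inl x) = wt k m x.
    by apply: weight_hom => [? ? []|y _|cx|y _] //; rewrite !ffunE.
  have wr i : wt (D := add_circle d t) (extend k c) (extend m c') (inr i) = 1.
    by rewrite weight_marked ?ffunE ?deltaxx //; case: i.
  rewrite (vertex_prod_sum (f := @node D) d) //; first last.
  - by case=> [x|i]; rewrite ?wr // !wl weight_node.
  - exact: node_inj.
  rewrite wr mul1r; apply: eq_bigr => x _; exact: wl.
have tiedE (k : {ffun dart D -> 'I_N}) c :
    tied_colouring (D := add_circle d t) (extend k c) =
    tied_colouring k && (if t is Some e then k e == c else true).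
  apply/tied_colouringP/andP => [kE|[/tied_colouringP kD ce] [x|i] [y|j]]; rewrite ?tieE ?ffunE //=.
  - split; first by apply/tied_colouringP=> x y xy; have := kE (inl x) (inl y) xy; rewrite !ffunE.
    case et: t => [e|] //; have := kE (inl e) (inr true).
    by rewrite tieE et /= !ffunE (tie_refl DP) => /(_ isT) ->.
  - exact: kD.
  - by case: (t) ce => //= e /eqP <- /kD.
  - by case: (t) ce => //= e /eqP <- /kD.
rewrite sum_extend => [|k /tied_colouringP kE]; last first.
  by apply: kE; rewrite tieE; case: (t) => //= e; apply: tie_refl.
transitivity (\sum_(c < N) \sum_(k : {ffun dart D -> 'I_N} |
    tied_colouring k && (if t is Some e then k e == c else true))
  M%:R * \sum_(m : {ffun dart D -> 'I_M} | edge_labelling edge m) vertex_prod node predT (wt k m)).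
  apply: eq_bigr => c _; apply: eq_big => [k|k kE]; first exact: tiedE.
  by apply: (inner _ _ kE); move: kE; rewrite tiedE => /andP[].
case: (t) => [e|].
  rewrite (exchange_big_dep (fun k : {ffun dart D -> 'I_N} => tied_colouring k)) /= => [|c k _ /andP[] //].
  rewrite mulr_sumr; apply: eq_bigr => k kt.
  by rewrite (eq_bigl (fun c => c == k e)) ?big_pred1_eq // => c; rewrite kt eq_sym.
rewrite sumr_const card_ord -[RHS]mulrA mulr_natl; congr (_ *+ _).
by rewrite mulr_sumr; apply: eq_bigl => k; rewrite andbT.
Qed.

Lemma state_sum_subdivide (D : tgraph) (d : dart D) : is_diagram D -> Z (subdivide d) = Z D.
Proof.
move=> DP.
pose p (u : dart (subdivide d)) : dart D :=
  match u with inl x => x | inr false => edge d | inr true => d end.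
have tieE u v : tie u v = tie (p u) (p v) by [].
have ed : (edge d == d) = false by apply/negbTE/(td_edge_neq DP).
have pK : cancel (inl : dart D -> dart (subdivide d)) p by [].
rewrite /state_sum (sum_ffun_onto _ pK) => [|k /tied_colouringP kt u]; last first.
  by apply: kt; rewrite tieE tie_refl.
apply: eq_big => [k|k /tied_colouringP kt].
  apply/tied_colouringP/tied_colouringP => kt x y xy; last by rewrite !ffunE; apply: kt.
  by have := kt (inl x) (inl y) xy; rewrite !ffunE.
have kD : tied_colouring k.
  by apply/tied_colouringP=> x y xy; have := kt (inl x) (inl y) xy; rewrite !ffunE.
have split_prod (m : {ffun dart (subdivide d) -> 'I_M}) :
    vertex_prod node predT (wt (D := subdivide d) [ffun u => k (p u)] m) =
    delta R (m (inr true)) (m (inr false)) * vertex_prod node predT (wt k (fun x => m (inl x))).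
  have wl x : wt (D := subdivide d) [ffun u => k (p u)] m (inl x) = wt k (fun x => m (inl x)) x.
    by apply: weight_hom => [? ? []|y _|cx|y _] //; rewrite !ffunE.
  have wr i : wt (D := subdivide d) [ffun u => k (p u)] m (inr i) = delta R (m (inr true)) (m (inr false)).
    by rewrite weight_marked; case: i => //; rewrite deltaC.
  rewrite (vertex_prod_sum (f := @node D) d) //; first last.
  - by case=> [x|i]; rewrite ?wr // !wl weight_node.
  - exact: node_inj.
  by rewrite wr; congr (_ * _); apply: eq_bigr => x _; rewrite wl.
(* The marked point contributes a delta, so only labellings that agree on the two halves of the
   subdivided edge count, and these come from D. *)
rewrite (bigID (fun m : {ffun dart (subdivide d) -> 'I_M} => m (inr true) == m (inr false))) /=.
rewrite [X in _ + X]big1 ?addr0 => [|m /andP[_ /negPf mm]]; last first.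
  by rewrite split_prod /delta mm mul0r.
rewrite (sum_ffun_onto _ pK) => [|m /andP[/edge_labellingP me /eqP mm] [x|[]] //=]; last first.
- by rewrite -me /= ed eqxx mm -me.
- by rewrite mm; apply: (me (inr false)).
apply: eq_big => [m|m /andP[_ mm]]; last first.
  rewrite split_prod /delta mm mul1r; apply: eq_bigr => x _.
  by apply: weight_local => y _; rewrite !ffunE.
rewrite !ffunE /=; apply/andP/edge_labellingP => [[/edge_labellingP me /eqP mm] x|me].
  have [->//|xd] := eqVneq x d.
  have [->|xe] := eqVneq x (edge d); first by rewrite (td_edgeK DP).
  by have := me (inl x); rewrite /= (negPf xd) (negPf xe) !ffunE.
split; last by rewrite me.
apply/edge_labellingP=> -[x|[]]; rewrite !ffunE /= ?me //.
have [->|xd] := eqVneq x d; first by rewrite /= me.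
by have [->|xe] := eqVneq x (edge d); rewrite /= me.
Qed.

Definition outer_weight (D : tgraph) (d : dart D) (k : dart D -> 'I_N) (m : dart D -> 'I_M) : R :=
  vertex_prod node (fun x => ~~ same_vertex d x) (wt k m).

Section Crossing.
Variables (D : tgraph) (d : dart D).
Hypotheses (DP : is_diagram D) (cd : crossing d).
Local Notation rest := (outer_weight d).

Lemma same_vertex_node (x y : dart D) : same_vertex x (node y) = same_vertex x y.
Proof. by rewrite !(same_vertexE DP) vertex_node. Qed.

Lemma state_sum_extract :
  Z D = \sum_(k : {ffun dart D -> 'I_N} | tied_colouring k)
         \sum_(m : {ffun dart D -> 'I_M} | edge_labelling edge m) wt k m d * rest k m.
Proof.
apply: eq_bigr => k kt; apply: eq_bigr => m _.
rewrite (vertex_prod_extract (node_inj DP) (x := d)) // => z; exact: weight_node.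
Qed.

(** Smoothing keeps darts and edges, so both sums run over labellings of D. The new tie restricts
    the colourings, and each of the two new marked points contributes a delta. *)
Lemma state_sum_smooth :
  Z (smooth d) = \sum_(k : {ffun dart D -> 'I_N} | tied_colouring k && (k d == k (node d)))
    \sum_(m : {ffun dart D -> 'I_M} | edge_labelling edge m)
      (delta R (m d) (m (node d)) * delta R (m (opp d)) (m (node (opp d)))) * rest k m.
Proof.
have SP := smooth_diagram DP cd; have Si := node_inj SP.
apply: eq_big => [k|k /tied_colouringP kS].
  apply/tied_colouringP/andP => [kt|[/tied_colouringP kt /eqP e] x y].
    split; last by apply/eqP/kt; rewrite /= /merge !(tie_refl DP) orbT.
    by apply/tied_colouringP=> x y xy; apply: kt; rewrite /= /merge xy.
  by case/or3P => [/kt//|/andP[/kt-> /kt->]|/andP[/kt-> /kt->]].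
have kt : tied_colouring (D := smooth d) k by apply/tied_colouringP.
have kD : tied_colouring (D := D) k.
  by apply/tied_colouringP=> x y xy; apply: kS; rewrite /= /merge xy.
apply: eq_bigr => m _.
have wS z : wt (D := smooth d) k m (node z) = wt (D := smooth d) k m z by apply: weight_node.
have nS (x : dart D) : x \in vertex d -> ~~ crossing (x : dart (smooth d)).
  by move=> xd; rewrite smooth_crossing // xd andbF.
have vo : opp d \in vertex d by rewrite /opp !vertex_node // vertex_refl.
have f1 x : fconnect (@node (smooth d)) d x = (x \in [:: d; node d]).
  rewrite -/(same_vertex (d : dart (smooth d)) x) (same_vertexE SP) /vertex !inE.
  by rewrite !(smooth_nodeE DP cd); do 2?case: eqP.
have f2 x : fconnect (@node (smooth d)) (opp d) x = (x \in [:: opp d; node (opp d)]).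
  rewrite -/(same_vertex (opp d : dart (smooth d)) x) (same_vertexE SP) /vertex !inE /opp.
  by rewrite !(smooth_nodeE DP cd); do 2?case: eqP.
have nf z : fconnect (@node (smooth d)) d (node (z : dart (smooth d))) = fconnect (@node (smooth d)) d z.
  by rewrite -same_fconnect1_r.
have nf2 z : fconnect (@node (smooth d)) (opp d) (node (z : dart (smooth d))) = fconnect (@node (smooth d)) (opp d) z.
  by rewrite -same_fconnect1_r.
rewrite (vertex_prod_extract Si (x := d)) // (vertex_prod_extract Si (x := opp d)) //; last first.
- by rewrite f1 !inE /opp (node2_eq cd) (node_injE DP) (negPf (td_node_neq DP _)).
- by move=> z; apply: (congr1 negb (nf z)).
rewrite mulrA; congr (_ * _ * _).
- by rewrite weight_marked ?nS ?(vertex_refl d) //= eqxx.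
- rewrite weight_marked ?nS // -[node (opp d)](smooth_node2 DP cd) //.
apply: eq_vertex_prod => [x|z|x|x].
- rewrite /= f1 f2  (same_vertexE DP) !inE /opp -negb_or; by do 4?case: eqP.
- by apply: (congr2 (fun u v => ~~ u && ~~ v) (nf z) (nf2 z)).
- rewrite /= f1 f2 => xo; apply: smooth_node_out.
  by move: xo; rewrite !inE /opp; do 4?case: eqP.
rewrite /= f1 f2 => xo; apply: (@weight_hom _ _ _ _ _ D (smooth d) id) => // y xy.
symmetry; apply: (@smooth_node_out D d); have xd : x \notin vertex d.
  by move: xo; rewrite !inE /opp; do 4?case: eqP.
apply: contra xd => yd; apply: (vertex_trans DP _ yd).
by rewrite vertex_sym // -same_vertexE.
Qed.

Lemma outer_weight_node k m : outer_weight (node d) k m = rest k m.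
Proof.
apply: eq_bigl => x; congr (_ && ~~ _).
by rewrite /same_vertex -same_fconnect1 //; apply: node_inj.
Qed.

Lemma outer_weight_switch k m : outer_weight (d : dart (switch d)) k m = rest k m.
Proof.
apply: eq_vertex_prod => // [x|x xo]; first by congr (~~ _); apply: same_vertex_node.
symmetry; apply: (@weight_hom _ _ _ _ _ (switch d) D id) => //= _.
by rewrite [same_vertex _ _](negbTE xo) addbF.
Qed.

End Crossing.

Lemma state_sum_smooth_node (D : tgraph) (d : dart D) (DP : is_diagram D) (cd : crossing d) :
  Z (smooth (node d)) =
  \sum_(k : {ffun dart D -> 'I_N} | tied_colouring k && (k d == k (node d)))
    \sum_(m : {ffun dart D -> 'I_M} | edge_labelling edge m)
      (delta R (m (node d)) (m (opp d)) * delta R (m (node (opp d))) (m d)) * outer_weight d k m.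
Proof.
rewrite state_sum_smooth ?(crossing_node DP) //; apply: eq_big => [k|k _].
  case: (boolP (tied_colouring k)) => //= kt.
  by rewrite -[node (node d)]/(opp d) (tied_opp DP kt cd) eq_sym.
apply: eq_bigr => m _; rewrite outer_weight_node // /opp (nodeK4 DP) //.
Qed.

Lemma weight_switch (D : tgraph) (d : dart D) (k : dart D -> 'I_N) (m : dart D -> 'I_M) :
  is_diagram D -> crossing d -> tied_colouring k ->
  wt k m d + wt (D := switch d) k m d =
  if k d == k (node d) then (A + A') *
    (delta R (m d) (m (node d)) * delta R (m (opp d)) (m (node (opp d))) +
     delta R (m (node d)) (m (opp d)) * delta R (m (node (opp d))) (m d)) else 0.
Proof.
move=> DP cd kt; rewrite -tensor_switch.
have osw : @over (switch d) d = ~~ over d by rewrite /= /same_vertex connect0 addbT.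
have o4 : opp (opp d) = d by rewrite /opp (nodeK4 DP).
case: (boolP (over d)) => od.
  rewrite [wt k m d in LHS]weight_over // (@weight_under _ _ _ _ _ (switch d)) ?osw ?od //.
  rewrite -[@opp (switch d)]/(@opp D) /= o4 (tied_opp DP kt cd) //.
rewrite addrC (@weight_over _ _ _ _ _ (switch d)) ?osw ?od // weight_under //.
by rewrite -[@opp (switch d)]/(@opp D) /= o4 (tied_opp DP kt cd).
Qed.

Lemma state_sum_switch (D : tgraph) (d : dart D) : is_diagram D -> crossing d ->
  Z D + Z (switch d) = (A + A') * (Z (smooth d) + Z (smooth (node d))).
Proof.
move=> DP cd; have WP := switch_diagram d DP.
rewrite (state_sum_extract d DP) (@state_sum_extract (switch d) d WP) -big_split /=.
rewrite state_sum_smooth // state_sum_smooth_node // -[X in _ * X]big_split mulr_sumr [RHS]big_mkcondr /=.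
apply: eq_bigr => k kt; rewrite -big_split /=.
rewrite (eq_bigr (fun m : {ffun dart D -> 'I_M} => (wt k m d + wt (D := switch d) k m d) * outer_weight d k m)); last first.
  by move=> m _; rewrite outer_weight_switch // mulrDl.
case: ifP => kk; last by rewrite big1 // => m _; rewrite weight_switch // kk mul0r.
rewrite -big_split mulr_sumr; apply: eq_bigr => m _.
by rewrite weight_switch // kk /=; ring.
Qed.

Lemma state_sum_skein (D : tgraph) (d : dart D) : is_diagram D -> crossing d -> over d ->
  tie d (node d) -> Z D = A * Z (A_smoothing d) + A' * Z (B_smoothing d).
Proof.
move=> DP cd od td; rewrite (state_sum_extract d DP) /A_smoothing /B_smoothing.
rewrite state_sum_smooth_node // state_sum_smooth // !mulr_sumr -big_split /=.
apply: eq_big => [k|k /tied_colouringP kt].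
  case: (boolP (tied_colouring k)) => //= /tied_colouringP kt; apply/esym/eqP; exact: kt.
rewrite !mulr_sumr -big_split; apply: eq_bigr => m _.
rewrite weight_over // tensor_eq ?(kt _ _ td) // /smoothings (deltaC R (m d) (m (node (opp d)))) /=.
by ring.
Qed.

End Moves.

Lemma vertex_prod_seq (R : comPzRingType) (T : finType) (f : T -> T) (Q : pred T)
    (w : T -> R) (r : seq T) :
  injective f -> (forall z, Q (f z) = Q z) -> (forall z, w (f z) = w z) -> all Q r ->
  pairwise (fun x y => ~~ fconnect f x y) r ->
  vertex_prod f Q w =
  (\prod_(x <- r) w x) * vertex_prod f (fun y => Q y && ~~ has (fun x => fconnect f x y) r) w.
Proof.
move=> fi Qf wf; elim: r Q Qf => [|x r IH] Q Qf /=.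
  by rewrite big_nil mul1r => _ _; apply: eq_bigl => y; rewrite andbT.
case/andP=> Qx Qr /andP[xr pr]; rewrite (vertex_prod_extract fi Qf wf Qx) big_cons -mulrA.
congr (_ * _); rewrite IH //.
- by congr (_ * _); apply: eq_bigl => y /=; rewrite negb_or !andbA.
- by move=> z; rewrite /= Qf -(same_fconnect1_r fi).
- by apply/allP=> y yr; rewrite /= (allP Qr) // (allP xr).
Qed.

Section Averaging.
Variables (R : fieldType) (T : finType) (M : nat) (e : T -> T).
Hypotheses (eK : involutive e) (M0 : M%:R != 0 :> R).

(* Averaging over the labels of the edges through the darts in xs. *)
Fixpoint relabel_sum (xs : seq T) (F : {ffun T -> 'I_M} -> R) (m : {ffun T -> 'I_M}) : R :=
  if xs is x :: xs' then \sum_i relabel_sum xs' F (relabel e m x i) else F m.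

(** The identities for moves II and III hold only after summation over the labels of the inner
    edges. Averaging over these labels makes such a local identity applicable without splitting a
    labelling into an inner and an outer part; each average costs a factor M, to be cancelled. *)
Lemma eq_relabel_sums xs (F G : {ffun T -> 'I_M} -> R) :
  (forall m : {ffun T -> 'I_M}, edge_labelling e m -> relabel_sum xs F m = relabel_sum xs G m) ->
  \sum_(m : {ffun T -> 'I_M} | edge_labelling e m) F m =
  \sum_(m : {ffun T -> 'I_M} | edge_labelling e m) G m.
Proof.
have avg F' : \sum_(m : {ffun T -> 'I_M} | edge_labelling e m) relabel_sum xs F' m =
    M%:R ^+ size xs * \sum_(m : {ffun T -> 'I_M} | edge_labelling e m) F' m.
  elim: xs => [|x xs IH] /=; first by rewrite expr0 mul1r.
  by rewrite (sum_relabel eK (relabel_sum xs F')) IH mulrA -exprS.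
move=> FG; apply: (mulfI (expf_neq0 (size xs) M0)); rewrite -!avg.
exact: eq_bigr.
Qed.

End Averaging.

(** * Invariance under moves II and III *)

Section Moves.
Variables (R : fieldType) (N M : nat) (A A' : R).
Hypotheses (AA' : A * A' = 1) (MA : M%:R = - (A ^+ 2 + A' ^+ 2)) (M0 : M%:R != 0 :> R).

Local Notation Z D := (state_sum N M A A' D).
Local Notation wt := (weight A A').

Section Bigon.
Variables (D : tgraph) (a b : dart D).
Hypotheses (DP : is_diagram D) (ab : bigon a b).
Let E := remove_bigon a b.
Let s := vertex a ++ vertex b.
Let v := nth a s.

Let bigon_vE i j : (i < 8)%N -> (j < 8)%N -> (v i == v j) = (i == j).
Proof.
have [/andP[ca cb] nab _ _ _] := ab.
move=> i8 j8; rewrite nth_uniq // cat_uniq !vertex_uniq // andbT.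
by apply/hasPn=> x xb; apply/negP=> xa; apply: (vertex_disjoint DP nab xa xb).
Qed.

Let bigon_outside x y : x \notin s -> y \in vertex x -> y \notin s.
Proof.
move=> xs xy; apply: contra xs; rewrite !mem_cat; rewrite vertex_sym // in xy.
by case/orP=> h; rewrite (vertex_trans DP xy h) ?orbT.
Qed.

Let rest (k : dart D -> 'I_N) (m : dart D -> 'I_M) := vertex_prod node (fun y => y \notin s) (wt k m).

Let prod_D (k : dart D -> 'I_N) m : tied_colouring k ->
  vertex_prod node predT (wt k m) = wt k m a * wt k m (node b) * rest k m.
Proof.
move=> kt; have [_ nab _ _ _] := ab.
(* The second vertex is represented by [node b], which is [edge a] and thus goes over. *)
rewrite (@vertex_prod_seq _ _ node predT _ [:: a; node b]) //; last first.
- rewrite /= !andbT -/(same_vertex a (node b)) same_vertex_node //.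
- by move=> z; apply: weight_node.
- exact: node_inj.
rewrite !big_cons big_nil mulr1; congr (_ * _); apply: eq_bigl => y; congr (_ && _).
rewrite /= orbF mem_cat -!same_vertexE // /same_vertex.
by rewrite -(same_fconnect1 (node_inj DP) b).
Qed.

Hypothesis EP : is_diagram E.

Let prod_E (k : dart D -> 'I_N) m : tied_colouring k ->
  vertex_prod node predT (wt (D := E) k m) =
  delta R (m a) (m (opp a)) * delta R (m (node a)) (m (node (opp a))) *
  (delta R (m b) (m (opp b)) * delta R (m (node b)) (m (node (opp b)))) * rest k m.
Proof.
move=> kt; have kE : tied_colouring (D := E) k by [].
have nE (x : dart D) : x \in s -> @node E x = opp x.
  by move=> xs; rewrite /= !same_vertexE // -mem_cat xs.
have cE (x : dart D) : x \in s -> ~~ @crossing E x.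
  by move=> xs; rewrite (bigon_crossing DP) -mem_cat xs andbF.
have so (x : dart D) : (opp x \in s) = (x \in s) by rewrite /opp !mem_cat !vertex_node.
have fE (x y : dart D) : x \in s -> fconnect (@node E) x y = (y \in [:: x; opp x]).
  move=> xs; rewrite -/(@same_vertex E x y) (same_vertexE EP) !inE.
  rewrite !nE ?so // /opp (nodeK4 DP).
  by do 2?case: eqP.
have sv i : (i < 8)%N -> v i \in s by move=> i8; apply: mem_nth.
rewrite (@vertex_prod_seq _ _ (@node E) predT _ [:: v 0; v 1; v 4; v 5]%N) //; last first.
- by rewrite /= !fE ?sv // !inE -[opp (v 0)]/(v 2) -[opp (v 1)]/(v 3) -[opp (v 4)]/(v 6) !bigon_vE.
- by move=> z; apply: weight_node.
- exact: node_inj.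
rewrite !big_cons big_nil mulr1 !weight_marked ?cE ?sv // !nE ?sv // !mulrA; congr (_ * _).
have QE y : predT y && ~~ has (fun x => fconnect (@node E) x y) [:: v 0; v 1; v 4; v 5]%N =
    (y \notin s).
  by rewrite /= !fE ?sv // /s !mem_cat !inE; congr (~~ _); rewrite orbF -!orbA; do !bool_congr.
have nO (x : dart D) : x \notin s -> @node E x = node x.
  by move=> xs; rewrite /= !same_vertexE // -mem_cat (negPf xs).
apply: eq_vertex_prod => [y|z|x|x]; first exact: QE.
- congr (~~ _); apply: eq_has => x; exact/esym/(same_fconnect1_r (node_inj EP)).
- by rewrite QE; apply: nO.
rewrite QE => xs; apply: (@weight_hom _ _ _ _ _ D E id) => // y xy.
by rewrite nO //; rewrite same_vertexE // in xy; apply: bigon_outside xs xy.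
Qed.

Lemma state_sum_bigon : Z E = Z D.
Proof.
have [/andP[ca cb] nab [ea eb] _ /andP[oa oea]] := ab.
have eK := td_edgeK DP.
apply: eq_bigr => k kt; under eq_bigr => m _ do rewrite prod_E //.
under [RHS]eq_bigr => m _ do rewrite prod_D //.
have kt' := elimT (tied_colouringP k) kt.
have kb : k (node b) = k a by apply/esym/kt'; rewrite -ea; apply: td_tie_edge DP _.
have kb2 : k (opp b) = k (node a).
  by rewrite (tied_opp DP kt cb) -eb; apply/kt'/(td_tie_edge DP).
(* The sides of the bigon are the edges of [a] and of [node a]; their labels i and j are summed, the
   others being fixed. *)
apply: (eq_relabel_sums (xs := [:: a; node a]) eK M0) => m me /=.
pose m' i j := relabel edge (relabel edge m a i) (node a) j.
have ena : edge (node a) = b by rewrite -eb eK.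
have mE i j y : m' i j y = if (y == v 1) || (y == v 4) then j
    else if (y == v 0) || (y == v 5) then i else m y.
  by rewrite !ffunE ea ena.
have out i j y : y \notin s -> m' i j y = m y.
  rewrite mem_cat !inE !negb_or => /andP[/and4P[/negPf y0 /negPf y1 _ _]].
  by case/and4P=> [/negPf y4 /negPf y5 _ _]; rewrite mE y0 y1 y4 y5.
have rE i j : rest k (m' i j) = rest k m.
  apply: eq_vertex_prod => [//|z|//|z zs]; first by rewrite !mem_cat !vertex_node.
  by apply: weight_local => y; rewrite same_vertexE // => zy; rewrite out // (bigon_outside zs).
have mv i j n : (n < 8)%N -> m' i j (v n) = if (n == 1)%N || (n == 4)%N then j
    else if (n == 0)%N || (n == 5)%N then i else m (v n).
  by move=> n8; rewrite mE !bigon_vE.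
have va i j : (m' i j a = i) * (m' i j (node a) = j) *
    (m' i j (opp a) = m (opp a)) * (m' i j (node (opp a)) = m (node (opp a))).
  by split; [split; [split|]|]; [exact: (mv i j 0%N)|exact: (mv i j 1%N)|exact: (mv i j 2)|exact: (mv i j 3)].
have vb i j : (m' i j b = j) * (m' i j (node b) = i) *
    (m' i j (opp b) = m (opp b)) * (m' i j (node (opp b)) = m (node (opp b))).
  by split; [split; [split|]|]; [exact: (mv i j 4)|exact: (mv i j 5)|exact: (mv i j 6)|exact: (mv i j 7)].
transitivity ((\sum_i \sum_j (delta R i (m (opp a)) * delta R j (m (node (opp a)))) *
    (delta R j (m (opp b)) * delta R i (m (node (opp b))))) * rest k m).
  rewrite mulr_suml; apply: eq_bigr => i _; rewrite mulr_suml; apply: eq_bigr => j _.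
  by rewrite -/(m' i j) rE !va !vb.
rewrite -(R2_tensor AA' MA (k a) (k (node a))) mulr_suml; apply: eq_bigr => i _.
rewrite mulr_suml; apply: eq_bigr => j _; rewrite -/(m' i j) rE; congr (_ * _).
rewrite [X in _ = X * _]weight_over // weight_over ?(crossing_node DP) -?ea //.
rewrite ea kb -[node (node b)]/(opp b) kb2 !va vb.
have -> : node (opp (node b)) = b by rewrite /opp (nodeK4 DP).
by rewrite -[opp (node b)]/(node (opp b)) !vb.
Qed.

End Bigon.

Section Triangle.
Variables (D : tgraph) (a b c : dart D).
Hypotheses (DP : is_diagram D) (abc : triangle a b c).
Let E := flip_triangle a b c.
Let s := tri_darts a b c.
Let v := nth a s.

Let rest (k : dart D -> 'I_N) (m : dart D -> 'I_M) := vertex_prod node (fun y => y \notin s) (wt k m).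

Let prod_D (k : dart D -> 'I_N) m : tied_colouring k ->
  vertex_prod node predT (wt k m) = wt k m a * wt k m (node b) * wt k m c * rest k m.
Proof.
move=> kt; have [_ /and3P[nab nbc nca] _ _ _] := abc.
rewrite (@vertex_prod_seq _ _ node predT _ [:: a; node b; c]) //; last first.
- rewrite /= !andbT -/(same_vertex a (node b)) same_vertex_node // nab.
  rewrite -(same_fconnect1 (node_inj DP) b) [fconnect _ b c](negPf nbc) andbT /=.
  by rewrite fconnect_sym //; apply: node_inj.
- by move=> z; apply: weight_node.
- exact: node_inj.
rewrite !big_cons big_nil mulr1 !mulrA; congr (_ * _); apply: eq_bigl => y; congr (_ && _).
rewrite /= orbF /s /tri_darts !mem_cat -!same_vertexE // /same_vertex.
by rewrite -(same_fconnect1 (node_inj DP) b).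
Qed.

Let outside x y : x \notin s -> y \in vertex x -> y \notin s.
Proof.
move=> xs xy; apply: contra xs; rewrite !mem_cat; rewrite vertex_sym // in xy.
by case/or3P=> h; rewrite (vertex_trans DP xy h) ?orbT.
Qed.

Lemma state_sum_triangle : Z E = Z D.
Proof.
have [/and3P[ca cb cc] /and3P[nab nbc nca] [ea eb ec] _ /andP[oa oea]] := abc.
have eK := td_edgeK DP.
suff key (k : {ffun dart D -> 'I_N}) : tied_colouring k ->
    \sum_(m : {ffun dart E -> 'I_M} | edge_labelling (@edge E) m)
      vertex_prod (@node E) predT (wt (D := E) k m) =
    \sum_(m : {ffun dart D -> 'I_M} | edge_labelling edge m) vertex_prod node predT (wt k m).
  by apply: eq_bigr => k; apply: key.
move=> kt.
have kt' := elimT (tied_colouringP k) kt.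
have kb : k (node b) = k a by apply/esym/kt'; rewrite -ea; apply: td_tie_edge DP _.
have kna : k (node a) = k c by rewrite -ec; apply/esym/kt'/(td_tie_edge DP).
have knc : k (node c) = k b by rewrite -eb; apply/esym/kt'/(td_tie_edge DP).
have inK := inwardK DP abc; have ouK := outwardK DP abc.
pose inw := inward a b c; pose ouw := outward a b c.
(* The edges of the new diagram are conjugate to those of D by [outward], so its labellings are
   those of D read through [inw], and both sides become sums over labellings of D. *)
rewrite (sum_ffun_onto (h := ouw) (h' := inw)) => [|//|m _ y]; last by rewrite /ouw /inw inK.
transitivity (\sum_(m : {ffun dart D -> 'I_M} | edge_labelling edge m)
    vertex_prod node predT (wt k (fun x => m (inw x)))).
  apply: eq_big => [m|m _].
    apply/edge_labellingP/edge_labellingP => me x.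
      by have := me (ouw x); rewrite !ffunE [edge _]flip_edgeE /inw /ouw !ouK.
    by rewrite !ffunE [edge _]flip_edgeE /inw ouK me.
  by apply: eq_vertex_prod => // z _; apply: (@weight_hom _ _ _ _ _ D E id) => // y _; rewrite ffunE.
under eq_bigr => m _ do rewrite prod_D //.
under [RHS]eq_bigr => m _ do rewrite prod_D //.
apply: (eq_relabel_sums (xs := [:: a; b; c]) eK M0) => m me /=.
pose m' i j l := relabel edge (relabel edge (relabel edge m a i) b j) c l.
(* The labels at v 0, ..., v 11 when the sides [a], [b], [c] carry i, j, l; for v 10 and v 11 the
   default of [nth] supplies the old label. *)
pose lbl i j l n := nth (m (v n)) [:: i; l; m (v 2); m (v 3); j; i; m (v 6); m (v 7); l; j] n.
have mE i j l y : m' i j l y = if (y == v 8) || (y == v 1) then l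
    else if (y == v 4) || (y == v 9) then j
    else if (y == v 0) || (y == v 5) then i else m y.
  by rewrite !ffunE ea eb ec.
have mv i j l n : (n < 12)%N -> m' i j l (v n) = lbl i j l n.
  move=> n12; rewrite mE !(tri_vE DP abc) //.
  by move: n12; do 12?[case: n => [|n]].
have out i j l y : y \notin s -> m' i j l y = m y.
  move=> ys; have vy n : (n < 12)%N -> (y == v n) = false.
    by move=> n12; apply: contraNF ys => /eqP->; apply: tri_s_v.
  by rewrite mE !vy.
have rE i j l : rest k (m' i j l) = rest k m.
  apply: eq_vertex_prod => [//|z|//|z zs]; first by rewrite !mem_cat !vertex_node.
  by apply: weight_local => y; rewrite same_vertexE // => zy; rewrite out // (outside zs).
have rE' i j l : rest k (fun x => m' i j l (inw x)) = rest k m.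
  apply: eq_vertex_prod => [//|z|//|z zs]; first by rewrite !mem_cat !vertex_node.
  apply: weight_local => y; rewrite same_vertexE // => zy; have ys := outside zs zy.
  by rewrite /inw (tri_inw_out DP abc ys) out.
(* Only the side [a] is known to go over, so the crossing of the two lower strands can be of either
   kind. *)
pose Wc (x y z t : 'I_M) := if over c then tensor A A' (k c) (k b) x y z t
  else tensor A A' (k b) (k c) y z t x.
have wa (n : dart D -> 'I_M) :
    wt k n a = tensor A A' (k a) (k c) (n (v 0%N)) (n (v 1%N)) (n (v 2)) (n (v 3)).
  by rewrite weight_over // kna.
have wb (n : dart D -> 'I_M) :
    wt k n (node b) = tensor A A' (k a) (k b) (n (v 5)) (n (v 6)) (n (v 7)) (n (v 4)).
  have ob : over (node b) by rewrite -ea.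
  rewrite weight_over ?(crossing_node DP) // kb -[node (node b)]/(opp b) (tied_opp DP kt cb).
  by rewrite /opp (nodeK4 DP).
have wc (n : dart D -> 'I_M) : wt k n c = Wc (n (v 8)) (n (v 9)) (n (v 10)) (n (v 11)).
  rewrite /Wc; case: (boolP (over c)) => oc; first by rewrite weight_over // knc.
  by rewrite weight_under // knc (tied_opp DP kt cc) /opp (nodeK4 DP).
have vi n : (n < 12)%N -> inw (v n) = v (inw_in n) by apply: tri_inw_v.
transitivity ((\sum_i \sum_j \sum_l tensor A A' (k a) (k c) (m (v 7)) (m (v 10)) i l *
    tensor A A' (k a) (k b) (m (v 2)) j i (m (v 11)) * Wc (m (v 3)) (m (v 6)) l j) * rest k m).
  rewrite mulr_suml; apply: eq_bigr => i _; rewrite mulr_suml; apply: eq_bigr => j _.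
  rewrite mulr_suml; apply: eq_bigr => l _.
  by rewrite -/(m' i j l) rE' wa wb wc !vi // !mv.
rewrite -(R3_tensor AA' MA); last 2 first.
- rewrite /Wc => ->; case: (over c); [exists A, A'|exists A', A] => x y z t; rewrite tensor_eq //.
  by rewrite /smoothings (deltaC R y x) (deltaC R t x); ring.
- rewrite /Wc => cb'; case: (over c).
    by exists (if (k c < k b)%N then -1 else 1) => x y z t; rewrite tensor_neq.
  exists (if (k b < k c)%N then -1 else 1) => x y z t; rewrite tensor_neq 1?eq_sym //.
  by rewrite /passing (deltaC R z x) (mulrC (delta R y t)).
rewrite mulr_suml; apply: eq_bigr => i _; rewrite mulr_suml; apply: eq_bigr => j _.
rewrite mulr_suml; apply: eq_bigr => l _.
by rewrite -/(m' i j l) rE wa wb wc !mv.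
Qed.

End Triangle.

End Moves.

Import Num.Theory.

Lemma poly_many_roots (R : idomainType) (p : {poly R}) (g : nat -> R) :
  injective g -> (forall n, p.[g n] = 0) -> p = 0.
Proof.
move=> gi pg; apply/eqP; apply: contraT => p0.
have := max_poly_roots (rs := map g (iota 0 (size p))) p0.
rewrite size_map size_iota ltnn; apply.
  by apply/allP=> _ /mapP[n _ ->]; apply/rootP.
by rewrite map_inj_uniq ?iota_uniq.
Qed.

(** * Evaluation of Laurent polynomials *)

Section Evaluation.
Variables (F : numFieldType).

Definition ev (a c : F) (p : {poly {poly int}}) : F :=
  (map_poly (map_poly intr) p).[a%:P].[c].

Lemma evD a c p q : ev a c (p + q) = ev a c p + ev a c q.
Proof. by rewrite /ev rmorphD !hornerE. Qed.

Lemma evM a c p q : ev a c (p * q) = ev a c p * ev a c q.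
Proof. by rewrite /ev rmorphM !hornerE. Qed.

Lemma evXn a c n : ev a c 'X^n = a ^+ n.
Proof. by rewrite /ev map_polyXn hornerXn horner_exp hornerC. Qed.

Lemma evC a c : ev a c ('X%:P) = c.
Proof. by rewrite /ev map_polyC hornerC /= map_polyX hornerX. Qed.

(** For fixed m the numbers c = (n + 1)(m + 1) are infinitely many, so p vanishes identically in c
    at A = a m; the same argument applies again as m varies. *)
Lemma ev_eq0 (a : nat -> F) p : injective a ->
  (forall m n, ev (a m) (n.+1 * m.+1)%:R p = 0) -> p = 0.
Proof.
move=> ai e0.
have ii : injective (map_poly (intr : int -> F)) by apply: map_inj_poly => // x y /intr_inj.
apply: (map_inj_poly ii (rmorph0 _)); rewrite rmorph0.
apply: (poly_many_roots (g := fun m => (a m)%:P)) => [m n /polyC_inj /ai //|m].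
apply: (poly_many_roots (g := fun n => (n.+1 * m.+1)%:R)) => [x y /eqP|n]; last exact: e0.
by rewrite eqr_nat eqn_pmul2r // eqSS => /eqP.
Qed.

(* x takes the value v at A = a, c = g. *)
Definition has_value (a g : F) (x : Kfrac) (v : F) : Prop :=
  exists p n, x = FracField.tofrac p / varA ^+ n /\ ev a g p = v * a ^+ n.

Variables (a g : F).
Hypothesis a0 : a != 0.
Local Notation value := (has_value a g).

Lemma varA_neq0 : varA != 0.
Proof. by rewrite /varA tofrac_eq0 polyX_eq0. Qed.

Lemma varAXn n : varA ^+ n = FracField.tofrac 'X^n.
Proof. by rewrite /varA rmorphXn. Qed.

Lemma has_valueD x y v w : value x v -> value y w -> value (x + y) (v + w).
Proof.
move=> [p [n [-> pv]]] [q [m [-> qw]]].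
exists (p * 'X^m + q * 'X^n), (n + m)%N; split.
  rewrite addf_div ?expf_neq0 ?varA_neq0 // exprD.
  by rewrite tofracD !tofracM !tofracXn.
by rewrite evD !evM !evXn pv qw exprD; ring.
Qed.

Lemma has_valueM x y v w : value x v -> value y w -> value (x * y) (v * w).
Proof.
move=> [p [n [-> pv]]] [q [m [-> qw]]]; exists (p * q), (n + m)%N; split.
  by rewrite tofracM mulf_div exprD.
by rewrite evM pv qw exprD; ring.
Qed.

Lemma has_value_int z : value z%:~R z%:~R.
Proof.
exists z%:~R, 0%N; split; first by rewrite rmorph_int expr0 divr1.
by rewrite /ev !rmorph_int expr0 mulr1 -!polyCMz !hornerC.
Qed.

Lemma has_value_varA : value varA a.
Proof. by exists 'X^1, 0%N; rewrite expr0 divr1 -varAXn evXn mulr1. Qed.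

Lemma has_value_varAV : value varA^-1 a^-1.
Proof.
exists 1, 1%N; rewrite rmorph1 div1r expr1 mulVf //; split=> //.
by rewrite /ev rmorph1 hornerC hornerC.
Qed.

Lemma has_value_varc : value varc g.
Proof. by exists ('X%:P), 0%N; rewrite expr0 divr1 mulr1 evC. Qed.

Lemma has_valueN x v : value x v -> value (- x) (- v).
Proof. by move=> xv; rewrite -mulN1r -[- v]mulN1r; apply: has_valueM xv; apply: (has_value_int (-1)). Qed.

(** Two presentations of x as p / A^n become equal polynomials after cross-multiplication, and a
    power of the nonzero number a can be cancelled from their values. *)
Lemma has_value_unique x v w : value x v -> value x w -> v = w.
Proof.
move=> [p [n [-> pv]]] [q [m [e qw]]].
have An k : varA ^+ k != 0 by rewrite expf_neq0 ?varA_neq0.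
move/eqP: e; rewrite eqr_div // !varAXn -!tofracM tofrac_eq => /eqP e.
have := congr1 (ev a g) e; rewrite !evM !evXn pv qw -!mulrA -exprD [a ^+ m * _]mulrC -exprD.
by move/(mulIf (expf_neq0 _ a0)).
Qed.

End Evaluation.

(** With M = m + 1, the square t of this number is a root of t^2 + M t + 1 = 0, that is, M = -(t +
    t^-1). *)
Definition kauffman_var (m : nat) : algC :=
  sqrtC ((- m.+1%:R + sqrtC (m.+1%:R ^+ 2 - 4)) / 2).

Lemma kauffman_varP m :
  kauffman_var m != 0 /\
  m.+1%:R = - (kauffman_var m ^+ 2 + (kauffman_var m)^-1 ^+ 2).
Proof.
set a := kauffman_var m; set M : algC := m.+1%:R.
have t2 : (2 * a ^+ 2 + M) ^+ 2 = M ^+ 2 - 4.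
  rewrite /a /kauffman_var -/M sqrtCK mulrC divfK ?pnatr_eq0 // addrAC addNr add0r.
  exact: sqrtCK.
have a2 : a ^+ 2 * (a ^+ 2 + M) = -1.
  apply: (mulfI (x := 4)); first by rewrite pnatr_eq0.
  have -> : 4 * (a ^+ 2 * (a ^+ 2 + M)) = (2 * a ^+ 2 + M) ^+ 2 - M ^+ 2 by ring.
  by rewrite t2; ring.
have a0 : a != 0.
  by apply: contra_eq_neq a2 => ->; rewrite expr0n mul0r eq_sym oppr_eq0 oner_eq0.
split=> //; apply: (mulfI (expf_neq0 2 a0)).
have -> : a ^+ 2 * - (a ^+ 2 + a^-1 ^+ 2) = - (a ^+ 2 * a ^+ 2) - (a * a^-1) ^+ 2 by ring.
by rewrite divff // expr1n -[1 in RHS]opprK -a2; ring.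
Qed.

Lemma kauffman_var_inj : injective kauffman_var.
Proof.
move=> m n e; have [_ em] := kauffman_varP m; have [_ en] := kauffman_varP n.
by have /eqP := em; rewrite e -en eqr_nat eqSS => /eqP.
Qed.

Definition normalized_sum (m n : nat) (D : tgraph) : algC :=
  state_sum n.+1 m.+1 (kauffman_var m) (kauffman_var m)^-1 D / (n.+1 * m.+1)%:R.

(* The state sums with n.+1 colours and m.+1 labels determine the bracket, of which they are
   the values at c = n.+1 * m.+1 and at a root A of - (A^2 + A^-2) = m.+1. *)
Definition bracket_of (D : tgraph) (x : Kfrac) : Prop :=
  forall m n, has_value (kauffman_var m) (n.+1 * m.+1)%:R x (normalized_sum m n D).

(** * The rules for normalised state sums *)

Section Rules.
Variables m n : nat.
Local Notation a := (kauffman_var m).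
Local Notation g := ((n.+1 * m.+1)%:R : algC).
Local Notation sum := (normalized_sum m n).
Let a0 : a != 0. Proof. by case: (kauffman_varP m). Qed.
Let aa : a * a^-1 = 1. Proof. exact: divff. Qed.
Let Ma : m.+1%:R = - (a ^+ 2 + a^-1 ^+ 2). Proof. by case: (kauffman_varP m). Qed.
Let M0 : m.+1%:R != 0 :> algC. Proof. by rewrite pnatr_eq0. Qed.
Let g0 : g != 0. Proof. by rewrite pnatr_eq0 muln_eq0. Qed.

Lemma sum_isom (D E : diagram) : isom D E -> sum E = sum D.
Proof. by move=> DE; rewrite /normalized_sum (state_sum_isom _ _ _ _ (dgmP D) DE). Qed.

Lemma sum_subdivide (D E : diagram) (d : dart E) : isom D (subdivide d) -> sum D = sum E.
Proof.
move=> DE; rewrite /normalized_sum -(state_sum_isom _ _ _ _ (dgmP D) DE).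
by rewrite state_sum_subdivide //; apply: dgmP.
Qed.

Lemma sum_circle (D : diagram) : isom D circle -> sum D = 1.
Proof.
move=> DE; rewrite /normalized_sum -(state_sum_isom _ _ _ _ (dgmP D) DE).
by rewrite state_sum_circle -natrM divff.
Qed.

Lemma sum_add_circle (D E : diagram) (d : dart E) t : isom D (add_circle d t) ->
  sum D = (if t is Some _ then - (a ^+ 2 + a^-1 ^+ 2) else g) * sum E.
Proof.
move=> DE; rewrite /normalized_sum -(state_sum_isom _ _ _ _ (dgmP D) DE).
rewrite state_sum_add_circle; last exact: dgmP.
by case: t DE => [e|] _; rewrite -?Ma -?natrM mulrA.
Qed.

Lemma sum_skein (D DA DB : diagram) (d : dart D) :
  crossing d -> over d -> tie d (node d) -> isom DA (A_smoothing d) -> isom DB (B_smoothing d) ->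
  sum D = a * sum DA + a^-1 * sum DB.
Proof.
move=> cd od td iA iB; rewrite /normalized_sum (state_sum_skein _ _ _ _ (dgmP D) cd od td).
rewrite (state_sum_isom _ _ _ _ (dgmP DA) iA) (state_sum_isom _ _ _ _ (dgmP DB) iB).
by rewrite mulrDl !mulrA.
Qed.

Lemma sum_switch (D D' De Df : diagram) (d : dart D) :
  crossing d -> isom D' (switch d) -> isom De (smooth d) -> isom Df (smooth (node d)) ->
  sum D + sum D' = (a + a^-1) * (sum De + sum Df).
Proof.
move=> cd i' ie jf; rewrite /normalized_sum -mulrDl -(state_sum_isom _ _ _ _ (dgmP D') i').
rewrite (state_sum_switch _ _ _ _ (dgmP D) cd).
rewrite (state_sum_isom _ _ _ _ (dgmP De) ie) (state_sum_isom _ _ _ _ (dgmP Df) jf).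
by rewrite -mulrA -[in RHS]mulrDl.
Qed.

Lemma sum_R2 (D E : diagram) (x y : dart D) :
  bigon x y -> isom E (remove_bigon x y) -> sum D = sum E.
Proof.
move=> xy DE; rewrite /normalized_sum -(state_sum_isom _ _ _ _ (dgmP E) DE).
rewrite (state_sum_bigon _ aa Ma M0 (dgmP D) xy) //.
by apply: remove_bigon_diagram xy; apply: dgmP.
Qed.

Lemma sum_R3 (D E : diagram) (x y z : dart D) :
  triangle x y z -> isom E (flip_triangle x y z) -> sum D = sum E.
Proof.
move=> xyz DE; rewrite /normalized_sum -(state_sum_isom _ _ _ _ (dgmP E) DE).
by rewrite (state_sum_triangle _ aa Ma M0 (dgmP D) xyz).
Qed.

Lemma sum_isotopic (D E : diagram) : isotopic D E -> sum D = sum E.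
Proof.
elim=> {D E} [D E [/sum_isom ->|[d /sum_subdivide ->]]|D|D E _ ->|D E G _ -> _ ->] //.
Qed.

Lemma has_value_tied_loop :
  has_value a g (- (varA ^+ 2 + varA^-1 ^+ 2)) (- (a ^+ 2 + a^-1 ^+ 2)).
Proof.
by apply/has_valueN/has_valueD; apply: has_valueM; (apply: has_value_varA || apply: has_value_varAV).
Qed.

Lemma has_value_A_AV : has_value a g (varA + varA^-1) (a + a^-1).
Proof. by apply: has_valueD; [apply: has_value_varA|apply: has_value_varAV]. Qed.

End Rules.

(** * Existence and uniqueness of the bracket *)

Lemma bracket_of_eq (x y : Kfrac) (v : nat -> nat -> algC) :
  (forall m n, has_value (kauffman_var m) (n.+1 * m.+1)%:R x (v m n)) ->
  (forall m n, has_value (kauffman_var m) (n.+1 * m.+1)%:R y (v m n)) -> x = y.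
Proof.
move=> xv yv; apply/eqP; rewrite -subr_eq0.
have [p [k [xy _]]] := has_valueD (xv 0 0)%N (has_valueN (yv 0 0)%N).
rewrite xy; suff -> : p = 0 by rewrite tofrac0 mul0r.
apply: (ev_eq0 kauffman_var_inj) => m n; have [a0 _] := kauffman_varP m.
have := has_valueD (xv m n) (has_valueN (yv m n)); rewrite subrr => xy0.
have xyp : has_value (kauffman_var m) (n.+1 * m.+1)%:R (x - y)
    (ev (kauffman_var m) (n.+1 * m.+1)%:R p / kauffman_var m ^+ k).
  by exists p, k; rewrite xy divfK ?expf_neq0.
have /eqP := has_value_unique a0 xyp xy0; rewrite mulf_eq0 invr_eq0 expf_eq0 (negPf a0) andbF orbF.
by move/eqP.
Qed.

(** The values are prescribed before the induction starts, so the choices made on the way down do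
    not matter. Rule (vi) is solved for D without division, its coefficient being 1, so the result
    remains a Laurent polynomial. *)
Lemma bracket_of_exists (D : diagram) : exists x, bracket_of D x.
Proof.
elim/diagram_ind_moves: D.
- by move=> D E d DE [x xE]; exists x => m n; rewrite (sum_subdivide _ _ DE).
- by move=> D DE; exists 1%:~R => m n; rewrite (sum_circle _ _ DE); apply: (has_value_int _ _ 1).
- move=> D E d t DE [x xE].
  exists ((if t is Some _ then - (varA ^+ 2 + varA^-1 ^+ 2) else varc) * x) => m n.
  rewrite (sum_add_circle _ _ DE); apply: has_valueM => //.
  by case: (t) => [e|]; [apply: has_value_tied_loop|apply: has_value_varc].
- move=> D DA DB d cd od td iA iB [x xA] [y yB]; exists (varA * x + varA^-1 * y) => m n.
  have [a0 _] := kauffman_varP m; rewrite (sum_skein _ _ cd od td iA iB).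
  by apply: has_valueD; apply: has_valueM => //; [apply: has_value_varA|apply: has_value_varAV].
- move=> D D' De Df d cd i' ie jf [x xD] [y yE] [z zF].
  exists ((varA + varA^-1) * (y + z) - x) => m n.
  have -> : normalized_sum m n D = (kauffman_var m + (kauffman_var m)^-1) *
      (normalized_sum m n De + normalized_sum m n Df) - normalized_sum m n D'.
    by rewrite -(sum_switch _ _ cd i' ie jf) addrK.
  apply: has_valueD (has_valueN (xD m n)); apply: has_valueM; first exact: has_value_A_AV.
  exact: has_valueD.
- by move=> D E a b ab DE [x xE]; exists x => m n; rewrite (sum_R2 _ _ ab DE).
- by move=> D E a b c abc DE [x xE]; exists x => m n; rewrite (sum_R3 _ _ abc DE).
Qed.

(** Choosing a polynomial for each diagram is harmless, since its values determine it; every rule is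
    verified by comparing the values of its two sides. *)
Lemma tied_bracket_exists : exists f, is_tied_bracket f.
Proof.
have [f fP] := functional_choice _ bracket_of_exists.
exists f; split.
- by move=> D; have [p [k [-> _]]] := fP D 0%N 0%N; exists p, k.
- move=> D E DE; apply: (bracket_of_eq (fP D)) => m n.
  by rewrite (sum_isotopic _ _ DE); apply: fP.
- move=> D DO; apply: (bracket_of_eq (fP D)) => m n.
  by rewrite (sum_circle _ _ DO); apply: (has_value_int _ _ 1).
- move=> D E d DE; apply: (bracket_of_eq (fP E)) => m n.
  by rewrite (sum_add_circle _ _ DE); apply: has_valueM (has_value_varc _ _) (fP D m n).
- move=> D E d e DE; apply: (bracket_of_eq (fP E)) => m n.
  rewrite (sum_add_circle _ _ DE) -exprVn.
  exact: has_valueM (has_value_tied_loop m n) (fP D m n).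
- move=> D E a b ab DE; apply: (bracket_of_eq (fP D)) => m n.
  by rewrite (sum_R2 _ _ ab DE); apply: fP.
- move=> D E a b c abc DE; apply: (bracket_of_eq (fP D)) => m n.
  by rewrite (sum_R3 _ _ abc DE); apply: fP.
- move=> D DA DB d cd od td iA iB; apply: (bracket_of_eq (fP D)) => m n.
  have [a0 _] := kauffman_varP m; rewrite (sum_skein _ _ cd od td iA iB).
  by apply: has_valueD; apply: has_valueM (fP _ m n); [apply: has_value_varA|apply: has_value_varAV].
move=> D D' De Df d cd i' ie jf.
apply: (bracket_of_eq (v := fun m n => normalized_sum m n D + normalized_sum m n D')) => m n.
  by apply: has_valueD; apply: fP.
rewrite (sum_switch _ _ cd i' ie jf).
by apply: has_valueM; [apply: has_value_A_AV|apply: has_valueD; apply: fP].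
Qed.

Lemma tied_bracket_unique f g (D : diagram) : is_tied_bracket f -> is_tied_bracket g -> f D = g D.
Proof.
move=> fP gP; elim/diagram_ind_moves: D.
- move=> D E d DE fg; have DE' : isotopic E D.
    by apply: rst_step; right; exists d.
  by rewrite -(tb_isotopy fP DE') -(tb_isotopy gP DE').
- by move=> D DO; rewrite (tb_circle fP DO) (tb_circle gP DO).
- move=> D E d [e|] DE fg.
    by rewrite (tb_tied_union fP DE) (tb_tied_union gP DE) fg.
  by rewrite (tb_union fP DE) (tb_union gP DE) fg.
- move=> D DA DB d cd od td iA iB fA fB.
  by rewrite (tb_skein fP cd od td iA iB) (tb_skein gP cd od td iA iB) fA fB.
- move=> D D' De Df d cd i' ie jf f' fe ff; apply: (addIr (f D')).
  by rewrite (tb_switch fP cd i' ie jf) f' (tb_switch gP cd i' ie jf) fe ff.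
- by move=> D E a b ab DE fg; rewrite (tb_R2 fP ab DE) (tb_R2 gP ab DE).
- by move=> D E a b c abc DE fg; rewrite (tb_R3 fP abc DE) (tb_R3 gP abc DE).
Qed.

Theorem theorem3 :
  exists! f : diagram -> Kfrac, is_tied_bracket f.
Proof.
have [f fP] := tied_bracket_exists.
by exists f; split=> // g gP; apply: functional_extensionality => D; apply: tied_bracket_unique.
Qed.
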